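(* Suppose $\mathbb{E}_{P_0}K_{P_0}(X,X)<\infty$, Stein's identity $\mathbb{E}_{P_0}\xi_{P_0}(X)=0$ holds, and $\operatorname{tr}(C_\star^2)>0$. For every fixed $A\ge4$ and all sufficiently large $n$, \[ \inf_{\widehat T}\ \sup_{P\in\mathcal{P}(A)}\ \mathbb{E}_P\bigl|\widehat T-\mathrm{KSD}(P_0,P)\bigr|\ \asymp_A\ \frac{\operatorname{tr}(C_\star^2)^{1/4}}{\sqrt n}=\sqrt{\frac{\|C_\star\|_{\mathrm{HS}}}{n}}, \] where the infimum is over all estimators $\widehat T$ based on $n$ i.i.d. samples from $P$. Moreover, $\widehat{\mathrm{KSD}}_U$ attains this rate, i.e. $\sup_{P\in\mathcal{P}(A)}\mathbb{E}_P|\widehat{\mathrm{KSD}}_U-\mathrm{KSD}(P_0,P)|\lesssim_A\operatorname{tr}(C_\star^2)^{1/4}/\sqrt n$.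
   Context: $P_0$ is a fixed probability distribution on $\mathcal{X}\subseteq\mathbb{R}^d$ with a continuously differentiable, everywhere positive density $p_0$; its score is $s_0(x)=\nabla\log p_0(x)$. $k\in C^{1,1}(\mathcal{X}\times\mathcal{X})$ is a positive definite kernel with reproducing kernel Hilbert space $\mathcal{H}_k$, and $\mathcal{H}:=\mathcal{H}_k^d$. The Langevin--Stein feature map is $\xi_{P_0}(x):=s_0(x)k(x,\cdot)+\nabla_x k(x,\cdot)\in\mathcal{H}$, and the Stein kernel is $K_{P_0}(x,y):=\langle\xi_{P_0}(x),\xi_{P_0}(y)\rangle_{\mathcal{H}}$. Every sampling distribution $P$ considered is assumed to satisfy $\mathbb{E}_PK_{P_0}(X,X)<\infty$; for such $P$ the Stein mean embedding is the Bochner integral $\mu_P:=\mathbb{E}_P\xi_{P_0}(X)$ and $\mathrm{KSD}(P_0,P):=\|\mu_P\|_{\mathcal{H}}$. Given a sample $X_1,\dots,X_n$ with $n\ge2$, define \[ U_n:=\frac1{n(n-1)}\sum_{i\ne j}K_{P_0}(X_i,X_j),\qquad\widehat{\mathrm{KSD}}_U:=\sqrt{(U_n)_+},\qquad (u)_+=\max(u,0). \] The Stein covariance operator is $C_\star:=\mathbb{E}_{P_0}[\xi_{P_0}(X)\otimes\xi_{P_0}(X)]$ on $\mathcal{H}$, where $a\otimes b$ is the operator $x\mapsto\langle b,x\rangle a$; it is positive, self-adjoint and trace class, and $\|C_\star\|_{\mathrm{HS}}=\operatorname{tr}(C_\star^2)^{1/2}$. For $A\ge1$, \[ \mathcal{P}(A):=\bigl\{P:\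 \mathbb{E}_{P\otimes P}K_{P_0}(X,Y)^2\le A\,\operatorname{tr}(C_\star^2)\bigr\}, \] where $X,Y\sim P$ are independent and $P$ ranges over probability measures on $\mathcal{X}$ (with $\mathbb{E}_PK_{P_0}(X,X)<\infty$). An estimator is a real-valued measurable function of the sample $(X_1,\dots,X_n)$, and $\mathbb{E}_P$ denotes expectation when $X_1,\dots,X_n$ are i.i.d. from $P$. Notation: $a\lesssim_Ab$ means $a\le Cb$ with a constant $C>0$ depending only on $A$, and $a\asymp_Ab$ means $a\lesssim_Ab$ and $b\lesssim_Aa$. *)

(* Defs.v *)
From HB Require Import structures.
From mathcomp Require Import all_boot all_order all_algebra.
From mathcomp Require Import all_classical all_reals all_analysis.

Set Implicit Arguments.
Unset Strict Implicit.
Unset Printing Implicit Defensive.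

Import Order.TTheory GRing.Theory Num.Theory.
Import numFieldNormedType.Exports.

Local Open Scope classical_set_scope.
Local Open Scope ring_scope.

(* The Borel sigma-algebra of R^d. *)
HB.instance Definition _ (R : realType) (d : nat) :=
  @isMeasurable.Build (sigma_display (@open 'rV[R]_d)) 'rV[R]_d
    <<s (@open 'rV[R]_d) >>
    (@sigma_algebra0 _ setT _) (@sigma_algebraC _ _)
    (@sigma_algebra_bigcup _ setT _).

Section product_measures.
Context d (T : measurableType d) (R : realType).

Definition cons_pair n (z : T * n.-tuple T) : n.+1.-tuple T :=
  [tuple of z.1 :: z.2].

Lemma measurable_cons_pair n : measurable_fun [set: T * n.-tuple T] (@cons_pair n).
Proof. exact: measurable_cons. Qed.

Section step.
Variables (m : {sigma_finite_measure set T -> \bar R}) (n : nat).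
Variable mu : {sigma_finite_measure set (n.-tuple T) -> \bar R}.

Definition cons_measure : set (n.+1.-tuple T) -> \bar R :=
  pushforward (m \x mu)%E (@cons_pair n).

Let measurable_pre A : measurable A -> measurable (@cons_pair n @^-1` A).
Proof. by move=> mA; rewrite -[X in measurable X]setTI; exact: measurable_cons_pair. Qed.

Let cons_measure0 : cons_measure set0 = 0%E.
Proof. by rewrite /cons_measure /pushforward preimage_set0 measure0. Qed.

Let cons_measure_ge0 A : (0 <= cons_measure A)%E.
Proof. by rewrite /cons_measure /pushforward; exact: measure_ge0. Qed.

Let cons_measure_sigma_additive : semi_sigma_additive cons_measure.
Proof.
move=> F mF tF mUF; rewrite /cons_measure /pushforward preimage_bigcup.
apply: measure_semi_sigma_additive.
- by move=> i; exact: measurable_pre.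
- apply/trivIsetP => /= i j _ _ ij; rewrite -preimage_setI.
  by move/trivIsetP : tF => /(_ _ _ _ _ ij) ->//; rewrite preimage_set0.
- by rewrite -preimage_bigcup; exact: measurable_pre.
Qed.

HB.instance Definition _ := isMeasure.Build _ _ _ cons_measure
  cons_measure0 cons_measure_ge0 cons_measure_sigma_additive.

Let cons_measure_sigma_finite : sigma_finite setT cons_measure.
Proof.
have /sigma_finiteP[F [TF ndF Foo]] := sigma_finiteT m.
have /sigma_finiteP[G [TG ndG Goo]] := sigma_finiteT mu.
pose H k := F k `*` G k.
have TH : \bigcup_k H k = setT.
  rewrite -setXTT TF TG predeqE => -[x y]; split.
    by move=> [k _ []/= ? ?]; split; exists k.
  move=> [/= [k _ Fx] [l _ Gy]]; exists (maxn k l) => //; split.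
  - by move: x Fx; exact/subsetPset/ndF/leq_maxl.
  - by move: y Gy; exact/subsetPset/ndG/leq_maxr.
pose unc (t : n.+1.-tuple T) : T * n.-tuple T := (thead t, [tuple of behead t]).
have munc : measurable_fun setT unc.
  apply: measurable_fun_pair; first exact: measurable_tnth.
  exact: measurable_behead.
have uncK : cancel (@cons_pair n) unc.
  by move=> [x t]; rewrite /unc /cons_pair /= theadE; congr pair; exact/val_inj.
exists (fun k => unc @^-1` H k).
  by rewrite -preimage_bigcup TH preimage_setT.
move=> k; have [mF Fk] := Foo k; have [mG Gk] := Goo k.
have mH : measurable (H k) by exact: measurableX.
split; first by rewrite -[X in measurable X]setTI; exact: munc.
rewrite /cons_measure /pushforward -comp_preimage.
rewrite (_ : unc \o _ = id) ?preimage_id; last exact/funext.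
by rewrite product_measure1E// lte_mul_pinfty// ge0_fin_numE.
Qed.

HB.instance Definition _ := Measure_isSigmaFinite.Build _ _ _ cons_measure
  cons_measure_sigma_finite.

End step.

(* The n-fold product m (x) ... (x) m: the law of n i.i.d. draws when m is a
   probability. *)
Fixpoint tuple_measure (m : {sigma_finite_measure set T -> \bar R}) n :
    {sigma_finite_measure set (n.-tuple T) -> \bar R} :=
  if n is n'.+1 then cons_measure m (tuple_measure m n')
  else \d_([tuple] : 0.-tuple T).

End product_measures.

(* A plain set function: integrals do not need its measure structure. *)
Definition lebesgue_rV (R : realType) d : set 'rV[R]_d -> \bar R :=
  pushforward (tuple_measure (@lebesgue_measure R) d)
    (fun t => \row_i (tnth t i : R)).

Definition has_density (R : realType) d (X : set 'rV[R]_d) (p : 'rV[R]_d -> R)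
    (P : probability 'rV[R]_d R) : Prop :=
  forall B, measurable B ->
    P B = (\int[@lebesgue_rV R d]_(x in B `&` X) (p x)%:E)%E.

Section calculus.
Context (R : realType) (d : nat).
Implicit Types (X : set 'rV[R]_d) (f : 'rV[R]_d -> R)
  (k : 'rV[R]_d -> 'rV[R]_d -> R).

Definition partial (i : 'I_d) f (x : 'rV[R]_d) : R :=
  'D_(delta_mx 0 i : 'rV[R]_d) f x.

Definition C1_on X f : Prop := forall x, X x ->
  {for x, continuous f} /\
  forall i, derivable f x (delta_mx 0 i) /\ {for x, continuous (partial i f)}.

Definition partial1 i k x y : R := partial i (k ^~ y) x.
Definition partial2 j k x y : R := partial j (k x) y.

Definition continuous2_at k x y : Prop :=
  {for (x, y), continuous (fun z : 'rV[R]_d * 'rV[R]_d => k z.1 z.2)}.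

(* The derivatives of order at most one in each of the two arguments, the
   mixed ones included, exist and are jointly continuous. *)
Definition C11_on X k : Prop := forall x y, X x -> X y ->
  [/\ continuous2_at k x y,
      forall i, derivable (k ^~ y) x (delta_mx 0 i) /\
        continuous2_at (partial1 i k) x y,
      forall j, derivable (k x) y (delta_mx 0 j) /\
        continuous2_at (partial2 j k) x y &
      forall i j, derivable (partial1 i k x) y (delta_mx 0 j) /\
        continuous2_at (partial2 j (partial1 i k)) x y].

Definition score f x (i : 'I_d) : R := partial i (fun z => ln (f z)) x.

End calculus.

Section hilbert.
Context (R : realType).

(* An inner product space sitting in an ambient vector space V: `ip` is only
   meaningful on `carrier`. *)
Record inner_space (V : lmodType R) := InnerSpace {
  carrier : set V;
  ip : V -> V -> R }.

Definition hnorm (V : lmodType R) (H : inner_space V) (u : V) : R :=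
  Num.sqrt (ip H u u).

Record is_hilbert (V : lmodType R) (H : inner_space V) : Prop := IsHilbert {
  hilbert0 : carrier H 0;
  hilbertP : forall a u v,
    carrier H u -> carrier H v -> carrier H (a *: u + v);
  ipC : forall u v, carrier H u -> carrier H v -> ip H u v = ip H v u;
  ipP : forall a u v w, carrier H u -> carrier H v -> carrier H w ->
    ip H (a *: u + v) w = a * ip H u w + ip H v w;
  ip_ge0 : forall u, carrier H u -> 0 <= ip H u u;
  ip_eq0 : forall u, carrier H u -> ip H u u = 0 -> u = 0;
  hilbert_complete : forall u : nat -> V, (forall n, carrier H (u n)) ->
    (forall e, 0 < e -> exists N, forall m n, (N <= m)%N -> (N <= n)%N ->
      hnorm H (u m - u n) < e) ->
    exists2 v, carrier H v & hnorm H (u n - v) @[n --> \oo] --> (0 : R) }.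

Definition pow_space (V : lmodType R) (d : nat) (H : inner_space V) :
    inner_space ('I_d -> V) :=
  InnerSpace [set u : 'I_d -> V | forall i, carrier H (u i)]
    (fun u v => \sum_i ip H (u i) (v i)).

Definition pd_kernel (S : Type) (k : S -> S -> R) : Prop :=
  (forall x y, k x y = k y x) /\
  forall n (a : 'I_n -> R) (x : 'I_n -> S),
    0 <= \sum_i \sum_j a i * a j * k (x i) (x j).

(* By the Moore-Aronszajn theorem there is exactly one such space of functions
   (the values of `ip` outside of `carrier` apart). *)
Definition is_rkhs (S : Type) (k : S -> S -> R) (H : inner_space (S -> R^o)) :=
  [/\ is_hilbert H, forall x, carrier H (k x) &
      forall f x, carrier H f -> f x = ip H f (k x)].

Definition restrict2 (T : Type) (X : set T) (k : T -> T -> R) : X -> X -> R :=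
  fun x y => k (\val x) (\val y).

Section operators.
Variables (V : lmodType R) (H : inner_space V).

Definition tensor (a b : V) : V -> V := fun h => ip H b h *: a.

(* Orthonormal basis in the sense of Hilbert spaces: a maximal orthonormal
   set. *)
Definition orthonormal_basis (E : set V) : Prop :=
  [/\ E `<=` carrier H, forall e, E e -> ip H e e = 1,
      forall e f, E e -> E f -> e <> f -> ip H e f = 0 &
      forall v, carrier H v -> (forall e, E e -> ip H e v = 0) -> v = 0].

Definition onb : set V := xget set0 orthonormal_basis.

(* For positive operators only: the terms of the sum are then nonnegative, and
   its value does not depend on the basis. *)
Definition trace (A : V -> V) : \bar R :=
  (\esum_(e in onb) (ip H e (A e))%:E)%E.

Definition hs_norm (A : V -> V) : R :=
  Num.sqrt (fine (\esum_(e in onb) (hnorm H (A e) ^+ 2)%:E)%E).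

End operators.

Section bochner.
Context dT (T : measurableType dT) (V : lmodType R) (H : inner_space V).
Variable P : probability T R.

Definition is_simple (s : T -> V) : Prop :=
  [/\ forall x, carrier H (s x), finite_set (range s) &
      forall v, measurable (s @^-1` [set v])].

Definition simple_integral (s : T -> V) : V :=
  \sum_(v \in range s) fine (P (s @^-1` [set v])) *: v.

(* f is Bochner integrable with integral m: it is a limit in L^1(P; H) of simple
   functions whose integrals tend to m. *)
Definition is_bochner (f : T -> V) (m : V) : Prop :=
  [/\ forall x, carrier H (f x), carrier H m &
      exists s : nat -> T -> V,
        [/\ forall n, is_simple (s n),
            forall n, measurable_fun [set: T] (fun x => hnorm H (f x - s n x)),
            (\int[P]_x (hnorm H (f x - s n x))%:E)%E @[n --> \oo] --> (0 : \bar R) &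
            hnorm H (simple_integral (s n) - m) @[n --> \oo] --> (0 : R)]].

(* 0 when f is not Bochner integrable. *)
Definition bochner (f : T -> V) : V := xget 0 (is_bochner f).

End bochner.
End hilbert.

Section stein.
Context (R : realType) (d : nat).
Let T := 'rV[R]_d.
Variables (X : set T) (p0 : T -> R) (k : T -> T -> R).

(* Langevin-Stein feature map, with values in H_k^d; extended by 0 outside of
   X. *)
Definition stein_feature : T -> 'I_d -> (X -> R^o) :=
  patch (fun=> 0) X
    (fun x i y => score p0 x i * k x (\val y) + partial1 i k x (\val y)).

End stein.

Section ksd.
Context (R : realType) (d : nat).
Let T := 'rV[R]_d.
Context (V : lmodType R) (H : inner_space V) (xi : T -> V).
Implicit Types P : probability T R.

Definition stein_kernel (x y : T) : R := ip H (xi x) (xi y).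

Definition mean_embedding P : V := bochner H P xi.

Definition ksd P : R := hnorm H (mean_embedding P).

(* The expectation of the random operator xi(X) (x) xi(X), taken pointwise:
   (E Z) h := E (Z h). *)
Definition stein_cov P : V -> V :=
  fun h => bochner H P (fun x => tensor H (xi x) (xi x) h).

Definition u_stat n (t : n.-tuple T) : R :=
  (n%:R * (n%:R - 1))^-1 *
  \sum_(i < n) \sum_(j < n | i != j) stein_kernel (tnth t i) (tnth t j).

Definition ksd_u n (t : n.-tuple T) : R := Num.sqrt (Num.max (u_stat t) 0).

Definition finite_energy P : Prop :=
  (\int[P]_x (stein_kernel x x)%:E < +oo)%E.

Definition stein_class (X : set T) P0 (A : R) : set (probability T R) :=
  [set P : probability T R | [/\ P X = 1%E, finite_energy P &
    (\int[P \x P]_z (stein_kernel z.1 z.2 ^+ 2)%:E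
       <= A%:E * trace H (stein_cov P0 \o stein_cov P0))%E]].

Definition max_risk (Q : set (probability T R)) n (t : n.-tuple T -> R) : \bar R :=
  ereal_sup [set (\int[tuple_measure P n]_s `|t s - ksd P|%:E)%E | P in Q].

Definition minimax_risk (Q : set (probability T R)) n : \bar R :=
  ereal_inf [set max_risk Q t |
    t in [set t : n.-tuple T -> R | measurable_fun [set: n.-tuple T] t]].

End ksd.

(* Main.v *)
Require Import Defs.
From HB Require Import structures.
From mathcomp Require Import all_boot all_order all_algebra.
From mathcomp Require Import all_classical all_reals all_analysis.
From mathcomp Require Import measurable_realfun ring lra.

Set Implicit Arguments.
Unset Strict Implicit.
Unset Printing Implicit Defensive.

Import Order.TTheory GRing.Theory Num.Theory.
Import numFieldNormedType.Exports.

Local Open Scope classical_set_scope.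
Local Open Scope ring_scope.

(** The Stein kernel K is the Gram kernel of the feature map xi, so
    tr (C_star ^ 2) = E K ^ 2 over P0 x P0.

    Upper bound. The Hoeffding decomposition of U_n - KSD ^ 2 consists of a
    linear part and a degenerate part. The degenerate part has second moment of
    order E K ^ 2 / n ^ 2. The linear part is driven by G(x) = <xi x, mu>, and
    E G ^ 2 = <C mu, mu> <= KSD ^ 2 * sqrt (E K ^ 2): it shrinks with KSD itself,
    which compensates the singularity of the square root at 0.

    Lower bound. P0 is compared with the mixture of its perturbations of density
    1 + eps * sum_i s_i psi_i over random signs s, where the psi_i are centred
    truncations of finitely many coordinates of xi in an orthonormal basis and
    eps ^ 2 is of order 1 / (n * sqrt (E K ^ 2)). The chi-square distance of the
    mixture to P0 is controlled by an exponential moment of a Rademacher chaos.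
    The KSD of a perturbation, by Bessel, dominates a quadratic form in the
    signs, which is large with constant probability by Paley-Zygmund.

    The feature map is strongly measurable because it is norm continuous on the
    open set X: difference quotients of kernel sections have Gram matrices
    converging to the mixed derivative of k, hence are Cauchy. *)

(** Comparing [P0] with a single perturbation would give only the operator norm of C_star in place
    of its Hilbert-Schmidt norm. Averaging over random signs cancels the first-order term of the
    likelihood. What remains is quadratic: the chi-square distance is driven by n ^ 2 * eps ^ 4
    times the squared Hilbert-Schmidt norm, while the squared KSD is about eps ^ 2 times that same
    squared norm. This balance dictates eps and the rate.

    The perturbed densities must lie between 0 and 2, which forces the directions to be bounded and
    finite in number. Their number and their bound affect only the threshold on n, never the
    constants. A density at most 2 multiplies E K ^ 2 by at most 4, and this is where 4 <= A enters.

    The upper bound is uniform although the laws in the class bear no relation to [P0]: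
    quantitatively, a law enters only through its KSD and its E K ^ 2. *)

Local Notation intg mu f := (integrable mu setT (EFin \o f)).

(** * Hilbert spaces *)

Section hilbert_theory.
Context (R : realType) (V : lmodType R) (H : inner_space V) (hH : is_hilbert H).
Local Notation "<[ u , v ]>" := (ip H u v) (at level 0, u, v at level 99).
Local Notation nrm := (hnorm H).
Implicit Types (a : R) (u v w : V).

Lemma carrier0 : carrier H 0. Proof. exact: hilbert0. Qed.

Lemma carrierD u v : carrier H u -> carrier H v -> carrier H (u + v).
Proof. by move=> hu hv; rewrite -[u]scale1r; exact: hilbertP. Qed.

Lemma carrierZ a u : carrier H u -> carrier H (a *: u).
Proof. by move=> hu; rewrite -[_ *: _]addr0; apply: hilbertP => //; exact: carrier0. Qed.

Lemma carrierN u : carrier H u -> carrier H (- u).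
Proof. by move=> hu; rewrite -scaleN1r; exact: carrierZ. Qed.

Lemma carrierB u v : carrier H u -> carrier H v -> carrier H (u - v).
Proof. by move=> hu hv; apply: carrierD => //; exact: carrierN. Qed.

Lemma carrier_sum I (r : seq I) (P : pred I) (F : I -> V) :
  (forall i, P i -> carrier H (F i)) -> carrier H (\sum_(i <- r | P i) F i).
Proof. by move=> hF; elim/big_ind : _ => //; [exact: carrier0|exact: carrierD]. Qed.

Lemma ip_sym u v : carrier H u -> carrier H v -> <[u, v]> = <[v, u]>.
Proof. exact: ipC. Qed.

Lemma ipDl u v w : carrier H u -> carrier H v -> carrier H w ->
  <[u + v, w]> = <[u, w]> + <[v, w]>.
Proof. by move=> hu hv hw; rewrite -[u in LHS]scale1r ipP// mul1r. Qed.

Lemma ip0l w : carrier H w -> <[0, w]> = 0.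
Proof.
move=> hw; apply: (addIr <[0, w]>).
by rewrite -ipDl ?addr0 ?add0r//; exact: carrier0.
Qed.

Lemma ipZl a u w : carrier H u -> carrier H w -> <[a *: u, w]> = a * <[u, w]>.
Proof.
move=> hu hw; rewrite -[a *: u]addr0 (ipP hH)// ?ip0l ?addr0//; exact: carrier0.
Qed.

Lemma ipNl u w : carrier H u -> carrier H w -> <[- u, w]> = - <[u, w]>.
Proof. by move=> hu hw; rewrite -scaleN1r ipZl// mulN1r. Qed.

Lemma ipBl u v w : carrier H u -> carrier H v -> carrier H w ->
  <[u - v, w]> = <[u, w]> - <[v, w]>.
Proof. by move=> hu hv hw; rewrite ipDl ?ipNl//; exact: carrierN. Qed.

Lemma ipDr u v w : carrier H u -> carrier H v -> carrier H w ->
  <[w, u + v]> = <[w, u]> + <[w, v]>.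
Proof.
by move=> hu hv hw; rewrite ip_sym ?ipDl//; [congr +%R; exact: ip_sym|exact: carrierD].
Qed.

Lemma ipZr a u w : carrier H u -> carrier H w -> <[w, a *: u]> = a * <[w, u]>.
Proof.
by move=> hu hw; rewrite ip_sym ?ipZl//; [congr *%R; exact: ip_sym|exact: carrierZ].
Qed.

Lemma ipNr u w : carrier H u -> carrier H w -> <[w, - u]> = - <[w, u]>.
Proof. by move=> hu hw; rewrite -scaleN1r ipZr// mulN1r. Qed.

Lemma ipBr u v w : carrier H u -> carrier H v -> carrier H w ->
  <[w, u - v]> = <[w, u]> - <[w, v]>.
Proof. by move=> hu hv hw; rewrite ipDr ?ipNr//; exact: carrierN. Qed.

Lemma ip0r w : carrier H w -> <[w, 0]> = 0.
Proof. by move=> hw; rewrite ip_sym ?ip0l//; exact: carrier0. Qed.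

Lemma ip_suml I (r : seq I) (P : pred I) (F : I -> V) w :
  (forall i, P i -> carrier H (F i)) -> carrier H w ->
  <[\sum_(i <- r | P i) F i, w]> = \sum_(i <- r | P i) <[F i, w]>.
Proof.
move=> hF hw; elim: r => [|i r IH]; first by rewrite !big_nil ip0l.
rewrite !big_cons; case: ifP => // Pi.
by rewrite ipDl ?IH//; [exact: hF|exact: carrier_sum].
Qed.

Lemma hnorm_ge0 u : 0 <= nrm u. Proof. exact: sqrtr_ge0. Qed.

Lemma hnorm_sqr u : carrier H u -> nrm u ^+ 2 = <[u, u]>.
Proof. by move=> hu; rewrite sqr_sqrtr//; exact: ip_ge0. Qed.

Lemma hnorm0 : nrm 0 = 0.
Proof. by rewrite /hnorm ip0l ?sqrtr0//; exact: carrier0. Qed.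

Lemma hnormZ a u : carrier H u -> nrm (a *: u) = `|a| * nrm u.
Proof.
move=> hu; rewrite /hnorm ipZl ?ipZr//; last exact: carrierZ.
by rewrite mulrA -expr2 sqrtrM ?sqr_ge0// sqrtr_sqr.
Qed.

Lemma hnormN u : carrier H u -> nrm (- u) = nrm u.
Proof. by move=> hu; rewrite -scaleN1r hnormZ// normrN1 mul1r. Qed.

Lemma hnorm_eq0 u : carrier H u -> nrm u = 0 -> u = 0.
Proof. by move=> hu u0; apply: (ip_eq0 hH) => //; rewrite -hnorm_sqr// u0 expr0n. Qed.

Lemma sqr_hnormB u v : carrier H u -> carrier H v ->
  nrm (u - v) ^+ 2 = <[u, u]> - 2 * <[u, v]> + <[v, v]>.
Proof.
move=> hu hv; have huv := carrierB hu hv.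
rewrite hnorm_sqr// ipBl// !ipBr// (ip_sym hv hu); ring.
Qed.

Lemma sqr_hnormD u v : carrier H u -> carrier H v ->
  nrm (u + v) ^+ 2 = <[u, u]> + 2 * <[u, v]> + <[v, v]>.
Proof.
move=> hu hv; have huv := carrierD hu hv.
rewrite hnorm_sqr// ipDl// !ipDr// (ip_sym hv hu); ring.
Qed.

Lemma ip_le u v : carrier H u -> carrier H v -> <[u, v]> <= nrm u * nrm v.
Proof.
move=> hu hv; have [u0|un0] := eqVneq (nrm u) 0.
  by rewrite (hnorm_eq0 hu u0) ip0l// hnorm0 mul0r.
have [v0|vn0] := eqVneq (nrm v) 0.
  by rewrite (hnorm_eq0 hv v0) ip0r// hnorm0 mulr0.
have up : 0 < nrm u by rewrite lt_neqAle eq_sym un0 hnorm_ge0.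
have vp : 0 < nrm v by rewrite lt_neqAle eq_sym vn0 hnorm_ge0.
(* This combination gives both vectors the same norm; its square expands to 2|u||v|(|u||v| - <u,
   v>). *)
have := sqr_ge0 (nrm (nrm v *: u - nrm u *: v)).
rewrite sqr_hnormB; [|exact: carrierZ..].
rewrite !(ipZl, ipZr)//; [|exact: carrierZ..].
rewrite -!hnorm_sqr// => h.
have : 0 <= 2 * (nrm u * nrm v) * (nrm u * nrm v - <[u, v]>).
  by apply: le_trans h _; rewrite le_eqVlt; apply/orP; left; apply/eqP; ring.
by rewrite pmulr_rge0 ?subr_ge0// mulr_gt0// mulr_gt0.
Qed.

Lemma cauchy_schwarz u v : carrier H u -> carrier H v ->
  `|<[u, v]>| <= nrm u * nrm v.
Proof.
move=> hu hv; rewrite ler_norml ip_le// andbT lerNl -ipNl//.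
by rewrite -(hnormN hu) ip_le//; exact: carrierN.
Qed.

Lemma ler_hnormD u v : carrier H u -> carrier H v -> nrm (u + v) <= nrm u + nrm v.
Proof.
move=> hu hv; rewrite -(@ler_pXn2r _ 2)// ?nnegrE ?addr_ge0 ?hnorm_ge0//.
rewrite sqr_hnormD// -!hnorm_sqr//.
have := ip_le hu hv; move: (hnorm_ge0 u) (hnorm_ge0 v); nra.
Qed.

Lemma ler_hnormB u v : carrier H u -> carrier H v -> nrm (u - v) <= nrm u + nrm v.
Proof. by move=> hu hv; rewrite -(hnormN hv) ler_hnormD//; exact: carrierN. Qed.

Lemma hnorm_distC u v : carrier H u -> carrier H v -> nrm (u - v) = nrm (v - u).
Proof. by move=> hu hv; rewrite -hnormN ?opprB//; exact: carrierB. Qed.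

Lemma hnorm_triangle w u v : carrier H u -> carrier H v -> carrier H w ->
  nrm (u - v) <= nrm (u - w) + nrm (w - v).
Proof.
move=> hu hv hw; have -> : u - v = (u - w) + (w - v) by rewrite addrA subrK.
by apply: ler_hnormD; exact: carrierB.
Qed.

Definition orthonormal_seq (s : seq V) : Prop :=
  [/\ uniq s, forall e, e \in s -> carrier H e,
      forall e, e \in s -> <[e, e]> = 1 &
      forall e f, e \in s -> f \in s -> e <> f -> <[e, f]> = 0].

Definition hproj (s : seq V) (v : V) : V := \sum_(e <- s) <[e, v]> *: e.

Section projection.
Variables (s : seq V) (os : orthonormal_seq s).

Let cs e : e \in s -> carrier H e. Proof. by case: os => _ /(_ e). Qed.

Lemma carrier_hproj v : carrier H (hproj s v).
Proof.
rewrite /hproj big_seq; apply: carrier_sum => e es; exact/carrierZ/cs.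
Qed.

Lemma ip_hprojl u v : carrier H v ->
  <[hproj s u, v]> = \sum_(e <- s) <[e, u]> * <[e, v]>.
Proof.
move=> hv; rewrite /hproj big_seq ip_suml//; last by move=> e es; exact/carrierZ/cs.
by rewrite [RHS]big_seq; apply: eq_bigr => e es; rewrite ipZl//; exact: cs.
Qed.

Lemma ip_hproj e v : e \in s -> carrier H v -> <[e, hproj s v]> = <[e, v]>.
Proof.
move=> es hv; case: os => us _ s1 s0.
rewrite (ip_sym (cs es) (carrier_hproj v)) ip_hprojl; last exact: cs.
rewrite (bigD1_seq e)//= s1// mulr1 big_seq_cond big1 ?addr0// => f /andP[fs fe].
by rewrite (s0 f e) ?mulr0//; exact/eqP.
Qed.

Lemma ip_hproj_hproj u v : carrier H u -> carrier H v ->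
  <[hproj s u, hproj s v]> = \sum_(e <- s) <[e, u]> * <[e, v]>.
Proof.
move=> hu hv; rewrite ip_hprojl; last exact: carrier_hproj.
by rewrite !big_seq; apply: eq_bigr => e es; rewrite ip_hproj.
Qed.

Lemma sqr_hnorm_hproj v : carrier H v ->
  nrm (v - hproj s v) ^+ 2 = <[v, v]> - \sum_(e <- s) <[e, v]> ^+ 2.
Proof.
move=> hv; have hp := carrier_hproj v.
rewrite sqr_hnormB// ip_hproj_hproj// (ip_sym hv hp) ip_hprojl//.
under [in X in _ = X]eq_bigr do rewrite expr2.
ring.
Qed.

Lemma bessel v : carrier H v -> \sum_(e <- s) <[e, v]> ^+ 2 <= <[v, v]>.
Proof. by move=> hv; rewrite -subr_ge0 -sqr_hnorm_hproj// sqr_ge0. Qed.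

Lemma hnorm_hproj v : carrier H v -> nrm (hproj s v) <= nrm v.
Proof.
move=> hv; rewrite -(@ler_pXn2r _ 2)// ?nnegrE ?hnorm_ge0//.
rewrite !hnorm_sqr//; last exact: carrier_hproj.
rewrite ip_hproj_hproj//.
by under eq_bigr do rewrite -expr2; exact: bessel.
Qed.

End projection.

Lemma sum_undup_cat (s t : seq V) (F : V -> R) :
  (forall v, 0 <= F v) -> uniq s ->
  \sum_(e <- s) F e <= \sum_(e <- undup (s ++ t)) F e.
Proof.
move=> F0 us; pose r := [seq x <- undup (s ++ t) | x \in s].
have -> : \sum_(e <- s) F e = \sum_(e <- r) F e.
  apply: perm_big; apply: uniq_perm => //; first exact/filter_uniq/undup_uniq.
  by move=> x; rewrite mem_filter mem_undup mem_cat; case: (x \in s).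
by rewrite big_filter [leRHS](bigID (mem s))/= lerDl sumr_ge0.
Qed.

Section parseval.
Variables (E : set V) (hE : orthonormal_basis H E).

Definition onseq (s : seq V) := uniq s /\ {in s, forall e, E e}.

Lemma onseq_orthonormal s : onseq s -> orthonormal_seq s.
Proof.
case: hE => EH E1 E0 _ [us sE]; split => //.
- by move=> e /sE /EH.
- by move=> e /sE /E1.
- by move=> e f /sE eE /sE fE ef; exact: E0.
Qed.

Lemma onseq_cat s t : onseq s -> onseq t -> onseq (undup (s ++ t)).
Proof.
move=> [us sE] [ut tE]; split; first exact: undup_uniq.
by move=> e; rewrite mem_undup mem_cat => /orP[/sE|/tE].
Qed.

Let S v : set R := [set \sum_(e <- s) <[e, v]> ^+ 2 | s in onseq].

(** [E] may be uncountable, so convergence is along the net of its finite subsets. Bessel bounds the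
    partial sums; near-maximal ones have Cauchy projections, whose limit differs from [v] by a
    vector orthogonal to all of [E], hence null by maximality. *)
Lemma parseval_approx v eps : carrier H v -> 0 < eps ->
  exists2 s, onseq s & forall t, onseq t -> {subset s <= t} ->
    nrm (v - hproj t v) < eps.
Proof.
move=> hv eps0.
have on0 : onseq [::] by split.
have hasS : has_sup (S v).
  split; first by exists (\sum_(e <- [::]) <[e, v]> ^+ 2); exists [::].
  by exists <[v, v]> => _ [s os <-]; apply: bessel => //; exact: onseq_orthonormal.
pose M := sup (S v).
have leM s : onseq s -> \sum_(e <- s) <[e, v]> ^+ 2 <= M.
  by move=> os; apply: ub_le_sup; [exact: hasS.2|exists s].
have nearM d : 0 < d -> exists2 s, onseq s & M - d < \sum_(e <- s) <[e, v]> ^+ 2.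
  by move=> d0; have [_ [s os <-] hs] := sup_adherent d0 hasS; exists s.
have diffE s t : onseq s -> onseq t -> {subset s <= t} ->
    nrm (hproj t v - hproj s v) ^+ 2 =
    \sum_(e <- t) <[e, v]> ^+ 2 - \sum_(e <- s) <[e, v]> ^+ 2.
  move=> os ot st; have os' := onseq_orthonormal os.
  have ot' := onseq_orthonormal ot.
  have cps := carrier_hproj os' v; have cpt := carrier_hproj ot' v.
  rewrite sqr_hnormB// !ip_hproj_hproj// (ip_sym cpt cps) ip_hprojl//.
  have -> : \sum_(e <- s) <[e, v]> * <[e, hproj t v]> =
            \sum_(e <- s) <[e, v]> ^+ 2.
    rewrite !big_seq; apply: eq_bigr => e es.
    by rewrite ip_hproj// ?expr2//; exact: st.
  under eq_bigr do rewrite -expr2.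
  under [X in _ + X = _]eq_bigr do rewrite -expr2.
  ring.
have catl (s t : seq V) : {subset s <= undup (s ++ t)}.
  by move=> x xs; rewrite mem_undup mem_cat xs.
have catr (s t : seq V) : {subset t <= undup (s ++ t)}.
  by move=> x xs; rewrite mem_undup mem_cat xs orbT.
(* Enlarging [s] moves the projection by no more than what [s] misses of the supremum [M]. *)
have close d s t : 0 < d -> onseq s -> onseq t -> {subset s <= t} ->
    M - d ^+ 2 < \sum_(e <- s) <[e, v]> ^+ 2 -> nrm (hproj t v - hproj s v) < d.
  move=> d0 os ot st sM.
  rewrite -(@ltr_pXn2r _ 2)// ?nnegrE ?hnorm_ge0 ?ltW// diffE//.
  by have := leM _ ot; move: sM; lra.
have hn n : 0 < n.+1%:R^-1 :> R by rewrite invr_gt0.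
have /choice[q hq] n : exists s, onseq s /\
    M - (n.+1%:R^-1) ^+ 2 < \sum_(e <- s) <[e, v]> ^+ 2.
  by have [|s os hs] := nearM ((n.+1%:R^-1) ^+ 2);
    [rewrite exprn_gt0|exists s].
have oq n : onseq (q n) := (hq n).1.
pose u n := hproj (q n) v.
have cu n : carrier H (u n) := carrier_hproj (onseq_orthonormal (oq n)) v.
have near_u n t : onseq t -> {subset q n <= t} -> nrm (hproj t v - u n) < n.+1%:R^-1.
  by move=> ot st; apply: close => //; exact: (hq n).2.
have inv_small e : 0 < e -> exists N, forall n, (N <= n)%N -> n.+1%:R^-1 < e :> R.
  move=> e0; have [N _ hN] := near_infty_natSinv_lt (PosNum e0).
  by exists N => n Nn; exact: hN.
have [||w cw uw] := hilbert_complete hH (u := u) => //.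
  move=> e e0; have [N hN] := inv_small (e / 2) ltac:(by rewrite divr_gt0).
  exists N => m n Nm Nn.
  (* The sets [q n] are not nested; two of them are compared through their union. *)
  pose t := undup (q m ++ q n); have ot : onseq t := onseq_cat (oq m) (oq n).
  have ct := carrier_hproj (onseq_orthonormal ot) v.
  apply: le_lt_trans (hnorm_triangle (cu m) (cu n) ct) _.
  rewrite (hnorm_distC (cu m) ct).
  have h1 := lt_trans (near_u m t ot (catl _ _)) (hN m Nm).
  have h2 := lt_trans (near_u n t ot (catr _ _)) (hN n Nn).
  by apply: lt_le_trans (ltrD h1 h2) _; rewrite -splitr.
have uw_small e : 0 < e -> exists N, forall n, (N <= n)%N -> nrm (u n - w) < e.
  move=> e0; move/cvgrPdist_lt : uw => /(_ _ e0)[N _ hN]; exists N => n Nn.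
  by have := hN n Nn; rewrite sub0r normrN ger0_norm// hnorm_ge0.
have cvw : carrier H (v - w) := carrierB hv cw.
have vw : v = w.
  apply/eqP; rewrite -subr_eq0; apply/eqP; case: (hE) => EH E1 E0; apply => // e Ee.
  have ce := EH _ Ee.
  apply/eqP; rewrite -normr_eq0 eq_le normr_ge0 andbT; apply/ler_addgt0Pr => d d0.
  rewrite add0r.
  have d20 : 0 < d / 2 by rewrite divr_gt0.
  have [N1 hN1] := inv_small _ d20; have [N2 hN2] := uw_small _ d20.
  (* Once [e] is added to [q n], the projection of [v] has the same inner product with [e] as [v]
     itself, and it has hardly moved. *)
  pose n := maxn N1 N2; pose t := undup (q n ++ [:: e]).
  have oe : onseq [:: e] by split => // x; rewrite inE => /eqP ->.
  have ot : onseq t := onseq_cat (oq n) oe.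
  have ct := carrier_hproj (onseq_orthonormal ot) v.
  have et : e \in t by apply: catr; rewrite inE.
  have e1 : nrm e = 1 by rewrite /hnorm E1// sqrtr1.
  have -> : <[e, v - w]> = <[e, hproj t v - u n]> + <[e, u n - w]>.
    rewrite !ipBr//; rewrite ip_hproj//; last exact: onseq_orthonormal.
    ring.
  apply: le_trans (ler_normD _ _) _.
  have cA : carrier H (hproj t v - u n) by exact: carrierB.
  have cB : carrier H (u n - w) by exact: carrierB.
  apply: le_trans (lerD (cauchy_schwarz ce cA) (cauchy_schwarz ce cB)) _.
  rewrite e1 !mul1r.
  have h1 := ltW (lt_trans (near_u n t ot (catl _ _)) (hN1 n (leq_maxl _ _))).
  have h2 := ltW (hN2 n (leq_maxr _ _)).
  by apply: le_trans (lerD h1 h2) _; rewrite -splitr.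
have e20 : 0 < eps / 2 by rewrite divr_gt0.
have [N1 hN1] := inv_small _ e20; have [N2 hN2] := uw_small _ e20.
pose n := maxn N1 N2; exists (q n) => // t ot st.
have ct := carrier_hproj (onseq_orthonormal ot) v.
rewrite hnorm_distC//; apply: le_lt_trans (hnorm_triangle ct hv (cu n)) _.
have h1 := lt_trans (near_u n t ot st) (hN1 n (leq_maxl _ _)).
have h2 := hN2 n (leq_maxr _ _); rewrite -vw in h2.
by apply: lt_le_trans (ltrD h1 h2) _; rewrite -splitr.
Qed.

End parseval.
End hilbert_theory.

(** * Real-valued integrals *)

Section real_integrals.
Context d (T : measurableType d) (R : realType) (mu : {measure set T -> \bar R}).
Implicit Types f g : T -> R.

Lemma intg_measurable f : intg mu f -> measurable_fun setT f.
Proof. by move=> /integrableP[/measurable_EFinP]. Qed.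

Lemma eq_intg f g : f =1 g -> intg mu f -> intg mu g.
Proof. by move=> /funext ->. Qed.

Lemma intg_le f g : measurable_fun setT f -> (forall x, `|f x| <= g x) ->
  intg mu g -> intg mu f.
Proof.
move=> mf fg; apply: le_integrable => //; first exact/measurable_EFinP.
by move=> x _; rewrite /= lee_fin (le_trans (fg x))// ler_norm.
Qed.

Lemma intgD f g : intg mu f -> intg mu g -> intg mu (fun x => f x + g x).
Proof.
move=> hf hg; rewrite (_ : _ \o _ = (EFin \o f) \+ (EFin \o g))%E//.
exact: integrableD.
Qed.

Lemma intgZ a f : intg mu f -> intg mu (fun x => a * f x).
Proof.
move=> hf; rewrite (_ : _ \o _ = (fun x => a%:E * (EFin \o f) x)%E)//.
exact: integrableZl.
Qed.

Lemma intgN f : intg mu f -> intg mu (fun x => - f x).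
Proof.
by move=> /(intgZ (-1)); apply: eq_intg => x; rewrite mulN1r.
Qed.

Lemma intgB f g : intg mu f -> intg mu g -> intg mu (fun x => f x - g x).
Proof. by move=> hf hg; apply: intgD => //; exact: intgN. Qed.

Lemma intg_norm f : intg mu f -> intg mu (fun x => `|f x|).
Proof. exact: integrable_norm. Qed.

Lemma intg_sum I (s : seq I) (P : pred I) (F : I -> T -> R) :
  (forall i, P i -> intg mu (F i)) ->
  intg mu (fun x => \sum_(i <- s | P i) F i x).
Proof.
move=> hF; elim: s => [|i s IH].
  by apply: (@eq_intg (cst 0)); [move=> x; rewrite big_nil|exact: integrable0].
have [Pi|Pi] := boolP (P i); last first.
  by apply: eq_intg IH => x; rewrite big_cons (negbTE Pi).
apply: (eq_intg (f := fun x => F i x + \sum_(j <- s | P j) F j x)).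
  by move=> x; rewrite big_cons Pi.
by apply: intgD => //; exact: hF.
Qed.

Lemma Rintegral_sum I (s : seq I) (P : pred I) (F : I -> T -> R) :
  (forall i, P i -> intg mu (F i)) ->
  (\int[mu]_x (\sum_(i <- s | P i) F i x) = \sum_(i <- s | P i) \int[mu]_x F i x)%R.
Proof.
move=> hF; elim: s => [|i s IH].
  under eq_Rintegral do rewrite big_nil.
  by rewrite big_nil /Rintegral integral0.
under eq_Rintegral do rewrite big_cons.
rewrite big_cons; case: ifP => // Pi; rewrite RintegralD ?IH//.
  exact: hF.
exact: intg_sum.
Qed.

Lemma intg_lty f : measurable_fun setT f -> (forall x, 0 <= f x) ->
  (\int[mu]_x (f x)%:E < +oo)%E -> intg mu f.
Proof.
move=> mf f0 foo; apply/integrableP; split; first exact/measurable_EFinP.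
by under eq_integral do rewrite /= ger0_norm//.
Qed.

Lemma EFin_Rintegral f : intg mu f ->
  (\int[mu]_x f x)%R%:E = (\int[mu]_x (f x)%:E)%E.
Proof. by move=> hf; rewrite fineK//; exact: integrable_fin_num. Qed.

Lemma le_Rint f g : intg mu f -> intg mu g -> (forall x, f x <= g x) ->
  (\int[mu]_x f x <= \int[mu]_x g x)%R.
Proof. by move=> hf hg fg; apply: le_Rintegral. Qed.

Lemma Rint_ge0 f : (forall x, 0 <= f x) -> 0 <= (\int[mu]_x f x)%R.
Proof. by move=> f0; apply: Rintegral_ge0. Qed.

Lemma intg_mul f g : measurable_fun setT f -> measurable_fun setT g ->
  intg mu (fun x => f x ^+ 2) -> intg mu (fun x => g x ^+ 2) ->
  intg mu (fun x => f x * g x).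
Proof.
move=> mf mg f2 g2.
apply: (@intg_le _ (fun x => f x ^+ 2 + g x ^+ 2)); last exact: intgD.
- exact: measurable_funM.
- move=> x; rewrite ler_norml; apply/andP; split; nra.
Qed.

Lemma discriminant_le (a b c : R) : 0 <= c ->
  (forall t, 0 <= a - 2 * t * b + t ^+ 2 * c) -> b ^+ 2 <= a * c.
Proof.
rewrite le_eqVlt => /predU1P[<- h|c0 h]; last first.
  (* The minimizer of the quadratic in t. *)
  have := h (b / c); rewrite -(pmulr_rge0 _ c0) => {}h.
  rewrite -subr_ge0; apply: le_trans h _.
  rewrite le_eqVlt; apply/orP; left; apply/eqP; field.
  by rewrite gt_eqF.
rewrite mulr0; have [->|b0] := eqVneq b 0; first by rewrite expr0n.
(* For c = 0 the expression is affine in t, and this t makes it equal to -1. *)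
have := h ((a + 1) / (2 * b)); rewrite mulr0 addr0.
have -> : a - 2 * ((a + 1) / (2 * b)) * b = -1 by field.
by rewrite ler0N1.
Qed.

Lemma Rint_cauchy_schwarz f g : measurable_fun setT f -> measurable_fun setT g ->
  intg mu (fun x => f x ^+ 2) -> intg mu (fun x => g x ^+ 2) ->
  (\int[mu]_x (f x * g x))%R ^+ 2 <=
  (\int[mu]_x (f x ^+ 2))%R * (\int[mu]_x (g x ^+ 2))%R.
Proof.
move=> mf mg f2 g2; have fg := intg_mul mf mg f2 g2.
apply: discriminant_le => [|t]; first by apply: Rint_ge0 => x; exact: sqr_ge0.
rewrite -!RintegralZl// -RintegralB//; last exact: intgZ.
rewrite -RintegralD//; [|by apply: intgB => //; exact: intgZ|exact: intgZ].
apply: Rint_ge0 => x; rewrite (_ : _ + _ = (f x - t * g x) ^+ 2) ?sqr_ge0//.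
ring.
Qed.

Lemma Rint_dominated_cvg (f_ : nat -> T -> R) f g :
  (forall n, measurable_fun setT (f_ n)) -> (forall x, f_ n x @[n --> \oo] --> f x) ->
  intg mu g -> (forall n x, `|f_ n x| <= g x) ->
  intg mu f /\ (\int[mu]_x f_ n x)%R @[n --> \oo] --> (\int[mu]_x f x)%R.
Proof.
move=> mf cf ig fg.
have mf' : measurable_fun setT f by apply: (measurable_fun_cvg mf) => x _; exact: cf.
have h1 n : measurable_fun setT (EFin \o f_ n) by exact/measurable_EFinP.
have h2 : measurable_fun setT (EFin \o f) by exact/measurable_EFinP.
have h3 : {ae mu, forall x, setT x ->
    (fun n => (EFin \o f_ n) x) @ \oo --> (EFin \o f) x}.
  by apply: aeW => x _; apply/cvg_EFin; [exact: nearW|exact: cf].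
have h4 : {ae mu, forall x n, setT x -> (`|(EFin \o f_ n) x| <= (EFin \o g) x)%E}.
  by apply: aeW => x n _; rewrite /= lee_fin.
have [hf _ DC] := dominated_convergence measurableT h1 h2 h3 ig h4.
split => //; have e : (\int[mu]_x (EFin \o f) x = (\int[mu]_x f x)%R%:E)%E.
  by rewrite EFin_Rintegral.
by rewrite e in DC; have := fine_cvg DC; apply.
Qed.

End real_integrals.

Section probability_integrals.
Context d (T : measurableType d) (R : realType) (P : probability T R).

Lemma intg_cst (a : R) : intg P (fun=> a).
Proof. exact: finite_measure_integrable_cst. Qed.

Lemma Rint_cst (a : R) : (\int[P]_x a)%R = a.
Proof. by rewrite Rintegral_cst//= probability_setT mulr1. Qed.

Lemma intg_bounded (f : T -> R) a : measurable_fun setT f ->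
  (forall x, `|f x| <= a) -> intg P f.
Proof. by move=> mf fa; apply: intg_le mf fa _; exact: intg_cst. Qed.

End probability_integrals.

Section finite_range.
Context d (T : measurableType d) (W : Type) (s : T -> W).
Hypotheses (fs : finite_set (range s)) (ms : forall w, measurable (s @^-1` [set w])).

(** [W] carries no sigma-algebra and [F] is arbitrary: a preimage is a finite union of measurable
    fibres of [s]. *)
Lemma finite_range_measurable d' (U : measurableType d') (F : W -> U) :
  measurable_fun setT (F \o s).
Proof.
move=> _ B mB; rewrite setTI.
rewrite (_ : _ @^-1` _ = \bigcup_(w in range s `&` F @^-1` B) s @^-1` [set w]).
  by apply: fin_bigcup_measurable => //; exact: finite_setIl.
apply/seteqP; split=> [x /= Bx|x [w [_ /= Fw]] /= ->//].
by exists (s x) => //; split => //; exists x.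
Qed.

End finite_range.

Lemma cvg_dist_le (R : realType) (u e : nat -> R) (l : R) :
  (forall n, `|u n - l| <= e n) -> e n @[n --> \oo] --> 0 -> u n @[n --> \oo] --> l.
Proof.
move=> ue e0; apply/cvgrPdist_le => eps eps0.
move/cvgrPdist_le : e0 => /(_ _ eps0); apply: filterS => n.
by rewrite sub0r normrN distrC => h; rewrite (le_trans (ue n))// (le_trans (ler_norm _)).
Qed.

Lemma measurable_fun_sqrtr d (T : measurableType d) (R : realType) (f : T -> R) :
  measurable_fun setT f -> measurable_fun setT (fun x => Num.sqrt (f x)).
Proof.
move=> mf; have : measurable_fun setT (@Num.sqrt R).
  by apply: continuous_measurable_fun; exact: sqrt_continuous.
by move=> ms; exact: measurableT_comp.
Qed.

(** * Strong measurability and Bochner integrals *)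

Section strong_measurability.
Context (R : realType) (V : lmodType R) (H : inner_space V) (hH : is_hilbert H).

(** Strong measurability, with convergence everywhere instead of almost everywhere: the notion
    involves no measure, so one proof for the feature map serves all sampling laws at once. *)
Definition smeas d (T : measurableType d) (f : T -> V) : Prop :=
  (forall x, carrier H (f x)) /\
  exists2 s : nat -> T -> V, forall n, is_simple H (s n) &
    forall x, hnorm H (f x - s n x) @[n --> \oo] --> 0.

Section smeas_measurable.
Context d1 d2 d (T1 : measurableType d1) (T2 : measurableType d2)
  (T : measurableType d).

Lemma smeas_simple (s : T1 -> V) : is_simple H s -> smeas s.
Proof.
move=> hs; have [cs _ _] := hs; split => //; exists (fun=> s) => // x.
by rewrite subrr hnorm0//; exact: cvg_cst.
Qed.

Lemma measurable_simple2 (s : T1 -> V) (t : T2 -> V) (p : T -> T1) (q : T -> T2)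
    (F : V -> V -> R) : is_simple H s -> is_simple H t ->
  measurable_fun setT p -> measurable_fun setT q ->
  measurable_fun setT (fun x => F (s (p x)) (t (q x))).
Proof.
move=> [_ fs ms] [_ ft mt] mp mq.
apply: (@finite_range_measurable _ _ _ (fun x => (s (p x), t (q x))) _ _ _ _
  (fun w => F w.1 w.2)).
- apply: (@sub_finite_set _ _ (range s `*` range t)); last exact: finite_setX.
  by move=> _ [x _ <-]; split => /=; [exists (p x)|exists (q x)].
- move=> [v w]; rewrite (_ : _ @^-1` _ =
    (p @^-1` (s @^-1` [set v])) `&` (q @^-1` (t @^-1` [set w]))).
    by apply: measurableI; rewrite -[X in measurable X]setTI; [exact: mp|exact: mq].
  by apply/seteqP; split => [x /= [-> ->]//|x /= [-> ->]].
Qed.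

(** The two functions are read through separate maps [p] and [q], to cover kernels evaluated on a
    product space or at two entries of a tuple. *)
Lemma measurable_smeas2 (f : T1 -> V) (g : T2 -> V) (p : T -> T1) (q : T -> T2) :
  smeas f -> smeas g -> measurable_fun setT p -> measurable_fun setT q ->
  measurable_fun setT (fun x => ip H (f (p x)) (g (q x))).
Proof.
move=> [cf [s hs sf]] [cg [t ht tg]] mp mq.
have cs n x : carrier H (s n x) by have [] := hs n.
have ct n x : carrier H (t n x) by have [] := ht n.
apply: (measurable_fun_cvg (h := fun n x => ip H (s n (p x)) (t n (q x)))).
  by move=> n; exact: measurable_simple2.
move=> x _; pose a n := hnorm H (f (p x) - s n (p x)).
pose b n := hnorm H (g (q x) - t n (q x)).
have a0 : a n @[n --> \oo] --> 0 := sf (p x).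
have b0 : b n @[n --> \oo] --> 0 := tg (q x).
apply: (cvg_dist_le (e := fun n => a n * hnorm H (g (q x)) +
   (hnorm H (f (p x)) + a n) * b n)); last first.
  rewrite [X in _ --> X](_ : _ = 0 * hnorm H (g (q x)) + (hnorm H (f (p x)) + 0) * 0).
    apply: cvgD; first by apply: cvgM => //; exact: cvg_cst.
    by apply: cvgM => //; apply: cvgD => //; exact: cvg_cst.
  by rewrite mul0r mulr0 addr0.
move=> n /=; set u := f (p x); set v := g (q x); set u' := s n _; set v' := t n _.
have cu : carrier H u := cf _. have cv : carrier H v := cg _.
have cu' : carrier H u' := cs _ _. have cv' : carrier H v' := ct _ _.
have cuu := carrierB hH cu cu'. have cvv := carrierB hH cv cv'.
rewrite distrC (_ : _ - _ = ip H (u - u') v + ip H u' (v - v')); last first.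
  rewrite ipBl// ipBr//; ring.
apply: le_trans (ler_normD _ _) _; apply: lerD; first exact: cauchy_schwarz.
apply: le_trans (cauchy_schwarz hH cu' cvv) _.
apply: ler_wpM2r; first exact: hnorm_ge0.
rewrite -[u' in leLHS](subKr u) [a n](_ : _ = hnorm H (u - u'))//.
exact: ler_hnormB.
Qed.

End smeas_measurable.

Section smeas_theory.
Context d (T : measurableType d).
Implicit Types f g : T -> V.

Lemma smeas_carrier f x : smeas f -> carrier H (f x). Proof. by case. Qed.

Lemma measurable_smeas_ip f g : smeas f -> smeas g ->
  measurable_fun setT (fun x => ip H (f x) (g x)).
Proof. by move=> sf sg; exact: measurable_smeas2. Qed.

Lemma simple_cst v : carrier H v -> is_simple H (fun _ : T => v).
Proof.
move=> cv; split => //.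
  apply: (@sub_finite_set _ _ [set v]); last exact: finite_set1.
  by move=> _ [x _ <-].
by move=> w; rewrite preimage_cst; case: ifP.
Qed.

Lemma measurable_smeas_ipr f v : smeas f -> carrier H v ->
  measurable_fun setT (fun x => ip H (f x) v).
Proof.
by move=> sf cv; apply: (measurable_smeas_ip (g := fun=> v)) => //;
  apply/smeas_simple/simple_cst.
Qed.

Lemma measurable_smeas_hnorm f : smeas f -> measurable_fun setT (fun x => hnorm H (f x)).
Proof. by move=> sf; apply: measurable_fun_sqrtr; exact: measurable_smeas_ip. Qed.

(** The norm is expanded into inner products, which bypasses strong measurability of the
    difference. *)
Lemma measurable_smeas_dist f g : smeas f -> smeas g ->
  measurable_fun setT (fun x => hnorm H (f x - g x)).
Proof.
move=> sf sg.
rewrite (_ : (fun _ => _) = (fun x => Num.sqrt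
  (ip H (f x) (f x) - 2 * ip H (f x) (g x) + ip H (g x) (g x)))).
  apply: measurable_fun_sqrtr; apply: measurable_funD.
    apply: measurable_funB; first exact: measurable_smeas_ip.
    by apply: measurable_funM => //; exact: measurable_smeas_ip.
  exact: measurable_smeas_ip.
apply/funext => x.
have [cf cg] := (smeas_carrier x sf, smeas_carrier x sg).
by rewrite -sqr_hnormB// sqrtr_sqr ger0_norm// hnorm_ge0.
Qed.

Lemma simple_measurable (s : T -> V) (B : set V) : is_simple H s -> measurable (s @^-1` B).
Proof.
move=> [_ fs ms].
rewrite (_ : _ @^-1` _ = \bigcup_(w in range s `&` B) s @^-1` [set w]).
  by apply: fin_bigcup_measurable => //; exact: finite_setIl.
apply/seteqP; split=> [x /= Bx|x [w [_ /= Fw]] /= ->//].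
by exists (s x) => //; split => //; exists x.
Qed.

Lemma simple_comp (s : T -> V) (F : V -> V) : is_simple H s ->
  (forall v, carrier H v -> carrier H (F v)) -> is_simple H (F \o s).
Proof.
move=> hs hF; have [cs fs ms] := hs; split => [x||v].
- exact/hF.
- have /(finite_image F) := fs; apply: sub_finite_set => _ [x _ <-].
  by exists (s x) => //; exists x.
- by rewrite comp_preimage; exact: simple_measurable.
Qed.

Lemma simple_if (s t : T -> V) (B : set T) : is_simple H s -> is_simple H t ->
  measurable B -> is_simple H (fun x => if x \in B then s x else t x).
Proof.
move=> [cs fs ms] [ct ft mt] mB; split => [x||v].
- by case: ifP.
- apply: (@sub_finite_set _ _ (range s `|` range t)); last by rewrite finite_setU.
  by move=> _ [x _ <-]; case: ifP => _; [left|right]; exists x.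
- rewrite (_ : _ @^-1` _ = (B `&` s @^-1` [set v]) `|` (~` B `&` t @^-1` [set v])).
    by apply: measurableU; apply: measurableI => //; exact: measurableC.
  apply/seteqP; split => [x /=|x /= [[Bx sv]|[Bx tv]]].
  + by case: ifPn => [/set_mem|/negP/(contra_not mem_set)] Bx sv; [left|right].
  + by rewrite ifT//; exact: mem_set.
  + by rewrite ifF//; apply/negP => /set_mem.
Qed.

(** An approximant is kept where its norm is at most twice that of [f x], and replaced by 0
    elsewhere. Replacement stops once the error is below |f x|; where f x = 0, only null values are
    kept. The domination feeds dominated convergence. *)
Lemma smeas_dominated f : smeas f -> exists s : nat -> T -> V,
  [/\ forall n, is_simple H (s n), forall n x, hnorm H (f x - s n x) <= 3 * hnorm H (f x) &
      forall x, hnorm H (f x - s n x) @[n --> \oo] --> 0].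
Proof.
move=> sf; have [cf [s hs sfx]] := sf.
have cs n x : carrier H (s n x) by have [] := hs n.
pose B n := [set x | hnorm H (s n x) <= 2 * hnorm H (f x)].
have mB n : measurable (B n).
  rewrite -[X in measurable X]setTI; apply: measurable_fun_le => //.
    by apply: measurable_smeas_hnorm; exact: smeas_simple.
  by apply: measurable_funM => //; exact: measurable_smeas_hnorm.
exists (fun n x => if x \in B n then s n x else 0); split => [n|n x|x].
- by apply: (simple_if (t := fun=> 0)) => //; exact/simple_cst/carrier0.
- have f0 := hnorm_ge0 H (f x).
  case: ifPn => [/set_mem Bx|_]; last by rewrite subr0; lra.
  apply: le_trans (ler_hnormB hH (cf x) (cs n x)) _; move: Bx; rewrite /B /=; lra.
- have [fx0|fx0] := eqVneq (hnorm H (f x)) 0.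
    rewrite (_ : (fun _ => _) = fun=> 0); first exact: cvg_cst.
    apply/funext => n; case: ifPn => [/set_mem|_]; last by rewrite subr0.
    rewrite /B /= fx0 mulr0 => s0; have s1 : hnorm H (s n x) = 0.
      by apply/eqP; rewrite eq_le s0 hnorm_ge0.
    by rewrite (hnorm_eq0 hH (cf x) fx0) (hnorm_eq0 hH (cs n x) s1) subrr hnorm0.
  have fp : 0 < hnorm H (f x) by rewrite lt_neqAle eq_sym fx0 hnorm_ge0.
  have /cvgrPdist_lt/(_ _ fp) near0 := sfx x.
  apply: cvg_trans (sfx x); apply: near_eq_cvg.
  apply: filterS near0 => n; rewrite sub0r normrN ger0_norm ?hnorm_ge0// => fs.
  rewrite ifT//; apply/mem_set; rewrite /B /=.
  rewrite -[s n x](subKr (f x)).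
  apply: le_trans (ler_hnormB hH (cf x) (carrierB hH (cf x) (cs n x))) _; lra.
Qed.

Lemma smeas_tensor f v : smeas f -> carrier H v ->
  smeas (fun x => tensor H (f x) (f x) v).
Proof.
move=> [cf [s hs sf]] cv; split; first by move=> x; exact: carrierZ.
exists (fun n x => tensor H (s n x) (s n x) v).
  move=> n; apply: (@simple_comp (s n) (fun w => tensor H w w v)) => // w cw.
  exact: carrierZ.
move=> x; pose a n := hnorm H (f x - s n x).
have cs n : carrier H (s n x) by have [] := hs n.
have a0 : a n @[n --> \oo] --> 0 := sf x.
pose e n := hnorm H v * hnorm H (f x) * a n + a n * hnorm H v * (hnorm H (f x) + a n).
apply: (cvg_dist_le (e := e)); last first.
  rewrite [X in _ --> X](_ : _ = hnorm H v * hnorm H (f x) * 0 +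
     0 * hnorm H v * (hnorm H (f x) + 0)); last ring.
  apply: cvgD; first by apply: cvgM => //; exact: cvg_cst.
  apply: cvgM; first by apply: cvgM => //; exact: cvg_cst.
  by apply: cvgD => //; exact: cvg_cst.
move=> n; rewrite subr0 ger0_norm ?hnorm_ge0//.
have cd := carrierB hH (cf x) (cs n).
have -> : tensor H (f x) (f x) v - tensor H (s n x) (s n x) v =
    ip H v (f x) *: (f x - s n x) + ip H v (f x - s n x) *: s n x.
  rewrite /tensor (ipBr hH)//; rewrite !(ip_sym hH _ cv)//.
  by rewrite scalerBr scalerBl addrA subrK.
apply: le_trans (ler_hnormD hH (carrierZ hH _ cd) (carrierZ hH _ (cs n))) _.
rewrite !(hnormZ hH)//; apply: lerD.
  by apply: ler_wpM2r; [exact: hnorm_ge0|exact: cauchy_schwarz].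
apply: ler_pM => //; first exact: hnorm_ge0.
  by rewrite mulrC; exact: cauchy_schwarz.
rewrite -[s n x in leLHS](subKr (f x)).
exact: ler_hnormB.
Qed.

End smeas_theory.
End strong_measurability.

Lemma cvg_sum_seq (R : realType) I (s : seq I) (F : I -> nat -> R) (l : I -> R) :
  (forall i, F i n @[n --> \oo] --> l i) ->
  (\sum_(i <- s) F i n) @[n --> \oo] --> \sum_(i <- s) l i.
Proof.
move=> Fl; elim: s => [|i s IH].
  by rewrite big_nil; under eq_fun do rewrite big_nil; exact: cvg_cst.
rewrite big_cons; under eq_fun do rewrite big_cons.
exact: cvgD.
Qed.

(** * Finite powers of a Hilbert space *)

Section pow_space_hilbert.
Context (R : realType) (V : lmodType R) (H : inner_space V) (hH : is_hilbert H) (d : nat).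
Local Notation Hd := (pow_space d H).

Let hnorm_pow_ge u i : carrier Hd u -> hnorm H (u i) <= hnorm Hd u.
Proof.
move=> cu; apply: ler_wsqrtr; rewrite /= (bigD1 i)//= lerDl sumr_ge0// => j _.
exact/(ip_ge0 hH)/cu.
Qed.

Lemma hnorm_pow_sqr u : carrier Hd u -> hnorm Hd u ^+ 2 = \sum_i hnorm H (u i) ^+ 2.
Proof.
move=> cu; rewrite sqr_sqrtr; last by apply: sumr_ge0 => i _; exact/(ip_ge0 hH)/cu.
by apply: eq_bigr => i _; rewrite hnorm_sqr.
Qed.

Lemma hnorm_pow_le u : carrier Hd u -> hnorm Hd u <= \sum_i hnorm H (u i).
Proof.
move=> cu; have s0 : 0 <= \sum_i hnorm H (u i) by apply: sumr_ge0 => i _; exact: hnorm_ge0.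
rewrite -(@ler_pXn2r _ 2)// ?nnegrE ?hnorm_ge0//.
rewrite hnorm_pow_sqr// expr2 mulr_suml; apply: ler_sum => i _.
rewrite expr2; apply: ler_wpM2l; first exact: hnorm_ge0.
by rewrite (bigD1 i)//= lerDl; apply: sumr_ge0 => j _; exact: hnorm_ge0.
Qed.

Lemma pow_space_hilbert : is_hilbert Hd.
Proof.
split => /=.
- by move=> i; exact: carrier0.
- by move=> a u v cu cv i; apply: hilbertP.
- by move=> u v cu cv; apply: eq_bigr => i _; exact: ip_sym.
- move=> a u v w cu cv cw; rewrite mulr_sumr -big_split; apply: eq_bigr => i _ /=.
  exact: (ipP hH).
- by move=> u cu; apply: sumr_ge0 => i _; exact/(ip_ge0 hH)/cu.
- move=> u cu /eqP; rewrite psumr_eq0; last by move=> i _; exact/(ip_ge0 hH)/cu.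
  move=> /allP u0; apply/funext => i; apply: (ip_eq0 hH) => //.
  by apply/eqP/u0; rewrite mem_index_enum.
- move=> u cu cauchy.
  have cB m n : carrier Hd (u m - u n) by move=> i; exact: carrierB.
  have /choice[v hv] i : exists v, carrier H v /\ hnorm H (u n i - v) @[n --> \oo] --> (0 : R).
    have [||v cv uv] := hilbert_complete hH (u := fun n => u n i).
    + by move=> n; exact: cu.
    + move=> e /cauchy[N hN]; exists N => m n Nm Nn.
      exact: le_lt_trans (hnorm_pow_ge i (cB m n)) (hN m n Nm Nn).
    + by exists v.
  exists v; first by move=> i; exact: (hv i).1.
  have cuv n : carrier Hd (u n - v) by move=> i; apply: carrierB => //; exact: (hv i).1.
  apply: (cvg_dist_le (e := fun n => \sum_i hnorm H (u n i - v i))).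
    move=> n; rewrite subr0 ger0_norm; first exact: hnorm_pow_le.
    by rewrite hnorm_ge0.
  have := @cvg_sum_seq R _ (index_enum 'I_d) (fun i n => hnorm H (u n i - v i)) (fun=> 0)
    (fun i => (hv i).2).
  by rewrite big1.
Qed.

End pow_space_hilbert.

(** * Strong measurability of maps continuous on an open set *)

Section continuous_smeas.
Context (R : realType) (V : lmodType R) (H : inner_space V) (hH : is_hilbert H) (d : nat).
Local Notation T := 'rV[R]_d.

Definition hcontinuous_at (f : T -> V) (x : T) : Prop :=
  forall e : R, 0 < e -> \forall y \near x, hnorm H (f y - f x) < e.

(** A countable dense set whose images approximate [f] on [X]; it takes the place of separability of
    the Hilbert space. *)
Let rat_point (n : nat) : T :=
  if unpickle n is Some r then map_mx ratr (r : 'rV[rat]_d) else 0.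

Let rat_point_dense (x : T) (B : set T) : nbhs x B -> exists n, B (rat_point n).
Proof.
move=> /nbhs_ballP[e /= e0 eB].
have /choice[r hr] (i : 'I_d) : exists q : rat, `|x 0 i - ratr q| < e.
  have [|q] := @rat_in_itvoo R (x 0 i - e) (x 0 i + e); first by rewrite ltrBlDr -addrA ltrDl addr_gt0.
  rewrite in_itv /= => /andP[h1 h2]; exists q; rewrite ltr_norml; apply/andP; split; lra.
exists (pickle (\row_i r i : 'rV[rat]_d)); apply: eB; split => // i j.
by rewrite /rat_point pickleK ord1 !mxE; exact: hr.
Qed.

Variables (X : set T) (oX : open X) (f : T -> V).
Hypotheses (cf : forall x, carrier H (f x)) (fX : forall x, ~ X x -> f x = 0)
  (hf : forall x, X x -> hcontinuous_at f x).

(** A superlevel set meets [X] in an open set, by norm continuity, and meets the complement, where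
    [f] vanishes, in everything or nothing. *)
Let measurable_dist v : carrier H v -> measurable_fun setT (fun x => hnorm H (f x - v)).
Proof.
move=> cv mT; apply: (measurability _ (RGenOInfty.measurableE R)) => // _ [_ [a ->] <-].
rewrite setTI preimage_itvoy; set B := [set _ | _].
have -> : B = (X `&` B) `|` (~` X `&` B) by rewrite -setIUl setUv setTI.
have mX : measurable X by exact: sub_sigma_algebra.
apply: measurableU.
  apply: sub_sigma_algebra; rewrite openE => x [Xx ax].
  have e0 : 0 < hnorm H (f x - v) - a by rewrite subr_gt0.
  have nX : \forall y \near x, X y by exact: open_nbhs_nbhs.
  apply: filterS2 nX (hf Xx e0) => y Xy hy; split => //; rewrite /B /=.
  have := hnorm_triangle hH (cf x) cv (cf y); rewrite (hnorm_distC hH (cf x) (cf y)).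
  move: hy; lra.
have [hv|hv] := ltP a (hnorm H (0 - v)).
  rewrite (_ : _ `&` _ = ~` X); first exact: measurableC.
  apply/seteqP; split => [x []//|x Xx]; split => //.
  by rewrite /B /= fX.
rewrite (_ : _ `&` _ = set0)//; apply/seteqP; split => // x [Xx].
by rewrite /B /= fX// ltNge hv.
Qed.

Let v n := f (rat_point n).

Let cv n : carrier H (v n). Proof. exact: cf. Qed.

(* nearest n x is the point closest to f x among 0, v 0, ..., v (n - 1). *)
Let nearest := fix s n (x : T) : V :=
  if n is m.+1 then
    if x \in [set x | hnorm H (f x - v m) < hnorm H (f x - s m x)] then v m else s m x
  else 0.

(** The two claims go together: the set on which the next value replaces the current one compares
    two distances, so its measurability rests on that of the current distance. *)
Let nearestP n : is_simple H (nearest n) /\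
  measurable_fun setT (fun x => hnorm H (f x - nearest n x)).
Proof.
elim: n => [|n [IHs IHm]]; first by split; [apply: simple_cst|apply: measurable_dist]; exact: carrier0.
have mB : measurable [set x | hnorm H (f x - v n) < hnorm H (f x - nearest n x)].
  have := measurableC (measurable_fun_le measurableT IHm (measurable_dist (cv n))).
  congr measurable; rewrite setTI; apply/seteqP; split => x /=; last by rewrite ltNge => /negP.
  by rewrite ltNge => /negP.
split; first by apply: (simple_if (s := fun=> v n)) => //; exact/simple_cst.
rewrite (_ : (fun x => _) = (fun x => Num.min (hnorm H (f x - v n)) (hnorm H (f x - nearest n x)))).
  by apply: measurable_minr => //; exact: measurable_dist.
apply/funext => x /=; rewrite minEle; case: ifPn => [/set_mem/= /ltW -> //|].
move=> /negP h; case: ifPn => // le; apply/eqP; rewrite eq_le le andbT.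
by rewrite leNgt; apply/negP => lt; apply: h; exact/mem_set.
Qed.

Let nearest_le n m x : (m < n)%N -> hnorm H (f x - nearest n x) <= hnorm H (f x - v m).
Proof.
elim: n => // n IH; rewrite ltnS leq_eqVlt => mn /=.
case: ifPn => [/set_mem /= lt|/negP h].
  move: mn => /predU1P[->//|/IH]; exact/le_trans/ltW.
move: mn => /predU1P[->|//]; rewrite leNgt; apply/negP => lt; apply: h; exact/mem_set.
Qed.

Lemma continuous_smeas : smeas H f.
Proof.
split => //; exists nearest; first by move=> n; exact: (nearestP n).1.
move=> x; apply/cvgrPdist_lt => e e0.
suff [N hN] : exists N, forall n, (N <= n)%N -> hnorm H (f x - nearest n x) < e.
  by exists N => // n /hN; rewrite sub0r normrN ger0_norm ?hnorm_ge0.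
have [Xx|Xx] := pselect (X x).
  have [m hm] := rat_point_dense (hf Xx e0).
  (* [nearest n] has only seen the values of index below [n], hence the successor. *)
  exists m.+1 => n mn; apply: le_lt_trans (nearest_le x mn) _.
  by rewrite hnorm_distC.
(* Outside [X] the starting value 0 is already at distance zero and is never strictly improved. *)
exists 0%N => n _; suff -> : hnorm H (f x - nearest n x) = 0 by [].
elim: n => [|n IH] /=; first by rewrite fX// subr0 hnorm0.
rewrite ifF//; apply/negP => /set_mem /=; rewrite IH.
by rewrite ltNge hnorm_ge0.
Qed.

End continuous_smeas.

(** * Existence of Bochner integrals and their inner products *)

Section bochner_theory.
Context (R : realType) (V : lmodType R) (H : inner_space V) (hH : is_hilbert H).
Context d (T : measurableType d) (P : probability T R).
Implicit Types (f s : T -> V) (v m : V).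

Let simple_enum s : is_simple H s ->
  exists r : seq V, [/\ uniq r, forall w, w \in r <-> exists x, s x = w &
    simple_integral P s = \sum_(w <- r) fine (P (s @^-1` [set w])) *: w].
Proof.
move=> [_ /finite_seqP[r rE] _]; exists (undup r).
have ur : range s = [set` undup r].
  by rewrite rE; apply/seteqP; split => w /=; rewrite mem_undup.
split; first exact: undup_uniq.
  move=> w; have -> : (w \in undup r) <-> [set` undup r] w by [].
  by rewrite -ur; split => [[x _ <-]|[x <-]]; exists x.
by rewrite /simple_integral ur -fsbig_seq// undup_uniq.
Qed.

Lemma carrier_simple_integral s : is_simple H s -> carrier H (simple_integral P s).
Proof.
move=> hs; have [cs _ _] := hs; have [r [ur rE ->]] := simple_enum hs.
rewrite big_seq; apply: (carrier_sum hH) => w /rE[x <-].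
exact: (carrierZ hH).
Qed.

Lemma simple_integral_ip s v : is_simple H s -> carrier H v ->
  intg P (fun x => ip H (s x) v) /\
  (\int[P]_x ip H (s x) v)%R = ip H (simple_integral P s) v.
Proof.
move=> hs cv; have [cs _ ms] := hs; have [r [ur rE ->]] := simple_enum hs.
have cr w : w \in r -> carrier H w by move/rE => [x <-].
have sE : (fun x => ip H (s x) v) =
    (fun x => \sum_(w <- r) ip H w v * \1_(s @^-1` [set w]) x).
  apply/funext => x; rewrite (bigD1_seq (s x))//=; last by apply/rE; exists x.
  rewrite indicE mem_set// mulr1 big1 ?addr0// => w ws.
  by rewrite indicE memNset ?mulr0//= => /esym/eqP; rewrite (negbTE ws).
have int1 w : intg P (\1_(s @^-1` [set w])).
  by apply: integrable_indic => //=; exact: fin_num_fun_lty.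
have int2 w : intg P (fun x => ip H w v * \1_(s @^-1` [set w]) x).
  exact: intgZ.
rewrite sE; split; first exact: intg_sum.
rewrite Rintegral_sum// big_seq [X in ip H X v]big_seq (ip_suml hH)//; last first.
  by move=> w /cr cw; exact: carrierZ.
apply: eq_bigr => w wr; rewrite RintegralZl// (ipZl hH)//; last exact: cr.
rewrite mulrC; congr (_ * _); rewrite /Rintegral integral_indic//.
by rewrite setIT.
Qed.

(** Testing the difference [w] of the integrals against itself bounds |w| ^ 2 by |w| times the
    integral of the distance, which avoids a common refinement of the two partitions. *)
Lemma simple_integral_dist s t : is_simple H s -> is_simple H t ->
  intg P (fun x => hnorm H (s x - t x)) ->
  hnorm H (simple_integral P s - simple_integral P t) <=
  (\int[P]_x hnorm H (s x - t x))%R.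
Proof.
move=> hs ht ist; set w := _ - _.
have [cs _ _] := hs; have [ct _ _] := ht.
have cI := carrier_simple_integral hs; have cJ := carrier_simple_integral ht.
have cw : carrier H w by exact: carrierB.
have [is1 es] := simple_integral_ip hs cw; have [it1 et] := simple_integral_ip ht cw.
have : hnorm H w ^+ 2 <= hnorm H w * (\int[P]_x hnorm H (s x - t x))%R.
  rewrite hnorm_sqr// {1}/w ipBl// -es -et -RintegralB// -RintegralZl//.
  apply: le_Rint => [||x]; [exact: intgB|exact: intgZ|].
  rewrite -ipBl// mulrC; apply: ip_le => //; exact: carrierB.
rewrite expr2; have [->|w0] := eqVneq (hnorm H w) 0.
  by move=> _; apply: Rint_ge0 => x; exact: hnorm_ge0.
by rewrite ler_pM2l// lt_neqAle eq_sym w0 hnorm_ge0.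
Qed.

Lemma bochner_exists f : smeas H f -> intg P (fun x => hnorm H (f x)) ->
  exists m, is_bochner H P f m.
Proof.
move=> sf intf; have [s [hs sle sf0]] := smeas_dominated hH sf.
have cf x := smeas_carrier x sf.
have cs n x : carrier H (s n x) by have [] := hs n.
have mfs n : measurable_fun setT (fun x => hnorm H (f x - s n x)).
  by apply: measurable_smeas_dist => //; exact: smeas_simple.
have int3 : intg P (fun x => 3 * hnorm H (f x)) by exact: intgZ.
have intfs n : intg P (fun x => hnorm H (f x - s n x)).
  apply: (intg_le (g := fun x => 3 * hnorm H (f x))) => // x.
  by rewrite ger0_norm ?hnorm_ge0.
pose e n := (\int[P]_x hnorm H (f x - s n x))%R.
have [_] := Rint_dominated_cvg mfs sf0 int3
  (fun n x => eq_ind_r (fun r => r <= _) (sle n x) (ger0_norm (hnorm_ge0 H _))).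
rewrite Rint_cst -/(e _) => e0.
pose u n := simple_integral P (s n).
have cu n : carrier H (u n) by exact: carrier_simple_integral.
have du (m n : nat) : hnorm H (u m - u n) <= e m + e n.
  have hle x : hnorm H (s m x - s n x) <= hnorm H (f x - s m x) + hnorm H (f x - s n x).
    rewrite [X in _ <= X + _]hnorm_distC//; exact: hnorm_triangle.
  have ist : intg P (fun x => hnorm H (s m x - s n x)).
    apply: (intg_le (g := fun x => hnorm H (f x - s m x) + hnorm H (f x - s n x))).
    - by apply: measurable_smeas_dist => //; exact: smeas_simple.
    - by move=> x; rewrite ger0_norm ?hnorm_ge0.
    - exact: intgD.
  apply: le_trans (simple_integral_dist (hs m) (hs n) ist) _.
  rewrite /e -RintegralD//; apply: le_Rint => //; exact: intgD.
have [|m cm um] := hilbert_complete hH cu.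
  move=> eps eps0; have {}e0 : e n @[n --> \oo] --> 0 := e0; move/cvgrPdist_lt : e0 => /(_ (eps / 2)).
  rewrite divr_gt0// => /(_ isT)[N _ hN]; exists N => m n Nm Nn.
  have e_ge0 k : 0 <= e k by apply: Rint_ge0 => x; exact: hnorm_ge0.
  have eN k : (N <= k)%N -> e k < eps / 2.
    by move=> /hN; rewrite /= sub0r normrN ger0_norm.
  apply: le_lt_trans (du m n) _; rewrite [ltRHS]splitr.
  by apply: ltrD; exact: eN.
exists m; split => //; exists s; split => //.
apply/cvg_EFin => //; apply: filterE => n; exact: integrable_fin_num (intfs n).
Qed.

(** Any Bochner integral [m] is allowed: the one selected by [bochner] as well as the 0 of Stein's
    identity. Later questions about vector integrals are reduced to real ones in this way. *)
Lemma bochner_ip f m v : is_bochner H P f m -> smeas H f -> carrier H v ->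
  intg P (fun x => ip H (f x) v) /\ (\int[P]_x ip H (f x) v)%R = ip H m v.
Proof.
move=> [cf cm [s [hs mfs ifs um]]] sf cv.
have cs n x : carrier H (s n x) by have [] := hs n.
have cfs n x : carrier H (f x - s n x) by exact: carrierB.
(* The errors tend to 0 in the extended reals only, so they are finite, and the distances
   integrable, from some rank [N] on. *)
have /fine_cvgP[[N _ hN] e0] := ifs.
have intfs n : (N <= n)%N -> intg P (fun x => hnorm H (f x - s n x)).
  move=> Nn; apply: intg_lty => //; first by move=> x; exact: hnorm_ge0.
  by have := hN n Nn; rewrite /= ge0_fin_numE// integral_ge0// => x _; rewrite lee_fin hnorm_ge0.
have intfv : intg P (fun x => ip H (f x) v).
  have [is1 _] := simple_integral_ip (hs N) cv.
  apply: (intg_le (g := fun x => `|ip H (s N x) v| + hnorm H v * hnorm H (f x - s N x))).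
  - exact: measurable_smeas_ipr.
  - move=> x; rewrite -[f x in leLHS](subrK (s N x)) ipDl// addrC.
    apply: le_trans (ler_normD _ _) _; rewrite lerD2l mulrC; exact: cauchy_schwarz.
  - apply: intgD; first exact: intg_norm.
    by apply: intgZ; exact: intfs.
split => //.
pose e n := (\int[P]_x hnorm H (f x - s n x))%R.
have {}e0 : e n @[n --> \oo] --> 0 by [].
pose g n := hnorm H v * e n + hnorm H (simple_integral P (s n) - m) * hnorm H v.
have g0 : g n @[n --> \oo] --> 0.
  rewrite [X in _ --> X](_ : _ = hnorm H v * 0 + 0 * hnorm H v); last by rewrite mulr0 mul0r addr0.
  by apply: cvgD; apply: cvgM => //; exact: cvg_cst.
have hg n : (N <= n)%N -> `|(\int[P]_x ip H (f x) v)%R - ip H m v| <= g n.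
  move=> Nn; have [is1 es] := simple_integral_ip (hs n) cv.
  have cI := carrier_simple_integral (hs n).
  rewrite -(subrKA (\int[P]_x ip H (s n x) v)%R).
  apply: le_trans (ler_normD _ _) _; apply: lerD.
    rewrite -RintegralB//; apply: le_trans (le_normr_Rintegral _ _) _ => //.
      exact: intgB.
    rewrite -RintegralZl//; last exact: intfs.
    apply: le_Rint => [||x].
    - by apply: intg_norm; exact: intgB.
    - by apply: intgZ; exact: intfs.
    - by rewrite -ipBl// mulrC; exact: cauchy_schwarz.
  rewrite es -ipBl//; apply: cauchy_schwarz => //; exact: carrierB.
apply/eqP; rewrite -subr_eq0 -normr_eq0 eq_le normr_ge0 andbT.
have cg := cvgP _ g0; rewrite -(cvg_lim _ g0)//.
apply: limr_ge => //; exists N => // n /hg; exact.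
Qed.

Lemma bochner_spec f : smeas H f -> intg P (fun x => hnorm H (f x)) ->
  is_bochner H P f (bochner H P f).
Proof. by move=> sf /(bochner_exists sf)[m hm]; apply: xgetPex; exists m. Qed.

End bochner_theory.

(** * Fubini's theorem for real-valued integrals *)

Section product_integrals.
Context d1 d2 (T1 : measurableType d1) (T2 : measurableType d2) (R : realType).
Variables (m1 : {sigma_finite_measure set T1 -> \bar R})
  (m2 : {sigma_finite_measure set T2 -> \bar R}).

Lemma Rint_fubini (F : T1 * T2 -> R) : intg (m1 \x m2)%E F ->
  (forall x, intg m2 (fun y => F (x, y))) ->
  (\int[m1]_x \int[m2]_y F (x, y))%R = (\int[(m1 \x m2)%E]_z F z)%R.
Proof.
move=> hF hx; rewrite {1 3}/Rintegral; congr fine.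
rewrite -(integral12_prod_meas1 hF); apply: eq_integral => x _.
by rewrite EFin_Rintegral.
Qed.

Lemma intg_prod (f : T1 -> R) (g : T2 -> R) : intg m1 f -> intg m2 g ->
  intg (m1 \x m2)%E (fun z => f z.1 * g z.2).
Proof.
move=> hf hg; have mf := intg_measurable hf; have mg := intg_measurable hg.
have mF : measurable_fun setT (fun z : T1 * T2 => f z.1 * g z.2).
  by apply: measurable_funM; apply: measurableT_comp.
apply/integrable12ltyP; first exact/measurable_EFinP.
pose G := (\int[m2]_y `|g y|)%R.
have GE x : (\int[m2]_y `|(EFin \o (fun z => f z.1 * g z.2)%R) (x, y)| = (`|f x| * G)%R%:E)%E.
  rewrite /G -RintegralZl//; last exact: intg_norm.
  rewrite EFin_Rintegral; last by apply: intgZ; exact: intg_norm.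
  by apply: eq_integral => y _; rewrite /= normrM.
under eq_integral do rewrite GE mulrC.
rewrite -EFin_Rintegral ?ltry//; apply: intgZ; exact: intg_norm.
Qed.

Lemma Rint_prod (f : T1 -> R) (g : T2 -> R) : intg m1 f -> intg m2 g ->
  (\int[(m1 \x m2)%E]_z (f z.1 * g z.2))%R =
  (\int[m1]_x f x)%R * (\int[m2]_y g y)%R.
Proof.
move=> hf hg; rewrite -Rint_fubini; last 2 first.
- exact: intg_prod.
- by move=> x /=; exact: intgZ.
by rewrite -RintegralZr//; apply: eq_Rintegral => x _ /=; rewrite RintegralZl.
Qed.

End product_integrals.

(** * Approximation by finite-dimensional projections *)

Section projection_approximation.
Let split_lt (F : realFieldType) (a b e : F) : 0 < e -> a < e / 4 -> b < e / 4 -> 2 * a + b < e.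
Proof. lra. Qed.
Context (R : realType) (V : lmodType R) (H : inner_space V) (hH : is_hilbert H).
Variables (E : set V) (hE : orthonormal_basis H E).

(** Projections are contractions: replacing [u] by [v] costs |u - v| once for the vector and once
    for its projection. *)
Lemma hproj_near s (os : orthonormal_seq H s) u v : carrier H u -> carrier H v ->
  hnorm H (u - hproj H s u) <= 2 * hnorm H (u - v) + hnorm H (v - hproj H s v).
Proof.
move=> cu cv; have cpu := carrier_hproj hH os u; have cpv := carrier_hproj hH os v.
have cuv := carrierB hH cu cv.
have pB : hproj H s (u - v) = hproj H s u - hproj H s v.
  rewrite /hproj -sumrB !big_seq; apply: eq_bigr => e es.
  by case: os => _ /(_ _ es) ce _ _; rewrite ipBr// scalerBl.
have -> : u - hproj H s u = (u - v) + ((v - hproj H s v) - hproj H s (u - v)).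
  by rewrite pB opprB addrA !subrKA.
have cpuv := carrier_hproj hH os (u - v).
have cvv := carrierB hH cv cpv.
apply: le_trans (ler_hnormD hH cuv (carrierB hH cvv cpuv)) _.
have h1 := ler_hnormB hH cvv cpuv; have h2 := hnorm_hproj hH os cuv; lra.
Qed.

Lemma hproj_approx_seq (L s0 : seq V) eps : onseq E s0 -> {in L, forall v, carrier H v} ->
  0 < eps -> exists s, [/\ onseq E s, {subset s0 <= s} &
    forall t, onseq E t -> {subset s <= t} ->
      {in L, forall v, hnorm H (v - hproj H t v) < eps}].
Proof.
move=> os0 cL eps0; elim: L cL => [_|v L IH cL]; first by exists s0; split.
have [|s [os ss hs]] := IH; first by move=> w wL; apply: cL; rewrite inE wL orbT.
have [|q oq hq] := parseval_approx hH hE _ eps0 (v := v); first by apply: cL; rewrite inE eqxx.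
exists (undup (s ++ q)); split => [||t ot st w].
- exact: onseq_cat.
- by move=> x /ss xs; rewrite mem_undup mem_cat xs.
- rewrite inE => /predU1P[->|wL].
    by apply: hq => // x xq; apply: st; rewrite mem_undup mem_cat xq orbT.
  by apply: hs => // x xs; apply: st; rewrite mem_undup mem_cat xs.
Qed.

(** The approximants of [f] take countably many values, so a sequence of finite parts of the
    possibly uncountable basis suffices. Every part contains [s0], which lets a prescribed finite
    sum be compared with those along the sequence. *)
Lemma hproj_approx_smeas d (T : measurableType d) (f : T -> V) s0 : smeas H f ->
  onseq E s0 -> exists t : nat -> seq V,
  [/\ forall n, onseq E (t n), forall n, {subset s0 <= t n} &
    forall x, hnorm H (f x - hproj H (t n) (f x)) @[n --> \oo] --> 0].
Proof.
move=> [cf [s hs sf]] os0.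
have cs n x : carrier H (s n x) by have [] := hs n.
have /choice[r hr] n : exists r : seq V, forall w, w \in r <-> exists x, s n x = w.
  have [_ /finite_seqP[r rE] _] := hs n; exists r => w.
  have -> : (w \in r) <-> [set` r] w by [].
  by rewrite -rE; split => [[x _ <-]|[x <-]]; exists x.
have /choice[t ht] N : exists t, [/\ onseq E t, {subset s0 <= t} &
    forall n x, (n <= N)%N -> hnorm H (s n x - hproj H t (s n x)) < N.+1%:R^-1].
  (* The list collects all the values of the first N + 1 approximants. *)
  have [||t [ot s0t ht]] := @hproj_approx_seq (flatten [seq r i | i <- iota 0 N.+1]) s0 N.+1%:R^-1 os0.
  - by move=> w /flatten_mapP[n _ /hr[x <-]].
  - by rewrite invr_gt0.
  exists t; split => // n x nN; apply: ht => //; apply/flatten_mapP; exists n.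
    by rewrite mem_iota add0n ltnS.
  by apply/hr; exists x.
exists t; split => [n|n|x]; [by have [] := ht n|by have [] := ht n|].
apply/cvgrPdist_lt => eps eps0.
have e4 : 0 < eps / 4 by rewrite divr_gt0.
move/cvgrPdist_lt : (sf x) => /(_ _ e4)[M _ /(_ M (leqnn _))].
rewrite /= sub0r normrN ger0_norm ?hnorm_ge0// => hM.
have [N _ hN] := near_infty_natSinv_lt (PosNum e4).
exists (maxn M N) => // n /=; rewrite geq_max => /andP[Mn Nn].
have [ot _ htn] := ht n.
rewrite sub0r normrN ger0_norm ?hnorm_ge0//.
apply: le_lt_trans (hproj_near (onseq_orthonormal hE ot) (cf x) (cs M x)) _.
have h1 := htn M x Mn; have h2 : n.+1%:R^-1 < eps / 4 := hN n Nn.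
exact: split_lt eps0 hM (lt_trans h1 h2).
Qed.

End projection_approximation.

(** * Stein covariance operator *)

Section covariance.
Context (R : realType) (V : lmodType R) (H : inner_space V) (hH : is_hilbert H).
Context (d : nat).
Local Notation T := 'rV[R]_d.
Variables (xi : T -> V) (sxi : smeas H xi).
Local Notation K := (stein_kernel H xi).

Lemma stein_kernelC x y : K x y = K y x.
Proof. by apply: (ip_sym hH); exact: smeas_carrier. Qed.

Lemma stein_kernel_diag x : K x x = hnorm H (xi x) ^+ 2.
Proof. by rewrite hnorm_sqr//; exact: smeas_carrier. Qed.

Lemma stein_kernel_sqr_le x y : K x y ^+ 2 <= K x x * K y y.
Proof.
rewrite !stein_kernel_diag -exprMn -[K x y ^+ 2]real_normK ?num_real//.
rewrite ler_pXn2r ?nnegrE ?mulr_ge0 ?hnorm_ge0//.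
by apply: cauchy_schwarz => //; exact: smeas_carrier.
Qed.

Lemma measurable_stein_kernel2 d' (T' : measurableType d') (p q : T' -> T) :
  measurable_fun setT p -> measurable_fun setT q ->
  measurable_fun setT (fun z => K (p z) (q z)).
Proof. by move=> mp mq; exact: measurable_smeas2. Qed.

Lemma measurable_stein_kernel : measurable_fun setT (fun z : T * T => K z.1 z.2).
Proof. exact: measurable_stein_kernel2. Qed.

Variable P : probability T R.
Local Notation PP := (P \x P)%E.
Local Notation C := (stein_cov H xi P).

Lemma finite_energyP : finite_energy H xi P -> intg P (fun x => K x x).
Proof.
move=> fe; apply: intg_lty => //; first exact: measurable_stein_kernel2.
by move=> x; rewrite stein_kernel_diag sqr_ge0.
Qed.

Hypothesis fe : finite_energy H xi P.
Let iK := finite_energyP fe.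

Lemma intg_hnorm : intg P (fun x => hnorm H (xi x)).
Proof.
apply: (intg_le (g := fun x => K x x + 1)).
- exact: measurable_smeas_hnorm.
- move=> x; rewrite ger0_norm ?hnorm_ge0// stein_kernel_diag.
  have := sqr_ge0 (hnorm H (xi x) - 1); have := hnorm_ge0 H (xi x); nra.
- by apply: intgD => //; exact: intg_cst.
Qed.

Lemma intg_ip_ip u v : carrier H u -> carrier H v ->
  intg P (fun x => ip H (xi x) u * ip H (xi x) v).
Proof.
move=> cu cv; apply: (intg_le (g := fun x => hnorm H u * hnorm H v * K x x)).
- by apply: measurable_funM; exact: measurable_smeas_ipr.
- move=> x; rewrite normrM stein_kernel_diag.
  have cx := smeas_carrier x sxi.
  have -> : hnorm H u * hnorm H v * hnorm H (xi x) ^+ 2 =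
    (hnorm H (xi x) * hnorm H u) * (hnorm H (xi x) * hnorm H v) by ring.
  by apply: ler_pM => //; exact: cauchy_schwarz.
- exact: intgZ.
Qed.

Lemma intg_ip_sqr u : carrier H u -> intg P (fun x => ip H (xi x) u ^+ 2).
Proof. by move=> cu; have := intg_ip_ip cu cu; apply: eq_intg => x; rewrite expr2. Qed.

Lemma intg_kernel_sqr : intg PP (fun z => K z.1 z.2 ^+ 2).
Proof.
apply: (intg_le (g := fun z => K z.1 z.1 * K z.2 z.2)).
- by apply: measurable_funX; exact: measurable_stein_kernel.
- by move=> z; rewrite ger0_norm ?sqr_ge0//; exact: stein_kernel_sqr_le.
- exact: (intg_prod (f := fun x => K x x) (g := fun x => K x x)).
Qed.

Lemma bochner_cov h : carrier H h ->
  is_bochner H P (fun x => tensor H (xi x) (xi x) h) (C h).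
Proof.
move=> ch; apply: bochner_spec => //; first exact: smeas_tensor.
apply: (intg_le (g := fun x => hnorm H h * K x x)).
- by apply: measurable_smeas_hnorm => //; exact: smeas_tensor.
- move=> x; have cx := smeas_carrier x sxi.
  rewrite ger0_norm ?hnorm_ge0// /tensor hnormZ// stein_kernel_diag expr2 mulrA.
  apply: ler_wpM2r; first exact: hnorm_ge0.
  by rewrite mulrC; exact: cauchy_schwarz.
- exact: intgZ.
Qed.

Lemma carrier_cov h : carrier H h -> carrier H (C h).
Proof. by move=> /bochner_cov[]. Qed.

Lemma cov_ip h v : carrier H h -> carrier H v ->
  ip H (C h) v = (\int[P]_x (ip H (xi x) h * ip H (xi x) v))%R.
Proof.
move=> ch cv; have [_ <-] := bochner_ip hH (bochner_cov ch) (smeas_tensor hH sxi ch) cv.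
by apply: eq_Rintegral => x _; rewrite /tensor ipZl//; exact: smeas_carrier.
Qed.

Lemma cov_sym h v : carrier H h -> carrier H v -> ip H (C h) v = ip H h (C v).
Proof.
move=> ch cv; rewrite (ip_sym hH ch (carrier_cov cv)) !cov_ip//.
by apply: eq_Rintegral => x _; rewrite mulrC.
Qed.

Lemma intg_cov_kernel h : carrier H h ->
  intg PP (fun z => ip H (xi z.1) h * ip H (xi z.2) h * K z.1 z.2).
Proof.
move=> ch; apply: intg_mul.
- by apply: measurable_funM; apply: (measurableT_comp (f := fun x => ip H (xi x) h)) => //;
    exact: measurable_smeas_ipr.
- exact: measurable_stein_kernel.
- apply: (eq_intg (f := fun z => ip H (xi z.1) h ^+ 2 * ip H (xi z.2) h ^+ 2)).
    by move=> z; rewrite exprMn.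
  by apply: (intg_prod (f := fun x => ip H (xi x) h ^+ 2)
    (g := fun x => ip H (xi x) h ^+ 2)); exact: intg_ip_sqr.
- exact: intg_kernel_sqr.
Qed.

(** Each of the two factors C h is an expectation; with independent copies x and y, their inner
    product brings in K x y. *)
Lemma sqr_hnorm_cov h : carrier H h ->
  hnorm H (C h) ^+ 2 =
  (\int[PP]_z (ip H (xi z.1) h * ip H (xi z.2) h * K z.1 z.2))%R.
Proof.
move=> ch; have cC := carrier_cov ch; rewrite hnorm_sqr// cov_ip//.
rewrite -(Rint_fubini (intg_cov_kernel ch)); last first.
  move=> x; have := intgZ (ip H (xi x) h) (intg_ip_ip ch (smeas_carrier x sxi)).
  by apply: eq_intg => y /=; rewrite (stein_kernelC x y) mulrA.
apply: eq_Rintegral => x _ /=; have cx := smeas_carrier x sxi.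
rewrite (ip_sym hH cx cC) cov_ip// -RintegralZl//; last exact: intg_ip_ip.
by apply: eq_Rintegral => y _; rewrite (stein_kernelC x y) mulrA.
Qed.

(** Cauchy-Schwarz on the product space separates the kernel from the tensor square of <xi, h>.
    Keeping <C h, h> on the right is what later yields a variance proportional to the squared
    KSD. *)
Lemma sqr_hnorm_cov_le h : carrier H h ->
  (hnorm H (C h) ^+ 2) ^+ 2 <=
  (\int[P]_x (ip H (xi x) h ^+ 2))%R ^+ 2 * (\int[PP]_z (K z.1 z.2 ^+ 2))%R.
Proof.
move=> ch; rewrite sqr_hnorm_cov//.
have i2 : intg PP (fun z => ip H (xi z.1) h ^+ 2 * ip H (xi z.2) h ^+ 2).
  by apply: (intg_prod (f := fun x => ip H (xi x) h ^+ 2)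
    (g := fun x => ip H (xi x) h ^+ 2)); exact: intg_ip_sqr.
apply: le_trans (Rint_cauchy_schwarz _ _ _ _) _.
- by apply: measurable_funM; apply: (measurableT_comp (f := fun x => ip H (xi x) h)) => //;
    exact: measurable_smeas_ipr.
- exact: measurable_stein_kernel.
- by apply: eq_intg i2 => z; rewrite exprMn.
- exact: intg_kernel_sqr.
rewrite le_eqVlt; apply/orP; left; apply/eqP; congr (_ * _).
rewrite expr2 -(Rint_prod (f := fun x => ip H (xi x) h ^+ 2)
    (g := fun x => ip H (xi x) h ^+ 2)); [|exact: intg_ip_sqr..].
by apply: eq_Rintegral => z _; rewrite exprMn.
Qed.

End covariance.

(* onb is empty, and every trace is 0, when there is no orthonormal basis. *)
Lemma onb_trace_gt0 (R : realType) (V : lmodType R) (H : inner_space V) (A : V -> V) :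
  (0 < trace H A)%E -> orthonormal_basis H (onb H).
Proof.
rewrite /trace /onb; case: xgetP => [E _ //|_].
by rewrite esum_set0 ltxx.
Qed.

(** * Trace and Hilbert-Schmidt norm of the covariance *)

Section trace.
Context (R : realType) (V : lmodType R) (H : inner_space V) (hH : is_hilbert H).
Context (d : nat).
Local Notation T := 'rV[R]_d.
Variables (xi : T -> V) (sxi : smeas H xi) (P : probability T R).
Hypothesis fe : finite_energy H xi P.
Hypothesis hE : orthonormal_basis H (onb H).
Local Notation K := (stein_kernel H xi).
Local Notation PP := (P \x P)%E.
Local Notation C := (stein_cov H xi P).
Local Notation EK2 := (\int[PP]_z (K z.1 z.2 ^+ 2))%R.

Let cE e : onb H e -> carrier H e. Proof. by case: hE => /(_ e). Qed.

(** For orthonormal [s], the Gram kernel of [xi] projected onto its span; finite sums over entries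
    of C become integrals of it. *)
Definition trunc_kernel (s : seq V) (z : T * T) : R :=
  \sum_(e <- s) ip H (xi z.1) e * ip H (xi z.2) e.

Section trunc.
Variables (s : seq V) (os : onseq (onb H) s).

Let ce e : e \in s -> carrier H e. Proof. by move=> es; apply/cE; case: os => _; apply. Qed.
Let oo := onseq_orthonormal hE os.

Lemma trunc_kernelE x y : trunc_kernel s (x, y) = ip H (hproj H s (xi x)) (xi y).
Proof.
have [cx cy] := (smeas_carrier x sxi, smeas_carrier y sxi).
rewrite ip_hprojl// /trunc_kernel !big_seq; apply: eq_bigr => e es /=.
by rewrite !(ip_sym hH _ (ce es)).
Qed.

Lemma trunc_kernel_sqr_le z : trunc_kernel s z ^+ 2 <= K z.1 z.1 * K z.2 z.2.
Proof.
case: z => x y /=; have [cx cy] := (smeas_carrier x sxi, smeas_carrier y sxi).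
have cp := carrier_hproj hH oo (xi x).
rewrite trunc_kernelE !(stein_kernel_diag hH sxi) -exprMn.
rewrite -[leLHS]real_normK ?num_real//.
rewrite ler_pXn2r ?nnegrE ?mulr_ge0 ?hnorm_ge0//.
apply: le_trans (cauchy_schwarz hH cp cy) _; apply: ler_wpM2r; first exact: hnorm_ge0.
exact: hnorm_hproj.
Qed.

Lemma measurable_trunc_kernel : measurable_fun setT (trunc_kernel s).
Proof.
rewrite (_ : trunc_kernel s = fun z => \sum_(e <- s)
    (if e \in s then ip H (xi z.1) e * ip H (xi z.2) e else 0)); last first.
  by apply/funext => z; rewrite /trunc_kernel big_seq big_mkcond.
apply: (@measurable_sum _ _ _ _ _ s (fun e (z : T * T) => if e \in s then
  ip H (xi z.1) e * ip H (xi z.2) e else 0)) => e; have [es|_] //= := boolP (e \in s).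
by apply: measurable_funM; apply: (measurableT_comp (f := fun x => ip H (xi x) e)) => //;
  apply: measurable_smeas_ipr => //; exact: ce.
Qed.

Lemma sum_sqr_hnorm_cov :
  \sum_(e <- s) hnorm H (C e) ^+ 2 = (\int[PP]_z (trunc_kernel s z * K z.1 z.2))%R.
Proof.
rewrite big_seq; under eq_bigr => e es do rewrite (sqr_hnorm_cov hH sxi fe (ce es)).
rewrite -Rintegral_sum; last by move=> e es; exact: intg_cov_kernel (ce es).
by apply: eq_Rintegral => z _; rewrite -big_seq -mulr_suml.
Qed.

(** The square of an entry <C e, f> is an integral over two independent copies; summed over e and f,
    the integrand factors as a square. *)
Lemma sum_sqr_cov : \sum_(e <- s) \sum_(f <- s) ip H (C e) f ^+ 2 =
  (\int[PP]_z (trunc_kernel s z ^+ 2))%R.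
Proof.
pose F e f z := (ip H (xi z.1) e * ip H (xi z.1) f) * (ip H (xi z.2) e * ip H (xi z.2) f).
have iF e f : e \in s -> f \in s -> intg PP (F e f).
  move=> es fs; apply: (intg_prod (f := fun x => ip H (xi x) e * ip H (xi x) f)
    (g := fun x => ip H (xi x) e * ip H (xi x) f));
    by apply: intg_ip_ip => //; exact: ce.
have cF e f : e \in s -> f \in s -> ip H (C e) f ^+ 2 = (\int[PP]_z F e f z)%R.
  move=> es fs; rewrite (cov_ip hH sxi fe (ce es) (ce fs)) expr2.
  rewrite -(Rint_prod (f := fun x => ip H (xi x) e * ip H (xi x) f)
    (g := fun x => ip H (xi x) e * ip H (xi x) f))//;
    by apply: intg_ip_ip => //; exact: ce.
rewrite big_seq; under eq_bigr => e es.
  rewrite big_seq; under eq_bigr => f fs do rewrite (cF e f es fs).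
  rewrite -Rintegral_sum; last by move=> f fs; exact: iF.
  over.
rewrite -Rintegral_sum; last by move=> e es; apply: intg_sum => f fs; exact: iF.
apply: eq_Rintegral => z _; rewrite -big_seq expr2 /trunc_kernel mulr_suml.
apply: eq_bigr => e _; rewrite -big_seq mulr_sumr; apply: eq_bigr => f _.
rewrite /F; ring.
Qed.

End trunc.

Lemma trunc_kernel_cvg s0 : onseq (onb H) s0 -> exists t : nat -> seq V,
  [/\ forall n, onseq (onb H) (t n), forall n, {subset s0 <= t n} &
    forall z, trunc_kernel (t n) z @[n --> \oo] --> K z.1 z.2].
Proof.
move=> os0; have [t [ot st tv]] := hproj_approx_smeas hH hE sxi os0.
exists t; split => // -[x y] /=.
have [cx cy] := (smeas_carrier x sxi, smeas_carrier y sxi).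
apply: (cvg_dist_le (e := fun n => hnorm H (xi x - hproj H (t n) (xi x)) * hnorm H (xi y))).
  move=> n; have cp := carrier_hproj hH (onseq_orthonormal hE (ot n)) (xi x).
  rewrite trunc_kernelE// distrC /stein_kernel -ipBl//; apply: cauchy_schwarz => //.
  exact: carrierB.
by rewrite -[X in _ --> X](mul0r (hnorm H (xi y))); apply: cvgM => //; exact: cvg_cst.
Qed.

Let K2_le z : `|K z.1 z.2| ^+ 2 <= K z.1 z.1 * K z.2 z.2.
Proof. by rewrite real_normK ?num_real//; exact: stein_kernel_sqr_le. Qed.

Lemma trunc_kernel_ip_cvg (t : nat -> seq V) : (forall n, onseq (onb H) (t n)) ->
  (forall z, trunc_kernel (t n) z @[n --> \oo] --> K z.1 z.2) ->
  (\int[PP]_z (trunc_kernel (t n) z * K z.1 z.2))%R @[n --> \oo] --> EK2 /\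
  (\int[PP]_z (trunc_kernel (t n) z ^+ 2))%R @[n --> \oo] --> EK2.
Proof.
move=> ot tv; have mK := measurable_stein_kernel hH sxi.
have iKK : intg PP (fun z => K z.1 z.1 * K z.2 z.2).
  by have iK := finite_energyP hH sxi fe; exact: (intg_prod iK iK).
split.
  apply: (Rint_dominated_cvg (f_ := fun n z => trunc_kernel (t n) z * K z.1 z.2)
    (f := fun z => K z.1 z.2 ^+ 2) _ _ iKK _).2.
  - by move=> n; apply: measurable_funM => //; exact: measurable_trunc_kernel.
  - by move=> z; rewrite expr2; apply: cvgM => //; exact: cvg_cst.
  - move=> n z; rewrite normrM.
    have h1 := trunc_kernel_sqr_le (ot n) z; have h2 := K2_le z.
    rewrite -[_ ^+ 2]real_normK ?num_real// in h1.
    have := sqr_ge0 (`|trunc_kernel (t n) z| - `|K z.1 z.2|); nra.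
apply: (Rint_dominated_cvg (f_ := fun n z => trunc_kernel (t n) z ^+ 2)
  (f := fun z => K z.1 z.2 ^+ 2) _ _ iKK _).2.
- by move=> n; apply: measurable_funX => //; exact: measurable_trunc_kernel.
- by move=> z; rewrite expr2; under eq_fun do rewrite expr2; exact: cvgM.
- by move=> n z; rewrite ger0_norm ?sqr_ge0//; exact: trunc_kernel_sqr_le.
Qed.

Let ip_covcov e : onb H e -> ip H e (C (C e)) = hnorm H (C e) ^+ 2.
Proof.
move=> /cE ce; have cC := carrier_cov hH sxi fe ce.
by rewrite -(cov_sym hH sxi fe)// hnorm_sqr.
Qed.

Let sum_fset (s : seq V) : onseq (onb H) s ->
  (\sum_(e \in [set` s]) (ip H e (C (C e)))%:E)%E =
  (\sum_(e <- s) hnorm H (C e) ^+ 2)%:E.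
Proof.
move=> [us sE]; rewrite -fsbig_seq// -sumEFin big_seq [RHS]big_seq.
by apply: eq_bigr => e /sE/ip_covcov ->.
Qed.

(** Any finite partial sum is below those along a sequence of larger finite sets, which tend to E K
    ^ 2; conversely, the sums along one such sequence are partial sums of the trace. *)
Lemma trace_cov_sqr : trace H (C \o C) = EK2%:E.
Proof.
have on0 : onseq (onb H) [::] by split.
apply/eqP; rewrite eq_le; apply/andP; split.
  apply: ge_ereal_sup => _ [F [/finite_seqP[s ->] sE] <-].
  have -> : [set` s] = [set` undup s] by apply/seteqP; split => x /=; rewrite mem_undup.
  have os : onseq (onb H) (undup s).
    by split; [exact: undup_uniq|move=> e; rewrite mem_undup => /sE].
  rewrite sum_fset// lee_fin.
  have [t [ot st tv]] := trunc_kernel_cvg os.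
  have [h _] := trunc_kernel_ip_cvg ot tv.
  rewrite -(cvg_lim _ h)//; apply: limr_ge; first by apply/cvg_ex; exists EK2.
  apply: nearW => n; rewrite -sum_sqr_hnorm_cov//.
  have [utn _] := ot n; have [us _] := os.
  have := @sum_undup_cat R V (undup s) (t n) (fun e => hnorm H (C e) ^+ 2)
    (fun v => sqr_ge0 _) us.
  move/le_trans; apply; rewrite le_eqVlt; apply/orP; left; apply/eqP.
  apply: perm_big; apply: uniq_perm => //; first exact: undup_uniq.
  move=> e; rewrite mem_undup mem_cat; case: (boolP (e \in undup s)) => // /st -> //.
have [t [ot _ tv]] := trunc_kernel_cvg on0.
have [h _] := trunc_kernel_ip_cvg ot tv.
have [tr|] := boolP (trace H (C \o C) \is a fin_num); last first.
  rewrite ge0_fin_numE ?ltNge ?negbK; first by move=> /(le_trans (leey _)).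
  by apply: esum_ge0 => e Ee; rewrite ip_covcov// lee_fin sqr_ge0.
rewrite -(fineK tr) lee_fin -(cvg_lim _ h)//; apply: limr_le; first by apply/cvg_ex; exists EK2.
apply: nearW => n; rewrite -sum_sqr_hnorm_cov// -lee_fin fineK// -sum_fset//.
apply: ereal_sup_ubound; exists [set` t n] => //; split; first exact: finite_seq.
by move=> e /= et; case: (ot n) => _; apply.
Qed.

Lemma hs_norm_cov : hs_norm H C = Num.sqrt EK2.
Proof.
rewrite /hs_norm -[EK2]/(fine EK2%:E) -trace_cov_sqr; congr (Num.sqrt (fine _)).
by apply: eq_esum => e Ee; rewrite /= ip_covcov.
Qed.

(** The source of the finitely many directions of the lower bound: they carry almost all of the
    Hilbert-Schmidt norm. *)
Lemma cov_matrix_large a : a < EK2 -> exists2 s, onseq (onb H) s &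
  a < \sum_(e <- s) \sum_(f <- s) ip H (C e) f ^+ 2.
Proof.
have on0 : onseq (onb H) [::] by split.
move=> aK; have [t [ot _ tv]] := trunc_kernel_cvg on0.
have [_ h] := trunc_kernel_ip_cvg ot tv.
have [N _ hN] := cvgr_gt _ h _ aK.
by exists (t N) => //; rewrite sum_sqr_cov; [apply: (hN N) => /=|exact: ot].
Qed.

(** Bessel bounds each row by |C e| ^ 2, and these bounds add up to a partial sum of the trace. *)
Lemma sum_sqr_cov_le s : onseq (onb H) s ->
  \sum_(e <- s) \sum_(f <- s) ip H (C e) f ^+ 2 <= EK2.
Proof.
move=> os; have oo := onseq_orthonormal hE os.
have ce e : e \in s -> carrier H e by case: oo => _ /(_ e).
apply: (@le_trans _ _ (\sum_(e <- s) hnorm H (C e) ^+ 2)).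
  rewrite big_seq [leRHS]big_seq; apply: ler_sum => e es.
  have cC := carrier_cov hH sxi fe (ce e es).
  rewrite hnorm_sqr//; apply: le_trans (bessel hH oo cC).
  rewrite big_seq [leRHS]big_seq; apply: ler_sum => f fs.
  by rewrite (ip_sym hH cC (ce f fs)).
rewrite -lee_fin -sum_fset// -trace_cov_sqr; apply: ereal_sup_ubound.
exists [set` s] => //; split; first exact: finite_seq.
by move=> e /= et; case: os => _; apply.
Qed.

End trace.

(** * Second moments of statistics of i.i.d. samples *)

Section tuple_integrals.
Context d (T : measurableType d) (R : realType) (P : probability T R).
Local Notation TM n := (tuple_measure P n).
Implicit Types n : nat.

Lemma measurable_tnth_comp n (g : T -> R) (i : 'I_n) : measurable_fun setT g ->
  measurable_fun setT (fun t : n.-tuple T => g (tnth t i)).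
Proof. by move=> mg; apply: (measurableT_comp mg); exact: measurable_tnth. Qed.

Lemma tuple_integral_cons n (f : n.+1.-tuple T -> \bar R) :
  measurable_fun setT f -> (forall t, 0 <= f t)%E ->
  (\int[TM n.+1]_t f t = \int[P]_x \int[TM n]_t f (cons_pair (x, t)))%E.
Proof.
move=> mf f0; rewrite [LHS]/= ge0_integral_pushforward//; last first.
  exact: measurable_cons_pair.
rewrite fubini_tonelli1//; last by move=> z; exact: f0.
by apply: (measurableT_comp (f := f)) => //; exact: measurable_cons_pair.
Qed.

Lemma tuple_integral_swap n (f : T * n.-tuple T -> \bar R) :
  measurable_fun setT f -> (forall t, 0 <= f t)%E ->
  (\int[P]_x \int[TM n]_t f (x, t) = \int[TM n]_t \int[P]_x f (x, t))%E.
Proof. by move=> mf f0; exact: fubini_tonelli. Qed.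

Lemma tuple_integral1 n : (\int[TM n]_t 1 = 1)%E.
Proof.
elim: n => [|n IH]; first by rewrite /= integral_dirac// diracT mul1e.
rewrite tuple_integral_cons//; under eq_integral do rewrite IH.
by rewrite integral_cst// mul1e; exact: probability_setT.
Qed.

Lemma tuple_integral_cst n (a : \bar R) : (\int[TM n]_t a = a)%E.
Proof.
rewrite integral_cst//= -[RHS]mule1; congr (a * _)%E.
by have := tuple_integral1 n; rewrite integral_cst// mul1e.
Qed.

Lemma sum_cons_pair n (F : T -> R) x (t : n.-tuple T) :
  \sum_(i < n.+1) F (tnth (cons_pair (x, t)) i) = F x + \sum_(i < n) F (tnth t i).
Proof.
rewrite big_ord_recl tnth0; congr (_ + _); apply: eq_bigr => i _.
by rewrite tnthS.
Qed.

(** Nonnegativity lets Tonelli peel off one point at a time, with no prior integrability on the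
    tuple space. The added point is integrated first, since its centring removes the cross term. *)
Lemma tuple_sqr_sum n (f : T -> R) : intg P f -> intg P (fun x => f x ^+ 2) ->
  (\int[P]_x f x)%R = 0 ->
  (\int[TM n]_t ((\sum_(i < n) f (tnth t i)) ^+ 2)%:E =
   (n%:R * (\int[P]_x f x ^+ 2)%R)%:E)%E.
Proof.
move=> if1 if2 f0; have mf := intg_measurable if1.
pose V := (\int[P]_x f x ^+ 2)%R; have V0 : 0 <= V by apply: Rint_ge0 => x; exact: sqr_ge0.
pose S k (t : k.-tuple T) := \sum_(i < k) f (tnth t i).
have mS k : measurable_fun setT (S k).
  by apply: measurable_sum => i; exact: measurable_tnth_comp.
elim: n => [|n IH].
  by under eq_integral do rewrite big_ord0 expr0n; rewrite integral0 mul0r.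
rewrite tuple_integral_cons; last 2 first.
- by apply/measurable_EFinP; apply: measurable_funX; exact: mS.
- by move=> t; rewrite lee_fin sqr_ge0.
under eq_integral do under eq_integral do rewrite sum_cons_pair.
rewrite (tuple_integral_swap (f := fun z : T * n.-tuple T => ((f z.1 + S n z.2) ^+ 2)%:E)); last 2 first.
- apply/measurable_EFinP; apply: measurable_funX; apply: measurable_funD.
    exact: (measurableT_comp mf (measurable_fst (T1 := T) (T2 := n.-tuple T))).
  exact: (measurableT_comp (mS n) (measurable_snd (T1 := T) (T2 := n.-tuple T))).
- by move=> t; rewrite lee_fin sqr_ge0.
under eq_integral => t _.
  rewrite (_ : (\int[P]_x _)%E = (V + S n t ^+ 2)%:E); last first.
    have i1 : intg P (fun x => 2 * S n t * f x) by exact: intgZ.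
    rewrite -EFin_Rintegral /=; last first.
      apply: (eq_intg (f := fun x => f x ^+ 2 + 2 * S n t * f x + S n t ^+ 2)).
        by move=> x; ring.
      by apply: intgD; [exact: intgD|exact: intg_cst].
    congr EFin; transitivity
       (\int[P]_x (f x ^+ 2 + 2 * S n t * f x + S n t ^+ 2))%R.
      by apply: eq_Rintegral => x _; ring.
    rewrite !RintegralD//; [|exact: intgD|exact: intg_cst].
    by rewrite RintegralZl// f0 Rint_cst mulr0 addr0.
  rewrite EFinD.
  over.
rewrite ge0_integralD//; last 2 first.
- by move=> t _; rewrite lee_fin sqr_ge0.
- by apply/measurable_EFinP; apply: measurable_funX; exact: mS.
rewrite tuple_integral_cst IH -EFinD; congr EFin.
by rewrite -/V -natr1 mulrDl mul1r addrC.
Qed.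

Section degenerate.
Variables (h : T -> T -> R).
Hypotheses (mh : measurable_fun setT (fun z : T * T => h z.1 z.2))
  (hC : forall x y, h x y = h y x) (ih : forall x, intg P (h x))
  (ih2 : forall x, intg P (fun y => h x y ^+ 2))
  (h0 : forall x, (\int[P]_y h x y)%R = 0) (ihh : intg (P \x P)%E (fun z => h z.1 z.2 ^+ 2)).

Let S n (t : n.-tuple T) :=
  \sum_(i < n) \sum_(j < n | i != j) h (tnth t i) (tnth t j).
Let Q n x (t : n.-tuple T) := \sum_(i < n) h x (tnth t i).
Let W := (\int[(P \x P)%E]_z (h z.1 z.2 ^+ 2))%R.

(** The new point contributes a row and a column, equal by symmetry of [h]. *)
Let S_cons n x (t : n.-tuple T) : S (cons_pair (x, t)) = 2 * Q x t + S t.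
Proof.
rewrite /S big_ord_recl /= tnth0.
have -> : \sum_(j < n.+1 | ord0 != j) h x (tnth (cons_pair (x, t)) j) = Q x t.
  rewrite big_mkcond big_ord_recl /= add0r; apply: eq_bigr => i _.
  by rewrite tnthS.
rewrite (_ : \sum_(i < n) _ = Q x t + S t); first by rewrite mulr2n mulrDl mul1r addrA.
rewrite /Q /S -big_split; apply: eq_bigr => i _ /=.
rewrite big_mkcond big_ord_recl /= tnth0 !tnthS hC; congr (_ + _).
rewrite [RHS]big_mkcond; apply: eq_bigr => j _.
by rewrite tnthS.
Qed.

Let mS n : measurable_fun setT (@S n).
Proof.
apply: measurable_sum => i.
under eq_fun do rewrite big_mkcond.
apply: (@measurable_sum _ _ _ _ _ _ (fun j (t : n.-tuple T) =>
  if i != j then h (tnth t i) (tnth t j) else 0)) => j; have [ij|_] //= := boolP (i != j).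
apply: (measurableT_comp (f := fun z : T * T => h z.1 z.2)
  (g := fun t : n.-tuple T => (tnth t i, tnth t j))) => //.
by apply: measurable_fun_pair; exact: measurable_tnth.
Qed.

Let mQ n : measurable_fun setT (fun z : T * n.-tuple T => Q z.1 z.2).
Proof.
apply: measurable_sum => i.
apply: (measurableT_comp (f := fun z : T * T => h z.1 z.2)
  (g := fun z : T * n.-tuple T => (z.1, tnth z.2 i))) => //.
apply: measurable_fun_pair => //.
by apply: (measurableT_comp (f := fun t : n.-tuple T => tnth t i)) => //; exact: measurable_tnth.
Qed.

(* A new point x adds 2 * Q x t to S t; integrating over x first kills the
   cross term, and Q x is a centred sum once x is fixed. *)
Lemma tuple_sqr_sum2 n :
  (\int[TM n]_t (S t ^+ 2)%:E = (2 * n%:R * (n%:R - 1) * W)%:E)%E.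
Proof.
elim: n => [|n IH].
  by under eq_integral do rewrite /S big_ord0 expr0n; rewrite integral0 mulr0 !mul0r.
have mR (x : T) : measurable_fun setT (h x).
  by have := ih x => /intg_measurable.
rewrite tuple_integral_cons; last 2 first.
- by apply/measurable_EFinP; apply: measurable_funX; exact: mS.
- by move=> t; rewrite lee_fin sqr_ge0.
under eq_integral do under eq_integral do rewrite S_cons.
rewrite (tuple_integral_swap
  (f := fun z : T * n.-tuple T => ((2 * Q z.1 z.2 + S z.2) ^+ 2)%:E)); last 2 first.
- apply/measurable_EFinP; apply: measurable_funX; apply: measurable_funD.
    by apply: measurable_funM => //; exact: mQ.
  exact: (measurableT_comp (@mS n) (measurable_snd (T1 := T) (T2 := n.-tuple T))).
- by move=> t; rewrite lee_fin sqr_ge0.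
have iQ t : intg P (fun x => @Q n x t).
  by apply: intg_sum => i _; apply: eq_intg (ih (tnth t i)) => x; exact: hC.
have Q0 t : (\int[P]_x @Q n x t)%R = 0.
  rewrite Rintegral_sum; last first.
    by move=> i _; apply: eq_intg (ih (tnth t i)) => x; exact: hC.
  rewrite big1// => i _; rewrite -(h0 (tnth t i)).
  by apply: eq_Rintegral => x _; exact: hC.
have mQ1 t : measurable_fun setT (fun x => @Q n x t) by exact: intg_measurable.
have iQ2 t : intg P (fun x => @Q n x t ^+ 2).
  apply: (eq_intg (f := fun x => \sum_(i < n) \sum_(j < n)
     h (tnth t i) x * h (tnth t j) x)).
    move=> x; rewrite expr2 /Q mulr_suml; apply: eq_bigr => i _.
    by rewrite mulr_sumr; apply: eq_bigr => j _; rewrite !(hC x).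
  by apply: intg_sum => i _; apply: intg_sum => j _; exact: intg_mul.
under eq_integral => t _.
  rewrite (_ : (\int[P]_x _)%E = (4%:E * \int[P]_x (Q x t ^+ 2)%:E + (S t ^+ 2)%:E)%E); last first.
    have i1 : intg P (fun x => 4 * S t * Q x t) by exact: intgZ.
    have i2 : intg P (fun x => 4 * Q x t ^+ 2) by exact: intgZ.
    rewrite -!EFin_Rintegral //=; last first.
      apply: (eq_intg (f := fun x => 4 * Q x t ^+ 2 + 4 * S t * Q x t + S t ^+ 2)).
        by move=> x; ring.
      by apply: intgD; [exact: intgD|exact: intg_cst].
    rewrite -EFinM -EFinD; congr EFin; transitivity
       (\int[P]_x (4 * Q x t ^+ 2 + 4 * S t * Q x t + S t ^+ 2))%R.
      by apply: eq_Rintegral => x _; ring.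
    rewrite !RintegralD//; [|exact: intgD|exact: intg_cst].
    by rewrite Rint_cst !RintegralZl// Q0 mulr0 addr0.
  over.
have mQ2 : measurable_fun setT (fun z : T * n.-tuple T => (Q z.1 z.2 ^+ 2)%:E).
  by apply/measurable_EFinP; apply: measurable_funX; exact: mQ.
have mI : measurable_fun setT (fun t : n.-tuple T => \int[P]_x (Q x t ^+ 2)%:E)%E.
  apply: (measurable_fun_fubini_tonelli_G (fun z : T * n.-tuple T => (Q z.1 z.2 ^+ 2)%:E)) => //.
  by move=> z; rewrite lee_fin sqr_ge0.
have I0 (t : n.-tuple T) : (0 <= \int[P]_x (Q x t ^+ 2)%:E)%E.
  by apply: integral_ge0 => x _; rewrite lee_fin sqr_ge0.
rewrite ge0_integralD//; last 4 first.
- by move=> t _; rewrite mule_ge0.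
- exact: measurable_funeM.
- by move=> t _; rewrite lee_fin sqr_ge0.
- by apply/measurable_EFinP; apply: measurable_funX; exact: mS.
rewrite ge0_integralZl// IH -(tuple_integral_swap
  (f := fun z : T * n.-tuple T => (Q z.1 z.2 ^+ 2)%:E))//; last first.
  by move=> z; rewrite lee_fin sqr_ge0.
under eq_integral => x _ do rewrite /= tuple_sqr_sum//.
have iH : intg P (fun x => \int[P]_y (h x y ^+ 2))%R.
  apply: intg_lty => //.
  - have := measurable_fun_fubini_tonelli_F (m2 := P) (fun z : T * T => (h z.1 z.2 ^+ 2)%:E).
    rewrite /fubini_F => hh; apply/measurable_EFinP.
    rewrite (_ : _ \o _ = fun x => (\int[P]_y (h x y ^+ 2)%:E)%E).
      apply: hh; first by apply/measurable_EFinP; exact: measurable_funX.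
      by move=> z; rewrite lee_fin sqr_ge0.
    by apply/funext => x /=; rewrite EFin_Rintegral.
  - by move=> x; apply: Rint_ge0 => y; exact: sqr_ge0.
  - under eq_integral do rewrite EFin_Rintegral//.
    rewrite -(fubini_tonelli1 (fun z : T * T => (h z.1 z.2 ^+ 2)%:E)).
    + by rewrite -EFin_Rintegral// ltry.
    + by apply/measurable_EFinP; exact: measurable_funX.
    + by move=> z; rewrite lee_fin sqr_ge0.
rewrite -EFin_Rintegral; last exact: intgZ.
rewrite RintegralZl//= (Rint_fubini ihh)// -/W -EFinM -EFinD; congr EFin.
by rewrite -natr1; ring.
Qed.

End degenerate.
End tuple_integrals.

(** * Risk of the U-statistic estimator *)

Section upper_bound.
Context (R : realType) (V : lmodType R) (H : inner_space V) (hH : is_hilbert H).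
Context (d : nat).
Local Notation T := 'rV[R]_d.
Variables (xi : T -> V) (sxi : smeas H xi) (P : probability T R).
Hypothesis fe : finite_energy H xi P.
Local Notation K := (stein_kernel H xi).
Local Notation PP := (P \x P)%E.
Local Notation C := (stein_cov H xi P).
Local Notation EK2 := (\int[PP]_z (K z.1 z.2 ^+ 2))%R.
Local Notation mu := (mean_embedding H xi P).
Local Notation m := (ksd H xi P).
Let G x := ip H (xi x) mu.

Lemma mean_embedding_spec : is_bochner H P xi mu.
Proof. by apply: bochner_spec => //; exact: intg_hnorm. Qed.

Lemma carrier_mean_embedding : carrier H mu.
Proof. by case: mean_embedding_spec. Qed.

Let cmu := carrier_mean_embedding.
Let cxi x : carrier H (xi x) := smeas_carrier x sxi.

Let mG : measurable_fun setT G.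
Proof. exact: measurable_smeas_ipr. Qed.

Let iG : intg P G.
Proof. by have [] := bochner_ip hH mean_embedding_spec sxi cmu. Qed.

Let iG2 : intg P (fun x => G x ^+ 2).
Proof. exact: intg_ip_sqr. Qed.

Let EG : (\int[P]_x G x)%R = m ^+ 2.
Proof.
by have [_ ->] := bochner_ip hH mean_embedding_spec sxi cmu; rewrite /ksd hnorm_sqr.
Qed.

(** Used with a = E G ^ 2, c = |C mu|, t = KSD and k = E K ^ 2. The last hypothesis says c ^ 2 <= a
    * sqrt k, so a ^ 2 <= c ^ 2 * t ^ 2 <= a * sqrt k * t ^ 2, and a factor a cancels. *)
Let sqr_le_aux (a c t k : R) : 0 <= a -> 0 <= c -> 0 <= t -> 0 <= k -> a <= c * t ->
  (c ^+ 2) ^+ 2 <= a ^+ 2 * k -> a <= t ^+ 2 * Num.sqrt k.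
Proof.
move=> a0 c0 t0 k0 h1 h2.
have s0 := sqrtr_ge0 k; move: (sqr_sqrtr k0) s0; set r := Num.sqrt k => rk r0.
have [->|an0] := eqVneq a 0; first by rewrite mulr_ge0 ?sqr_ge0.
have ap : 0 < a by rewrite lt_neqAle eq_sym an0.
have h3 : c ^+ 2 <= a * r.
  rewrite -(@ler_pXn2r _ 2)// ?nnegrE; [|exact: sqr_ge0|exact: mulr_ge0].
  by rewrite [leRHS]exprMn rk.
have h4 : a ^+ 2 <= c ^+ 2 * t ^+ 2.
  by rewrite -exprMn ler_pXn2r// nnegrE mulr_ge0.
have h5 : a ^+ 2 <= a * (t ^+ 2 * r).
  apply: le_trans h4 _; rewrite [leRHS](_ : _ = a * r * t ^+ 2); last ring.
  by apply: ler_wpM2r => //; exact: sqr_ge0.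
by move: h5; rewrite expr2 ler_pM2l.
Qed.

(* E G ^ 2 = <C mu, mu> <= |C mu| * |mu|, while |C mu| ^ 2 <= E G ^ 2 * sqrt EK2. *)
Lemma mean_embedding_sqr_le :
  (\int[P]_x G x ^+ 2)%R <= m ^+ 2 * Num.sqrt EK2.
Proof.
have cC := carrier_cov hH sxi fe cmu.
apply: (@sqr_le_aux _ (hnorm H (C mu))).
- by apply: Rint_ge0 => x; exact: sqr_ge0.
- by rewrite hnorm_ge0.
- by rewrite /ksd hnorm_ge0.
- by apply: Rint_ge0 => x; exact: sqr_ge0.
- apply: le_trans (ip_le hH cC cmu); rewrite (cov_ip hH sxi fe)//.
- have := sqr_hnorm_cov_le hH sxi fe cmu. exact.
Qed.

(** The inner product of xi x - mu and xi y - mu: the degenerate part of [K] under [P]. *)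
Let h x y := K x y - G x - G y + m ^+ 2.

Let hE x y : h x y = ip H (xi y) (xi x - mu) + (m ^+ 2 - G x).
Proof.
rewrite /h (stein_kernelC hH sxi) /stein_kernel ipBr// /G; ring.
Qed.

Let hC x y : h x y = h y x.
Proof. by rewrite /h (stein_kernelC hH sxi); ring. Qed.

Let cxm x : carrier H (xi x - mu). Proof. exact: carrierB. Qed.

Let ih x : intg P (h x).
Proof.
apply: (eq_intg (f := fun y => ip H (xi y) (xi x - mu) + (m ^+ 2 - G x))).
  by move=> y; rewrite hE.
apply: intgD; last exact: intg_cst.
by have [] := bochner_ip hH mean_embedding_spec sxi (cxm x).
Qed.

Let h0 x : (\int[P]_y h x y)%R = 0.
Proof.
transitivity (\int[P]_y (ip H (xi y) (xi x - mu) + (m ^+ 2 - G x)))%R.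
  by apply: eq_Rintegral => y _; rewrite hE.
have [i1 e1] := bochner_ip hH mean_embedding_spec sxi (cxm x).
rewrite RintegralD//; last exact: intg_cst.
rewrite Rint_cst e1 ipBr// /ksd hnorm_sqr// /G (ip_sym hH cmu (cxi x)); ring.
Qed.

Let ih2 x : intg P (fun y => h x y ^+ 2).
Proof.
pose c := m ^+ 2 - G x.
apply: (eq_intg (f := fun y => ip H (xi y) (xi x - mu) ^+ 2 +
  2 * c * ip H (xi y) (xi x - mu) + c ^+ 2)).
  by move=> y; rewrite hE -/c; ring.
apply: intgD; last exact: intg_cst.
apply: intgD; first exact: intg_ip_sqr.
by apply: intgZ; have [] := bochner_ip hH mean_embedding_spec sxi (cxm x).
Qed.

Let mh : measurable_fun setT (fun z : T * T => h z.1 z.2).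
Proof.
apply: measurable_funD => //; apply: measurable_funB.
  apply: measurable_funB; first exact: measurable_stein_kernel.
  exact: (measurableT_comp mG (measurable_fst (T1 := T) (T2 := T))).
exact: (measurableT_comp mG (measurable_snd (T1 := T) (T2 := T))).
Qed.

(** The factors 1 give the last three summands the product shape to which [intg_prod] and
    [Rint_prod] apply. *)
Let h_dom z := 4 * (K z.1 z.2 ^+ 2 + G z.1 ^+ 2 * 1 + 1 * G z.2 ^+ 2 + (m ^+ 2) ^+ 2 * (1 * 1)).

Let ih_dom : intg PP h_dom.
Proof.
apply: intgZ; apply: intgD; last by apply/intgZ/(intg_prod (f := fun=> 1) (g := fun=> 1)); exact: intg_cst.
apply: intgD; last by apply: (intg_prod (f := fun=> 1) (g := fun y => G y ^+ 2)) => //; exact: intg_cst.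
apply: intgD; last by apply: (intg_prod (g := fun=> 1) (f := fun y => G y ^+ 2)) => //; exact: intg_cst.
exact: intg_kernel_sqr.
Qed.

Let h_le z : h z.1 z.2 ^+ 2 <= h_dom z.
Proof.
rewrite /h /h_dom; move: (K _ _) (G _) (G _) (m ^+ 2) => a b c t.
rewrite !mulr1 mul1r -subr_ge0.
(* The gap in (a - b - c + t) ^ 2 <= 4 (a ^ 2 + b ^ 2 + c ^ 2 + t ^ 2) is a sum of squares over the
   six pairs. *)
rewrite (_ : _ - _ = (a + b) ^+ 2 + (a + c) ^+ 2 + (a - t) ^+ 2 + (b - c) ^+ 2 +
  (b + t) ^+ 2 + (c + t) ^+ 2); last ring.
by rewrite !addr_ge0// sqr_ge0.
Qed.

Let ihh : intg PP (fun z => h z.1 z.2 ^+ 2).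
Proof.
apply: intg_le ih_dom; first by apply: measurable_funX; exact: mh.
by move=> z; rewrite ger0_norm ?sqr_ge0.
Qed.

(** m ^ 4 = (E G) ^ 2 <= E G ^ 2 <= m ^ 2 * sqrt (E K ^ 2), and m ^ 2 cancels. *)
Let m2_le : m ^+ 2 <= Num.sqrt EK2.
Proof.
have mm : (m ^+ 2) ^+ 2 <= (\int[P]_x G x ^+ 2)%R.
  rewrite -EG; have := Rint_cauchy_schwarz (mu := P) (f := G) (g := fun=> 1) mG _ iG2 _.
  rewrite expr1n Rint_cst mulr1; under eq_Rintegral do rewrite mulr1.
  by apply => //; exact: intg_cst.
have := le_trans mm mean_embedding_sqr_le.
have [->|m0] := eqVneq (m ^+ 2) 0; first by rewrite sqrtr_ge0.
by rewrite expr2 ler_pM2l// lt_neqAle eq_sym m0 sqr_ge0.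
Qed.

(** 16 = 4 * 4: each of the four summands inside [h_dom] integrates to at most E K ^ 2. *)
Let Eh_le : (\int[PP]_z (h z.1 z.2 ^+ 2))%R <= 16 * EK2.
Proof.
have k0 : 0 <= EK2 by apply: Rint_ge0 => x; exact: sqr_ge0.
apply: le_trans (le_Rint ihh ih_dom h_le) _.
have iK := intg_kernel_sqr hH sxi fe.
have i1 := @intg_cst _ T R P 1.
have iG1 := intg_prod iG2 i1; have i1G := intg_prod i1 iG2; have i11 := intg_prod i1 i1.
rewrite RintegralZl//; last first.
  by apply: intgD; [apply: intgD => //; exact: intgD|exact: intgZ].
rewrite RintegralD//; [|by apply: intgD => //; exact: intgD|exact: intgZ].
rewrite RintegralD//; [|exact: intgD].
have e1 : (\int[PP]_z (G z.1 ^+ 2 * 1))%R = _ := Rint_prod iG2 i1.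
have e2 : (\int[PP]_z (1 * G z.2 ^+ 2))%R = _ := Rint_prod i1 iG2.
have e3 : (\int[PP]_z (1 * 1))%R = _ := Rint_prod i1 i1.
rewrite RintegralD// e1 e2 RintegralZl// e3 !Rint_cst !mulr1 mul1r.
have a1 := mean_embedding_sqr_le; have s0 := sqrtr_ge0 EK2.
have mm : m ^+ 2 * Num.sqrt EK2 <= EK2.
  by rewrite -[leRHS]sqr_sqrtr// expr2 ler_wpM2r// m2_le.
have m4 : (m ^+ 2) ^+ 2 <= EK2.
  by apply: le_trans mm; rewrite expr2; apply: ler_wpM2l => //; exact: sqr_ge0.
move: (\int[P]_x _)%R a1 mm m4 => a; lra.
Qed.

Let D n (t : n.-tuple T) := \sum_(i < n) \sum_(j < n | i != j) h (tnth t i) (tnth t j).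
Let L n (t : n.-tuple T) := \sum_(i < n) (G (tnth t i) - m ^+ 2).

(** Hoeffding's decomposition. The linear coefficient is 2 / n because a point occurs in 2 (n - 1)
    of the n (n - 1) ordered pairs. *)
Let u_stat_decomp n (t : n.-tuple T) : (2 <= n)%N ->
  u_stat H xi t - m ^+ 2 = (n%:R * (n%:R - 1))^-1 * D t + 2 / n%:R * L t.
Proof.
move=> n2; have n0 : n%:R != 0 :> R by rewrite pnatr_eq0; case: n n2 {t}.
have n1 : n%:R - 1 != 0 :> R.
  by case: n n2 t {n0} => [|[|n]]// _ _; rewrite -natr1 addrK pnatr_eq0.
have cnt (i : 'I_n) : (\sum_(j < n | i != j) 1 = n%:R - 1 :> R).
  rewrite (eq_bigl (fun j => j != i)); last by move=> j; rewrite eq_sym.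
  apply: (addrI 1); rewrite -[in LHS](bigD1 i (P := predT) (F := fun=> 1))//=.
  by rewrite sumr_const card_ord addrC subrK.
have cs (i : 'I_n) (a : R) : \sum_(j < n | i != j) a = (n%:R - 1) * a.
  by rewrite -(cnt i) mulr_suml; apply: eq_bigr => j _; rewrite mul1r.
pose S := \sum_(i < n) G (tnth t i).
have DE : D t = \sum_(i < n) \sum_(j < n | i != j) K (tnth t i) (tnth t j)
    - 2 * (n%:R - 1) * S + n%:R * (n%:R - 1) * m ^+ 2.
  rewrite /D /h.
  under eq_bigr => i _ do rewrite big_split sumrB sumrB /= !cs.
  rewrite big_split sumrB sumrB /= sumr_const card_ord -mulr_sumr.
  have -> : \sum_(i < n) \sum_(j < n | i != j) G (tnth t j) = (n%:R - 1) * S.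
    rewrite (exchange_big_dep xpredT)//= mulr_sumr; apply: eq_bigr => j _.
    by rewrite -(cs j); apply: eq_bigl => i; rewrite eq_sym.
  rewrite -/S -[_ *+ n]mulr_natl; ring.
have LE : L t = S - n%:R * m ^+ 2.
  by rewrite /L sumrB sumr_const card_ord -[_ *+ n]mulr_natl.
rewrite /u_stat DE LE; field.
by rewrite n0 n1.
Qed.

(* AM-GM makes the bound quadratic in the degenerate part a and in the linear
   part b; the weight (m + s) ^ -2 of the latter absorbs E b ^ 2 = O(m ^ 2). *)
Let sqrt_dist (u s a b : R) : 0 < s -> 0 <= m -> u - m ^+ 2 = a + 2 * b ->
  `|Num.sqrt (Num.max u 0) - m| <=
  4 * s + s ^- 3 * a ^+ 2 + (2 / (s * (m + s) ^+ 2)) * b ^+ 2.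
Proof.
move=> s0 m0 uab; set q := Num.sqrt _.
have q0 : 0 <= q by exact: sqrtr_ge0.
have ms : 0 < m + s by rewrite ltr_wpDl.
have h1 : `|q - m| * (q + m) <= `|u - m ^+ 2|.
  rewrite -{1}[q + m]ger0_norm ?addr_ge0// -normrM -subr_sqr sqr_sqrtr; last first.
    by rewrite le_max lexx orbT.
  rewrite maxEle; case: ifPn => // u0.
  rewrite sub0r normrN ger0_norm ?sqr_ge0// -normrN ger0_norm ?opprB; move: (sqr_ge0 m); lra.
(* If q and m differ by more than s, the larger of them is at least (m + s) / 2, so [h1] may be
   divided by q + m. *)
have h2 : `|q - m| <= s + 2 * (`|u - m ^+ 2| / (m + s)).
  have [qs|qs] := leP `|q - m| s.
    by rewrite (le_trans qs)// lerDl mulr_ge0// divr_ge0// ltW.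
  have qm : (m + s) / 2 <= q + m.
    move: qs; rewrite lter_normr => /orP[|]; lra.
  have : `|q - m| * ((m + s) / 2) <= `|u - m ^+ 2|.
    by apply: le_trans h1; apply: ler_wpM2l.
  rewrite mulrCA mulrC -ler_pdivlMr// => h3.
  have : `|q - m| <= 2 * (`|u - m ^+ 2| / (m + s)) by lra.
  by move/le_trans; apply; rewrite lerDr ltW.
apply: le_trans h2 _.
have h3 : `|u - m ^+ 2| <= `|a| + 2 * `|b|.
  by rewrite uab; apply: le_trans (ler_normD _ _) _; rewrite normrM ger0_norm.
(* For the degenerate part, m is dropped from the denominator before completing a square; [h5] also
   completes a square but keeps m + s. *)
have h4 : 2 * (`|a| / (m + s)) <= s + s ^- 3 * a ^+ 2.
  apply: (@le_trans _ _ (2 * (`|a| / s))).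
    by rewrite ler_pM2l// ler_wpM2l// lef_pV2 ?posrE// lerDr.
  rewrite -[a ^+ 2]real_normK ?num_real//; move: `|a| => c.
  have -> : s + s ^- 3 * c ^+ 2 = 2 * (c / s) + s * (c / s ^+ 2 - 1) ^+ 2.
    by field; rewrite gt_eqF.
  by rewrite lerDl mulr_ge0 ?sqr_ge0// ltW.
have h5 : 4 * (`|b| / (m + s)) <= 2 * s + (2 / (s * (m + s) ^+ 2)) * b ^+ 2.
  rewrite -[b ^+ 2]real_normK ?num_real//; move: `|b| => c.
  have -> : 2 * s + (2 / (s * (m + s) ^+ 2)) * c ^+ 2 =
     4 * (c / (m + s)) + 2 * s * (c / (s * (m + s)) - 1) ^+ 2.
    by field; rewrite !gt_eqF.
  by rewrite lerDl mulr_ge0 ?sqr_ge0// mulr_ge0// ltW.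
have h6 : `|u - m ^+ 2| / (m + s) <= `|a| / (m + s) + 2 * (`|b| / (m + s)).
  by rewrite mulrA -mulrDl ler_pM2r ?invr_gt0.
move: h4 h5 h6; lra.
Qed.

Lemma measurable_u_stat n : measurable_fun setT (u_stat H xi (n := n)).
Proof.
apply: measurable_funM => //; apply: measurable_sum => i.
under eq_fun do rewrite big_mkcond.
apply: (@measurable_sum _ _ _ _ _ _ (fun j (t : n.-tuple T) =>
  if i != j then K (tnth t i) (tnth t j) else 0)) => j; have [ij|_] //= := boolP (i != j).
by apply: measurable_stein_kernel2 => //; exact: measurable_tnth.
Qed.

Lemma measurable_ksd_u n : measurable_fun setT (ksd_u H xi (n := n)).
Proof.
apply: measurable_fun_sqrtr; apply: measurable_maxr => //; exact: measurable_u_stat.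
Qed.

(** With [s] the target rate, the three terms of the pointwise bound contribute 4 s, 64 s for the
    degenerate part and 2 s for the linear part. The bound [k] on E K ^ 2 is a parameter so as to be
    uniform over the class. *)
Lemma ksd_u_risk n (k : R) : (2 <= n)%N -> 0 < k -> EK2 <= k ->
  (\int[tuple_measure P n]_t `|ksd_u H xi t - m|%:E <=
   (72 * Num.sqrt (Num.sqrt k / n%:R))%:E)%E.
Proof.
move=> n2 k0 Kk; pose s := Num.sqrt (Num.sqrt k / n%:R).
have nN0 : n != 0%N by rewrite -lt0n (leq_trans _ n2).
have n0 : 0 < n%:R :> R by rewrite ltr0n lt0n.
have n1 : 2 <= n%:R :> R by rewrite ler_nat.
have sk0 : 0 < Num.sqrt k by rewrite sqrtr_gt0.
have s2 : s ^+ 2 = Num.sqrt k / n%:R by rewrite sqr_sqrtr// divr_ge0// ltW.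
have s4 : s ^+ 4 = k / n%:R ^+ 2.
  by rewrite (exprM s 2 2) s2 expr_div_n sqr_sqrtr// ltW.
have s0 : 0 < s by rewrite sqrtr_gt0 divr_gt0.
have m0 : 0 <= m by rewrite /ksd hnorm_ge0.
have ms : 0 < m + s by rewrite ltr_wpDl.
pose ca := s ^- 3 * (n%:R * (n%:R - 1)) ^- 2.
pose cb := 2 / (s * (m + s) ^+ 2) / n%:R ^+ 2.
have ca0 : 0 <= ca by rewrite mulr_ge0 ?invr_ge0 ?exprn_ge0 ?mulr_ge0// ?ltW//; lra.
have cb0 : 0 <= cb by rewrite !mulr_ge0 ?invr_ge0 ?mulr_ge0 ?exprn_ge0// ltW.
have bound t : `|ksd_u H xi t - m| <= 4 * s + ca * @D n t ^+ 2 + cb * L t ^+ 2.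
  have := @sqrt_dist (u_stat H xi t) s _ (n%:R^-1 * L t) s0 m0.
  rewrite (u_stat_decomp t n2) mulrA => /(_ _ erefl); rewrite /ksd_u.
  move/le_trans; apply; rewrite le_eqVlt; apply/orP; left; apply/eqP.
  by rewrite !exprMn !exprVn /ca /cb !mulrA.
have mL : measurable_fun setT (@L n).
  apply: measurable_sum => i; apply: (measurable_tnth_comp (g := fun x => G x - m ^+ 2)).
  exact: measurable_funB.
have mD : measurable_fun setT (@D n).
  apply: measurable_sum => i.
  under eq_fun do rewrite big_mkcond.
  apply: (@measurable_sum _ _ _ _ _ _ (fun j (t : n.-tuple T) =>
    if i != j then h (tnth t i) (tnth t j) else 0)) => j; have [ij|_] //= := boolP (i != j).
  apply: (measurableT_comp (f := fun z : T * T => h z.1 z.2)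
    (g := fun t : n.-tuple T => (tnth t i, tnth t j))) => //.
  by apply: measurable_fun_pair; exact: measurable_tnth.
pose W := (\int[PP]_z (h z.1 z.2 ^+ 2))%R.
pose v := (\int[P]_x (G x - m ^+ 2) ^+ 2)%R.
have ED := tuple_sqr_sum2 mh hC ih ih2 h0 ihh n.
have iGm : intg P (fun x => G x - m ^+ 2) by apply: intgB => //; exact: intg_cst.
have iGm2 : intg P (fun x => (G x - m ^+ 2) ^+ 2).
  apply: (eq_intg (f := fun x => G x ^+ 2 - 2 * m ^+ 2 * G x + m ^+ 2 ^+ 2)).
    by move=> x; ring.
  by apply: intgD; [apply: intgB => //; exact: intgZ|exact: intg_cst].
have EL : (\int[tuple_measure P n]_t (L t ^+ 2)%:E = (n%:R * v)%:E)%E.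
  apply: tuple_sqr_sum => //; rewrite RintegralB//; last exact: intg_cst.
  by rewrite EG Rint_cst subrr.
have v_le : v <= m ^+ 2 * Num.sqrt k.
  apply: (@le_trans _ _ (\int[P]_x G x ^+ 2)%R).
    have -> : v = (\int[P]_x (G x ^+ 2 - 2 * m ^+ 2 * G x + (m ^+ 2) ^+ 2))%R.
      by apply: eq_Rintegral => x _; ring.
    rewrite RintegralD//; [|by apply: intgB => //; exact: intgZ|exact: intg_cst].
    rewrite RintegralB//; last exact: intgZ.
    rewrite RintegralZl// EG Rint_cst; have := sqr_ge0 (m ^+ 2); nra.
  apply: le_trans mean_embedding_sqr_le _.
  by apply: ler_wpM2l; [exact: sqr_ge0|rewrite ler_wsqrtr].
apply: (@le_trans _ _ (\int[tuple_measure P n]_t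
    ((4 * s)%:E + (ca * D t ^+ 2)%:E + (cb * L t ^+ 2)%:E))%E).
  apply: ge0_le_integral => //.
  - apply/measurable_EFinP; apply: measurableT_comp => //.
    by apply: measurable_funB => //; exact: measurable_ksd_u.
  - apply: emeasurable_funD; first apply: emeasurable_funD => //; apply/measurable_EFinP;
      by apply: measurable_funM => //; exact: measurable_funX.
  - by move=> t _; rewrite -!EFinD lee_fin.
rewrite ge0_integralD//; last 4 first.
- by move=> t _; rewrite -EFinD lee_fin; apply: addr_ge0; apply: mulr_ge0 => //;
    [exact: ltW|exact: sqr_ge0].
- apply: emeasurable_funD => //; apply/measurable_EFinP.
  by apply: measurable_funM => //; exact: measurable_funX.
- by move=> t _; rewrite lee_fin mulr_ge0 ?sqr_ge0.
- by apply/measurable_EFinP; apply: measurable_funM => //; exact: measurable_funX.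
rewrite ge0_integralD//; last 3 first.
- by move=> t _; rewrite lee_fin mulr_ge0 ?ltW.
- by move=> t _; rewrite lee_fin mulr_ge0 ?sqr_ge0.
- by apply/measurable_EFinP; apply: measurable_funM => //; exact: measurable_funX.
rewrite tuple_integral_cst.
under [X in (_ + X + _)%E]eq_integral do rewrite EFinM.
under [X in (_ + X)%E]eq_integral do rewrite EFinM.
rewrite !ge0_integralZl_EFin//; last 4 first.
- by move=> t _; rewrite lee_fin sqr_ge0.
- by apply/measurable_EFinP; exact: measurable_funX.
- by move=> t _; rewrite lee_fin sqr_ge0.
- by apply/measurable_EFinP; exact: measurable_funX.
rewrite ED EL -!EFinM -!EFinD lee_fin -/W -/s.
have W0 : 0 <= W by apply: Rint_ge0 => z; exact: sqr_ge0.
have Wk : W <= 16 * k by apply: le_trans Eh_le _; rewrite ler_pM2l.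
(* E D ^ 2 <= 2 n (n - 1) * 16 k, and n <= 2 (n - 1) turns 32 k / (n (n - 1)) into 64 k / n ^ 2 = 64
   s ^ 4. *)
have hD : ca * (2 * n%:R * (n%:R - 1) * W) <= 64 * s.
  have -> : ca * (2 * n%:R * (n%:R - 1) * W) = s ^- 3 * (2 * W / (n%:R * (n%:R - 1))).
    by rewrite /ca; field; rewrite !gt_eqF//; lra.
  have -> : 64 * s = s ^- 3 * (64 * (k / n%:R ^+ 2)).
    by rewrite -s4; field; rewrite gt_eqF.
  rewrite ler_pM2l ?invr_gt0 ?exprn_gt0//.
  rewrite ler_pdivrMr ?mulr_gt0//; last by lra.
  have -> : 64 * (k / n%:R ^+ 2) * (n%:R * (n%:R - 1)) = 64 * k * ((n%:R - 1) / n%:R).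
    by field; rewrite gt_eqF.
  have : 2^-1 <= (n%:R - 1) / n%:R :> R.
    by rewrite ler_pdivlMr//; lra.
  move: ((n%:R - 1) / n%:R) => r hr.
  have : 64 * k * 2^-1 <= 64 * k * r by rewrite ler_pM2l// mulr_gt0.
  lra.
have hL : cb * (n%:R * v) <= 2 * s.
  apply: (@le_trans _ _ (cb * (n%:R * (m ^+ 2 * Num.sqrt k)))).
    by apply: ler_wpM2l => //; rewrite ler_pM2l.
  have -> : cb * (n%:R * (m ^+ 2 * Num.sqrt k)) =
      2 * s * ((m ^+ 2) / (m + s) ^+ 2).
    have -> : Num.sqrt k = s ^+ 2 * n%:R by rewrite s2 divfK// gt_eqF.
    by rewrite /cb; field; rewrite !gt_eqF.
  rewrite -[leRHS]mulr1; apply: ler_wpM2l; first by rewrite mulr_ge0// ltW.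
  rewrite ler_pdivrMr ?exprn_gt0// mul1r ler_pXn2r ?nnegrE ?(ltW ms)//.
  by rewrite lerDl ltW.
move: hD hL; lra.
Qed.

End upper_bound.

(** * Random signs *)

Section signs.
Context (R : realType).
Implicit Types (N m : nat) (s : seq R) (f g : seq R -> R).

(* The average of f over the 2 ^ N sign vectors, encoded as lists. *)
Fixpoint sign_avg N f : R :=
  if N is N'.+1 then
    (sign_avg N' (fun s => f (1 :: s)) + sign_avg N' (fun s => f (-1 :: s))) / 2
  else f [::].

Definition sign_seq N s := size s = N /\ {in s, forall x, x = 1 \/ x = -1}.

Let sign_cons N s a : a = 1 \/ a = -1 -> sign_seq N s -> sign_seq N.+1 (a :: s).
Proof.
move=> ha [ss hs]; split; first by rewrite /= ss.
by move=> x; rewrite inE => /predU1P[->//|/hs].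
Qed.

Let sign1 N s (hs : sign_seq N s) : sign_seq N.+1 (1 :: s).
Proof. by apply: sign_cons => //; left. Qed.

Let signN1 N s (hs : sign_seq N s) : sign_seq N.+1 (-1 :: s).
Proof. by apply: sign_cons => //; right. Qed.

Lemma le_sign_avg N f g : (forall s, sign_seq N s -> f s <= g s) ->
  sign_avg N f <= sign_avg N g.
Proof.
elim: N f g => [|N IH] f g fg /=; first by apply: fg; split.
rewrite ler_pM2r ?invr_gt0//; apply: lerD; apply: IH => s hs; apply: fg.
  exact: sign1.
exact: signN1.
Qed.

Lemma eq_sign_avg N f g : (forall s, sign_seq N s -> f s = g s) ->
  sign_avg N f = sign_avg N g.
Proof.
by move=> fg; apply/eqP; rewrite eq_le !le_sign_avg// => s hs; rewrite fg.
Qed.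

Lemma sign_avgD N f g : sign_avg N (fun s => f s + g s) = sign_avg N f + sign_avg N g.
Proof. elim: N f g => [|N IH] f g //=; rewrite !IH; lra. Qed.

Lemma sign_avgZ N a f : sign_avg N (fun s => a * f s) = a * sign_avg N f.
Proof. elim: N f => [|N IH] f //=; rewrite !IH; lra. Qed.

Lemma sign_avg_cst N a : sign_avg N (fun=> a) = a.
Proof. elim: N => [|N IH] //=; rewrite !IH; lra. Qed.

Lemma sign_avg_sum N m (F : 'I_m -> seq R -> R) :
  sign_avg N (fun s => \sum_(i < m) F i s) = \sum_(i < m) sign_avg N (F i).
Proof.
elim: m F => [|m IH] F.
  by rewrite big_ord0 -[RHS](sign_avg_cst N 0); apply: eq_sign_avg => s _; rewrite big_ord0.
rewrite big_ord_recl -IH -sign_avgD; apply: eq_sign_avg => s _.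
by rewrite big_ord_recl.
Qed.

Lemma sign_avg_ge0 N f : (forall s, sign_seq N s -> 0 <= f s) -> 0 <= sign_avg N f.
Proof. by move=> f0; rewrite -(sign_avg_cst N 0); exact: le_sign_avg. Qed.

Lemma sign_avg_mul N f g :
  sign_avg N f * sign_avg N g = sign_avg N (fun s => sign_avg N (fun s' => f s * g s')).
Proof.
rewrite mulrC -sign_avgZ; apply: eq_sign_avg => s _.
by rewrite mulrC sign_avgZ.
Qed.

(** The constant 2 in place of 1/2 allows an elementary proof: for 2 x ^ 2 > 1 both exponents are at
    most 2 x ^ 2; otherwise exp x <= 1 / (1 - x) and exp (- x) <= 1 / (1 + x) average to 1 / (1 - x
    ^ 2) <= 1 + 2 x ^ 2. *)
Lemma cosh_le (x : R) : (expR x + expR (- x)) / 2 <= expR (2 * x ^+ 2).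
Proof.
wlog x0 : x / 0 <= x.
  move=> h; have [|x0] := leP 0 x; first exact: h.
  by have := h (- x); rewrite oppr_ge0 (ltW x0) opprK sqrrN addrC; apply.
have [x1|x1] := leP (2 * x ^+ 2) 1; last first.
  have hx : x <= 2 * x ^+ 2 by nra.
  have h1 : expR x <= expR (2 * x ^+ 2) by rewrite ler_expR.
  have h2 : expR (- x) <= expR (2 * x ^+ 2) by rewrite ler_expR; lra.
  lra.
have xl1 : x < 1 by nra.
have e1 : expR x <= (1 - x)^-1.
  rewrite -[expR x]invrK lef_pV2 ?posrE ?invr_gt0 ?expR_gt0//; last by lra.
  by rewrite -expRN; exact: expR_ge1Dx.
have e2 : expR (- x) <= (1 + x)^-1.
  by rewrite expRN lef_pV2 ?posrE ?expR_gt0//; [exact: expR_ge1Dx|lra].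
have e3 : (1 - x ^+ 2)^-1 <= expR (2 * x ^+ 2).
  apply: le_trans (expR_ge1Dx _).
  rewrite -div1r ler_pdivrMr; last by nra.
  have := sqr_ge0 x; nra.
apply: le_trans e3.
have -> : (1 - x ^+ 2)^-1 = ((1 - x)^-1 + (1 + x)^-1) / 2.
  by field; rewrite !gt_eqF//; [nra|lra|lra].
lra.
Qed.

Lemma sign_avg_expR N (u : nat -> R) :
  sign_avg N (fun s => expR (\sum_(i < N) u i * s`_i)) <=
  expR (2 * \sum_(i < N) u i ^+ 2).
Proof.
elim: N u => [|N IH] u; first by rewrite /= !big_ord0 mulr0.
pose F s := expR (\sum_(i < N) u i.+1 * s`_i).
have hF a : sign_avg N (fun s => expR (\sum_(i < N.+1) u i * (a :: s)`_i)) =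
    expR (u 0%N * a) * sign_avg N F.
  rewrite -sign_avgZ; apply: eq_sign_avg => s _.
  by rewrite big_ord_recl /= expRD.
rewrite [leLHS]/= !hF mulr1 mulrN1 -mulrDl mulrAC big_ord_recl mulrDr expRD.
apply: ler_pM; [| |exact: cosh_le|exact: (IH (fun i => u i.+1))].
- by rewrite divr_ge0// addr_ge0// expR_ge0.
- by apply: sign_avg_ge0 => s _; exact: expR_ge0.
Qed.

Lemma sum_cauchy_schwarz m (a v : nat -> R) :
  (\sum_(k < m) a k * v k) ^+ 2 <= (\sum_(k < m) a k ^+ 2) * (\sum_(k < m) v k ^+ 2).
Proof.
apply: discriminant_le => [|t]; first by apply: sumr_ge0 => k _; exact: sqr_ge0.
rewrite !mulr_sumr -sumrB -big_split; apply: sumr_ge0 => k _ /=.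
by rewrite (_ : _ + _ = (a k - t * v k) ^+ 2) ?sqr_ge0//; ring.
Qed.

Definition sqn m (a : nat -> R) : R := \sum_(k < m) a k ^+ 2.

Lemma sqn_ge0 m a : 0 <= sqn m a.
Proof. by apply: sumr_ge0 => k _; exact: sqr_ge0. Qed.

(* The signs are averaged out one at a time: each step enlarges the coefficient
   of sqn a by the factor produced by cosh_le, and the smallness of
   64 * t * sum keeps it below 5 / 4 * t. *)
Lemma sign_avg_expR_sqr m N (v : nat -> nat -> R) (a : nat -> R) (t : R) : 0 < t ->
  64 * t * (\sum_(i < N) sqn m (v i)) <= 1 ->
  sign_avg N (fun s => expR (t * sqn m (fun k => a k + \sum_(i < N) v i k * s`_i))) <=
  expR (2 * t * (\sum_(i < N) sqn m (v i)) +
        t * (1 + 16 * t * (\sum_(i < N) sqn m (v i))) * sqn m a).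
Proof.
move=> t0; elim: N v a => [|N IH] v a hU.
  rewrite /= !big_ord0 mulr0 add0r mulr0 addr0 mulr1 ler_expR ler_pM2l// le_eqVlt.
  by apply/orP; left; apply/eqP; apply: eq_bigr => k _; rewrite big_ord0 addr0.
rewrite big_ord_recl in hU *.
set U := \sum_(i < N) _ in hU *; set w := sqn m (v ord0) in hU *.
have U0 : 0 <= U by apply: sumr_ge0 => i _; exact: sqn_ge0.
have w0 : 0 <= w by exact: sqn_ge0.
pose q := t * (1 + 16 * t * U).
have tU : 64 * t * U <= 1 by nra.
have q0 : 0 < q by rewrite mulr_gt0//; nra.
have qt : q <= 5 / 4 * t by rewrite /q; nra.
have hb b : sign_avg N (fun s => expR (t * sqn m (fun k => a k +
      \sum_(i < N.+1) v i k * (b :: s)`_i))) <=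
    expR (2 * t * U + q * sqn m (fun k => a k + v 0%N k * b)).
  apply: le_trans (IH (fun i => v i.+1) (fun k => a k + v 0%N k * b) tU).
  rewrite le_eqVlt; apply/orP; left; apply/eqP; apply: eq_sign_avg => s _.
  congr (expR (t * _)); apply: eq_bigr => k _.
  by rewrite big_ord_recl /= addrA.
pose c := \sum_(k < m) a k * v 0%N k.
have hc : c ^+ 2 <= sqn m a * w by exact: sum_cauchy_schwarz.
have exp_sqn b : b ^+ 2 = 1 ->
    sqn m (fun k => a k + v 0%N k * b) = sqn m a + w + 2 * c * b.
  move=> b1; rewrite /sqn /w /c mulr_sumr mulr_suml -!big_split /=.
  apply: eq_bigr => k _; rewrite sqrrD exprMn b1 mulr1; ring.
rewrite [leLHS]/=.
apply: (@le_trans _ _ ((expR (2 * t * U + q * (sqn m a + w + 2 * c)) +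
    expR (2 * t * U + q * (sqn m a + w - 2 * c))) / 2)).
  rewrite ler_pM2r ?invr_gt0//; apply: lerD.
    by apply: le_trans (hb 1) _; rewrite exp_sqn ?expr1n// mulr1.
  by apply: le_trans (hb (-1)) _; rewrite exp_sqn ?sqrrN ?expr1n// mulrN1.
have -> : (expR (2 * t * U + q * (sqn m a + w + 2 * c)) +
    expR (2 * t * U + q * (sqn m a + w - 2 * c))) / 2 =
  expR (2 * t * U + q * (sqn m a + w)) * ((expR (2 * q * c) + expR (- (2 * q * c))) / 2).
  rewrite [RHS]mulrA (mulrDr (expR _)) -!expRD; congr ((expR _ + expR _) / 2); ring.
apply: le_trans (ler_wpM2l (expR_ge0 _) (cosh_le _)) _.
rewrite -expRD ler_expR.
have a0 := sqn_ge0 m a.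
(* The factor from the cross term feeds the coefficient of [sqn m a], because c ^ 2 <= sqn m a * w
   and q <= 5/4 * t; the term q * w goes to the constant part. *)
have h1 : 8 * q ^+ 2 * c ^+ 2 <= 16 * t ^+ 2 * (sqn m a * w).
  have q2 : 8 * q ^+ 2 <= 16 * t ^+ 2 by nra.
  by apply: ler_pM => //; [rewrite mulr_ge0// sqr_ge0|exact: sqr_ge0].
have h2 : q * w <= 2 * t * w by apply: ler_wpM2r => //; lra.
move: h1 h2; rewrite /q; nra.
Qed.

(** For fixed s the exponent is linear in s', and averaging leaves the exponential of 2 t ^ 2 times
    a squared norm linear in s. The bound for squared norms applies with parameter 2 t ^ 2, whence
    128 = 64 * 2 and 4 = 2 * 2. *)
Lemma sign_avg_chaos N (M : nat -> nat -> R) (t : R) : 0 < t ->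
  128 * t ^+ 2 * (\sum_(i < N) \sum_(j < N) M i j ^+ 2) <= 1 ->
  sign_avg N (fun s => sign_avg N (fun s' =>
    expR (t * \sum_(i < N) \sum_(j < N) s`_i * s'`_j * M i j))) <=
  expR (4 * t ^+ 2 * (\sum_(i < N) \sum_(j < N) M i j ^+ 2)).
Proof.
move=> t0 hM; set S := \sum_(i < N) _ in hM *.
apply: (@le_trans _ _ (sign_avg N (fun s => expR (2 * t ^+ 2 *
    sqn N (fun k => 0 + \sum_(i < N) M i k * s`_i))))).
  apply: le_sign_avg => s _.
  apply: le_trans (le_trans (sign_avg_expR N (fun j => t * \sum_(i < N) M i j * s`_i)) _).
    rewrite le_eqVlt; apply/orP; left; apply/eqP; apply: eq_sign_avg => s' _.
    congr expR; rewrite exchange_big mulr_sumr; apply: eq_bigr => j _ /=.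
    rewrite !mulr_sumr mulr_suml; apply: eq_bigr => i _; ring.
  rewrite ler_expR /sqn !mulr_sumr; apply: ler_sum => k _.
  by rewrite add0r exprMn mulrA.
have t2 : 0 < 2 * t ^+ 2 by rewrite mulr_gt0// exprn_gt0.
have SE : \sum_(i < N) sqn N (M i) = S by [].
apply: le_trans (sign_avg_expR_sqr _ t2 _) _.
  by rewrite SE; apply: le_trans hM; rewrite mulrA -natrM.
rewrite ler_expR SE [X in _ + _ * X](_ : _ = 0); last first.
  by rewrite /sqn big1// => k _; rewrite expr0n.
by rewrite mulr0 addr0 mulrA -natrM.
Qed.

Lemma sign_avg_lin_mul N (u v : nat -> R) :
  sign_avg N (fun s => (\sum_(i < N) u i * s`_i) * (\sum_(i < N) v i * s`_i)) =
  \sum_(i < N) u i * v i.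
Proof.
have lin0 n (w : nat -> R) : sign_avg n (fun s => \sum_(i < n) w i * s`_i) = 0.
  elim: n w => [|n IH] w; first by rewrite /= big_ord0.
  have hw a : sign_avg n (fun s => \sum_(i < n.+1) w i * (a :: s)`_i) = w 0%N * a.
    transitivity (sign_avg n (fun s => w 0%N * a + \sum_(i < n) w i.+1 * s`_i)).
      by apply: eq_sign_avg => s _; rewrite big_ord_recl.
    by rewrite sign_avgD sign_avg_cst (IH (fun i => w i.+1)) addr0.
  by rewrite /= !hw mulr1 mulrN1 subrr mul0r.
elim: N u v => [|N IH] u v; first by rewrite /= !big_ord0 mul0r.
have h a : a ^+ 2 = 1 -> sign_avg N (fun s => (\sum_(i < N.+1) u i * (a :: s)`_i) *
    (\sum_(i < N.+1) v i * (a :: s)`_i)) = \sum_(i < N.+1) u i * v i.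
  move=> a1; rewrite big_ord_recl -(IH (fun i => u i.+1) (fun i => v i.+1)).
  transitivity (sign_avg N (fun s => u 0%N * v 0%N + (u 0%N * a *
      (\sum_(i < N) v i.+1 * s`_i) + v 0%N * a * (\sum_(i < N) u i.+1 * s`_i)) +
      (\sum_(i < N) u i.+1 * s`_i) * (\sum_(i < N) v i.+1 * s`_i))).
    apply: eq_sign_avg => s _; rewrite !big_ord_recl /=.
    move: (\sum_(i < N) u _ * _) (\sum_(i < N) v _ * _) => x y.
    have -> : (u 0%N * a + x) * (v 0%N * a + y) =
      u 0%N * v 0%N * a ^+ 2 + (u 0%N * a * y + v 0%N * a * x) + x * y by ring.
    by rewrite a1 mulr1.
  rewrite !sign_avgD !sign_avgZ sign_avg_cst.
  by rewrite (lin0 N (fun i => v i.+1)) (lin0 N (fun i => u i.+1)) !mulr0 !addr0.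
by rewrite [LHS]/= !h ?sqrrN ?expr1n//; lra.
Qed.

Lemma sign_avg_sqn m N (v : nat -> nat -> R) :
  sign_avg N (fun s => sqn m (fun k => \sum_(i < N) v i k * s`_i)) =
  \sum_(i < N) sqn m (v i).
Proof.
rewrite /sqn sign_avg_sum exchange_big; apply: eq_bigr => k _ /=.
by rewrite -(sign_avg_lin_mul N (fun i => v i k) (fun i => v i k)).
Qed.

Lemma expR_small (x : R) : 0 <= x -> x <= 2^-1 -> expR x <= 2.
Proof.
move=> x0 x1; rewrite -[expR x]invrK -[leRHS]invrK lef_pV2 ?posrE ?invr_gt0 ?expR_gt0//.
rewrite -expRN; apply: le_trans (expR_ge1Dx _); lra.
Qed.

(* 4 * B, where B = 2 ^ 15 bounds the second moment of Y over the square of its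
   mean in paley_zygmund. *)
Definition pz_const : R := 2 ^+ 17.

Lemma paley_zygmund m N (v : nat -> nat -> R) (U := \sum_(i < N) sqn m (v i)) : 0 < U ->
  pz_const^-1 <= sign_avg N (fun s =>
    if U / 2 <= sqn m (fun k => \sum_(i < N) v i k * s`_i) then 1 else 0).
Proof.
move=> U0; pose Y s := sqn m (fun k => \sum_(i < N) v i k * s`_i).
pose B : R := 2 ^+ 15; have B0 : 0 < B by rewrite exprn_gt0.
have EY2 : sign_avg N (fun s => Y s ^+ 2) <= B * U ^+ 2.
  (* The largest parameter admissible in [sign_avg_expR_sqr]. With Y ^ 2 <= (4 / t ^ 2) * exp (t Y)
     and exp (2 t U) <= 2 it gives B = 2 * 4 * 64 ^ 2 = 2 ^ 15. *)
  pose t := (64 * U)^-1.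
  have t0 : 0 < t by rewrite invr_gt0 mulr_gt0.
  have htU : 64 * t * U = 1 by rewrite /t; field; rewrite gt_eqF.
  have := @sign_avg_expR_sqr m N v (fun=> 0) t t0; rewrite -/U htU => /(_ (lexx _)).
  have -> : sqn m (fun=> 0) = 0 :> R by rewrite /sqn big1// => k _; rewrite expr0n.
  rewrite mulr0 addr0 => h.
  have he : expR (2 * t * U) <= 2.
    by apply: expR_small; [rewrite !mulr_ge0// ltW|lra].
  have hY s : Y s ^+ 2 <= (4 / t ^+ 2) * expR (t * sqn m (fun k => 0 + \sum_(i < N) v i k * s`_i)).
    have -> : sqn m (fun k => 0 + \sum_(i < N) v i k * s`_i) = Y s.
      by apply: eq_bigr => k _; rewrite add0r.
    have Y0 : 0 <= Y s by exact: sqn_ge0.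
    have e1 : (t * Y s / 2) ^+ 2 <= expR (t * Y s).
      rewrite [t * Y s in leRHS]splitr expRD -expr2 ler_pXn2r ?nnegrE ?expR_ge0//; last first.
        by rewrite !mulr_ge0// ltW.
      by apply: le_trans (expR_ge1Dx _); rewrite lerDr.
    rewrite mulrAC ler_pdivlMr ?exprn_gt0//.
    by apply: le_trans (ler_wpM2l _ e1) => //; rewrite le_eqVlt; apply/orP; left; apply/eqP; field.
  apply: le_trans (le_sign_avg (fun s _ => hY s)) _.
  rewrite sign_avgZ; apply: le_trans (ler_wpM2l _ (le_trans h he)) _.
    by rewrite divr_ge0 ?exprn_ge0// ltW.
  rewrite /t /B le_eqVlt; apply/orP; left; apply/eqP; field.
  by rewrite gt_eqF.
set p := sign_avg _ _.
(* A linearized Paley-Zygmund argument: on the event, AM-GM bounds Y by Y ^ 2 / (4 B U) + B U. The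
   first term averages to at most U / 4, which leaves U / 4 <= B U p. *)
have hL s : Y s <= U / 2 + (Y s ^+ 2 / (4 * B * U) +
    B * U * (if U / 2 <= Y s then 1 else 0)).
  have BU : 0 < B * U by rewrite mulr_gt0.
  have Y0 : 0 <= Y s by exact: sqn_ge0.
  have h0 : 0 <= Y s ^+ 2 / (4 * B * U) by rewrite divr_ge0 ?sqr_ge0// -mulrA mulr_ge0// ltW.
  case: ifPn => [_|]; last by rewrite -ltNge; lra.
  have -> : Y s ^+ 2 / (4 * B * U) + B * U * 1 = Y s + (Y s - 2 * (B * U)) ^+ 2 / (4 * B * U).
    by field; rewrite !gt_eqF.
  have h1 : 0 <= (Y s - 2 * (B * U)) ^+ 2 / (4 * B * U).
    by rewrite divr_ge0 ?sqr_ge0// -mulrA mulr_ge0// ltW.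
  by move: h1; lra.
have : U <= U / 2 + (U / 4 + B * U * p).
  have EY : sign_avg N Y = U by exact: sign_avg_sqn.
  rewrite -{1}EY; apply: le_trans (le_sign_avg (fun s _ => hL s)) _.
  rewrite sign_avgD sign_avg_cst lerD2l sign_avgD lerD//; last by rewrite sign_avgZ.
  rewrite (@eq_sign_avg N _ (fun s => (4 * B * U)^-1 * Y s ^+ 2)); last first.
    by move=> s _; rewrite mulrC.
  rewrite sign_avgZ mulrC ler_pdivrMr; last by rewrite -mulrA !mulr_gt0.
  by apply: le_trans EY2 _; rewrite le_eqVlt; apply/orP; left; apply/eqP; field.
move=> hU; have : U * 4^-1 <= U * (B * p) by lra.
have -> : pz_const = 4 * B by rewrite /pz_const /B -[17%N]/(2 + 15)%N exprD; congr (_ * _); ring.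
by rewrite ler_pM2l// invfM ler_pdivrMr// [p * B]mulrC.
Qed.

End signs.

(** * Lower bound *)

Section density.
Context d (T : measurableType d) (R : realType) (P : probability T R).
Variable f : T -> R.
Hypotheses (f0 : forall x, 0 <= f x) (if1 : intg P f) (f1 : (\int[P]_x f x)%R = 1).

Let mf : measurable_fun setT f := intg_measurable if1.

Let dens (A : set T) : \bar R := (\int[P]_(x in A) (f x)%:E)%E.

Let dens0 : dens set0 = 0%E. Proof. by rewrite /dens integral_set0. Qed.

Let dens_ge0 A : (0 <= dens A)%E.
Proof. by apply: integral_ge0 => x _; rewrite lee_fin. Qed.

Let dens_sigma_additive : semi_sigma_additive dens.
Proof. by apply: semi_sigma_additive_nng_induced => //; exact/measurable_EFinP. Qed.

HB.instance Definition _ := isMeasure.Build _ _ _ dens dens0 dens_ge0 dens_sigma_additive.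

Let dens_setT : dens setT = 1%E.
Proof. by rewrite /dens -EFin_Rintegral// f1. Qed.

HB.instance Definition _ := Measure_isProbability.Build _ _ _ dens dens_setT.

Let dens_dominated : dens `<< P.
Proof.
apply/null_content_dominatesP => A mA A0; rewrite /dens null_set_integral//.
exact/measurable_funTS/measurable_EFinP.
Qed.

(** [f] agrees almost everywhere with the Radon-Nikodym derivative of [dens], as both have the same
    integral over every measurable set; the change of variables for the derivative then applies. *)
Let dens_integral (g : T -> \bar R) : measurable_fun setT g -> (forall x, 0 <= g x)%E ->
  (\int[dens]_x g x = \int[P]_x (g x * (f x)%:E))%E.
Proof.
move=> mg g0; rewrite -(Radon_Nikodym_SigmaFinite.change_of_variables dens_dominated g0)//.
have irn := Radon_Nikodym_SigmaFinite.f_integrable dens_dominated.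
have mrn := measurable_int _ irn.
have mfE : measurable_fun setT (EFin \o f) by exact/measurable_EFinP.
apply: ae_eq_integral => //; [exact: emeasurable_funM|exact: emeasurable_funM|].
apply: ae_eqe_mul2l; apply: integral_ae_eq => // A _ mA.
by rewrite -Radon_Nikodym_SigmaFinite.f_integral.
Qed.

Lemma density_exists : exists Q : probability T R,
  forall g : T -> \bar R, measurable_fun setT g -> (forall x, 0 <= g x)%E ->
  (\int[Q]_x g x = \int[P]_x (g x * (f x)%:E))%E.
Proof. by exists dens; exact: dens_integral. Qed.

End density.

Section density_theory.
Context d (T : measurableType d) (R : realType) (P Q : probability T R) (f : T -> R).
Hypotheses (f0 : forall x, 0 <= f x) (mf : measurable_fun setT f)
  (PQ : forall g : T -> \bar R, measurable_fun setT g -> (forall x, 0 <= g x)%E ->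
  (\int[Q]_x g x = \int[P]_x (g x * (f x)%:E))%E).

Lemma density_intg (g : T -> R) : measurable_fun setT g ->
  intg P (fun x => g x * f x) ->
  intg Q g /\ (\int[Q]_x g x)%R = (\int[P]_x (g x * f x))%R.
Proof.
move=> mg igf.
have ge0 (u : T -> R) : measurable_fun setT u -> (forall x, 0 <= u x) ->
    intg P (fun x => u x * f x) ->
    intg Q u /\ (\int[Q]_x u x)%R = (\int[P]_x (u x * f x))%R.
  move=> mu u0 iuf.
  have e : (\int[Q]_x (u x)%:E = \int[P]_x (u x * f x)%:E)%E.
    have mE : measurable_fun setT (EFin \o u) by exact/measurable_EFinP.
    by rewrite (PQ mE)// => x; rewrite /= lee_fin.
  split; last by rewrite /Rintegral e.
  by apply: intg_lty => //; rewrite e -EFin_Rintegral// ltry.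
have mn : measurable_fun setT (fun x => `|g x|) by exact: measurableT_comp.
have iN : intg P (fun x => `|g x| * f x).
  have := intg_norm igf; apply: eq_intg => x.
  by rewrite normrM (ger0_norm (f0 x)).
have [i1 e1] := ge0 _ mn (fun x => normr_ge0 _) iN.
(* [g] is treated as the difference of the nonnegative functions |g| + g and |g|. *)
have [|||i2 e2] := ge0 (fun x => `|g x| + g x).
- exact: measurable_funD.
- by move=> x; rewrite -lerBlDr sub0r; have := ler_norm (- g x); rewrite normrN; lra.
- by have := intgD iN igf; apply: eq_intg => x; rewrite mulrDl.
have ig : intg Q g.
  by have := intgB i2 i1; apply: eq_intg => x; rewrite addrAC subrr add0r.
split => //.
have -> : (\int[Q]_x g x)%R = (\int[Q]_x ((`|g x| + g x) - `|g x|))%R.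
  by apply: eq_Rintegral => x _; rewrite addrAC subrr add0r.
rewrite RintegralB// e2 e1 -RintegralB//.
  by apply: eq_Rintegral => x _; ring.
by have := intgD iN igf; apply: eq_intg => x; rewrite mulrDl.
Qed.

Lemma density_tuple n (F : n.-tuple T -> \bar R) : measurable_fun setT F ->
  (forall t, 0 <= F t)%E ->
  (\int[tuple_measure Q n]_t F t =
   \int[tuple_measure P n]_t (F t * (\prod_(i < n) f (tnth t i))%:E))%E.
Proof.
elim: n F => [|n IH] F mF F0.
  by apply: eq_integral => t _; rewrite big_ord0 mule1.
have mL k : measurable_fun setT (fun t : k.-tuple T => \prod_(i < k) f (tnth t i)).
  by apply: measurable_prod => i _; exact: measurable_tnth_comp.
have L0 k (t : k.-tuple T) : (0 <= (\prod_(i < k) f (tnth t i))%:E)%E.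
  by rewrite lee_fin; apply: prodr_ge0 => i _.
have mFc : measurable_fun setT (fun z : T * n.-tuple T => F (cons_pair z)).
  by apply: (measurableT_comp (f := F)) => //; exact: measurable_cons_pair.
have mFL : measurable_fun setT (fun z : T * n.-tuple T =>
    (F (cons_pair z) * (\prod_(i < n) f (tnth z.2 i))%:E)%E).
  apply: emeasurable_funM => //; apply/measurable_EFinP.
  exact: (measurableT_comp (mL n) (measurable_snd (T1 := T) (T2 := n.-tuple T))).
rewrite !tuple_integral_cons//; last 2 first.
- by apply: emeasurable_funM => //; apply/measurable_EFinP; exact: mL.
- by move=> t; rewrite mule_ge0.
rewrite PQ; last 2 first.
- by apply: (measurable_fun_fubini_tonelli_F (fun z : T * n.-tuple T => F (cons_pair z))).
- by move=> x; exact: integral_ge0.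
apply: eq_integral => x _; rewrite IH//; last first.
  exact: (measurableT_comp mFc (measurable_pair1 x)).
have mx : measurable_fun setT (fun t : n.-tuple T =>
    (F (cons_pair (x, t)) * (\prod_(i < n) f (tnth t i))%:E)%E).
  exact: (measurableT_comp mFL (measurable_pair1 x)).
rewrite muleC -ge0_integralZl//; last 2 first.
- by move=> t _; rewrite mule_ge0.
- by rewrite lee_fin.
apply: eq_integral => t _.
rewrite big_ord_recl tnth0; under [in RHS]eq_bigr do rewrite tnthS.
by rewrite EFinM !muleA; congr (_ * _)%E; rewrite muleC.
Qed.

End density_theory.

Section tuple_product.
Context d (T : measurableType d) (R : realType) (P : probability T R).
Local Notation TM n := (tuple_measure P n).

Lemma tuple_prod n (f : T -> R) : (forall x, 0 <= f x) -> intg P f ->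
  (\int[TM n]_t (\prod_(i < n) f (tnth t i))%:E = ((\int[P]_x f x)%R ^+ n)%:E)%E.
Proof.
move=> f0 iff; have mf := intg_measurable iff.
elim: n => [|n IH].
  by under eq_integral do rewrite big_ord0; rewrite tuple_integral_cst expr0.
have mL k : measurable_fun setT (fun t : k.-tuple T => \prod_(i < k) f (tnth t i)).
  by apply: measurable_prod => i _; exact: measurable_tnth_comp.
have L0 k (t : k.-tuple T) : (0 <= (\prod_(i < k) f (tnth t i))%:E)%E.
  by rewrite lee_fin; apply: prodr_ge0 => i _.
rewrite tuple_integral_cons; [|by apply/measurable_EFinP; exact: mL|exact: L0].
have E x : (\int[TM n]_t (\prod_(i < n.+1) f (tnth (cons_pair (x, t)) i))%:E =
    ((\int[P]_x f x)%R ^+ n * f x)%:E)%E.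
  rewrite mulrC EFinM -IH -ge0_integralZl//; last 2 first.
  - by apply/measurable_EFinP; exact: mL.
  - by rewrite lee_fin.
  apply: eq_integral => t _; rewrite big_ord_recl tnth0 -EFinM.
  by under eq_bigr do rewrite tnthS.
under eq_integral do rewrite E.
rewrite -EFin_Rintegral; last exact: intgZ.
by rewrite RintegralZl// exprSr.
Qed.

End tuple_product.

(** * Estimation error against a mixture of perturbations *)

Section mixture_bound.
Context d (T : measurableType d) (R : realType) (mu : {measure set T -> \bar R}).
Variable N : nat.

Lemma intg_sign_avg (F : seq R -> T -> R) :
  (forall s, sign_seq N s -> intg mu (F s)) ->
  intg mu (fun x => sign_avg N (F ^~ x)) /\
  (\int[mu]_x sign_avg N (F ^~ x))%R = sign_avg N (fun s => (\int[mu]_x F s x)%R).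
Proof.
elim: N F => [|k IH] F iF /=; first by split => //; apply: iF; split.
have s1 a s : a = 1 \/ a = -1 -> sign_seq k s -> sign_seq k.+1 (a :: s).
  by move=> ha [ss hs]; split; [rewrite /= ss|move=> x; rewrite inE => /predU1P[->//|/hs]].
have [|i1 e1] := IH (fun s => F (1 :: s)).
  by move=> s hs; apply: iF; apply: s1 => //; left.
have [|i2 e2] := IH (fun s => F (-1 :: s)).
  by move=> s hs; apply: iF; apply: s1 => //; right.
have iD := intgD i1 i2; split.
  by have := intgZ 2^-1 iD; apply: eq_intg => x; rewrite mulrC.
by rewrite RintegralZr// RintegralD// e1 e2.
Qed.

Variables (L : seq R -> T -> R) (w D : seq R -> R) (delta r : R) (That : T -> R).
Hypotheses (L0 : forall s x, sign_seq N s -> 0 <= L s x)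
  (iL : forall s, sign_seq N s -> intg mu (L s))
  (L1 : forall s, sign_seq N s -> (\int[mu]_x L s x)%R = 1)
  (iLL : forall s s', sign_seq N s -> sign_seq N s' -> intg mu (fun x => L s x * L s' x))
  (w01 : forall s, sign_seq N s -> w s = 0 \/ (w s = 1 /\ delta <= D s))
  (delta0 : 0 <= delta)
  (iT : intg mu (fun x => `|That x|)) (rT : (\int[mu]_x `|That x|)%R <= r)
  (iTs : forall s, sign_seq N s -> intg mu (fun x => `|That x - D s| * L s x))
  (rTs : forall s, sign_seq N s -> (\int[mu]_x (`|That x - D s| * L s x))%R <= r).

(* W averages the likelihood ratios of the perturbations with D s >= delta. On
   |T| >= delta the estimator is wrong under mu; elsewhere it is wrong under
   these perturbations. c * W - (c * W) ^ 2 / 4 <= 1 trades a change of measure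
   for a second moment. *)
Lemma mixture_bound (c : R) : 0 <= c -> c <= 1 ->
  delta * c * sign_avg N w <= 2 * r + delta * c ^+ 2 / 4 *
   sign_avg N (fun s => sign_avg N (fun s' => (\int[mu]_x (L s x * L s' x))%R)).
Proof.
move=> c0 c1; pose W x := sign_avg N (fun s => w s * L s x).
pose X x := sign_avg N (fun s => w s * (`|That x - D s| * L s x)).
have w0 s : sign_seq N s -> 0 <= w s by move=> /w01[->//|[->]].
have w1 s : sign_seq N s -> w s <= 1 by move=> /w01[->//|[->]].
have W0 x : 0 <= W x by apply: sign_avg_ge0 => s hs; rewrite mulr_ge0 ?w0 ?L0.
have X0 x : 0 <= X x.
  by apply: sign_avg_ge0 => s hs; rewrite mulr_ge0 ?w0// mulr_ge0 ?L0.
have pt x : delta * c * W x <= `|That x| + X x + delta * c ^+ 2 / 4 * W x ^+ 2.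
  have h1 : c * W x - c ^+ 2 / 4 * W x ^+ 2 <= 1.
    have sq := sqr_ge0 (c * W x / 2 - 1); rewrite -subr_ge0.
    suff -> : 1 - (c * W x - c ^+ 2 / 4 * W x ^+ 2) = (c * W x / 2 - 1) ^+ 2 by [].
    by field.
  have [Td|Td] := leP delta `|That x|.
    have := ler_wpM2l delta0 h1; have := X0 x; lra.
  (* When |T| < delta, |T - D s| >= delta - |T| for each perturbation counted in W. *)
  have XW : W x * (delta - `|That x|) <= X x.
    rewrite mulrC -sign_avgZ; apply: le_sign_avg => s hs.
    have [->|[-> dD]] := w01 hs; first by rewrite !mul0r mulr0.
    rewrite !mul1r; apply: ler_wpM2r; first exact: L0.
    have := ler_norm (D s - That x); rewrite distrC.
    have := ler_norm (That x); lra.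
  have T0 : 0 <= `|That x| by [].
  have cW2 : 0 <= delta * c ^+ 2 / 4 * W x ^+ 2.
    by rewrite mulr_ge0 ?sqr_ge0// divr_ge0// mulr_ge0// sqr_ge0.
  (* For W >= 1, [XW] gives |T| + X >= delta and [h1] concludes; for W < 1 it gives |T| + X >= delta
     * W, and c <= 1 is enough. *)
  have [W1|W1] := leP 1 (W x).
    have h2 := ler_wpM2l delta0 h1.
    have h3 : 0 <= (W x - 1) * (delta - `|That x|).
      by apply: mulr_ge0; rewrite subr_ge0// ltW.
    lra.
  have h2 : 0 <= (1 - W x) * `|That x| by apply: mulr_ge0 => //; rewrite subr_ge0 ltW.
  have h3 : delta * c * W x <= delta * W x.
    by apply: ler_wpM2r => //; rewrite -[leRHS]mulr1; apply: ler_wpM2l.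
  lra.
have iwL s : sign_seq N s -> intg mu (fun x => w s * L s x) by move=> /iL; exact: intgZ.
have [iW eW] := intg_sign_avg iwL.
have iwX s : sign_seq N s -> intg mu (fun x => w s * (`|That x - D s| * L s x)).
  by move=> /iTs; exact: intgZ.
have [iX eX] := intg_sign_avg iwX.
have W2E x : W x ^+ 2 = sign_avg N (fun s => sign_avg N (fun s' =>
    (w s * w s') * (L s x * L s' x))).
  rewrite expr2 sign_avg_mul; apply: eq_sign_avg => s _; apply: eq_sign_avg => s' _; ring.
have iwLL s : sign_seq N s -> intg mu (fun x => sign_avg N (fun s' =>
    (w s * w s') * (L s x * L s' x))) /\
    (\int[mu]_x sign_avg N (fun s' => (w s * w s') * (L s x * L s' x)))%R =
    sign_avg N (fun s' => (\int[mu]_x ((w s * w s') * (L s x * L s' x)))%R).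
  move=> hs; apply: (intg_sign_avg (F := fun s' x => (w s * w s') * (L s x * L s' x))).
  by move=> s' hs'; apply: intgZ; exact: iLL.
have [iW2 eW2] := intg_sign_avg (fun s hs => (iwLL s hs).1).
have iW2' : intg mu (fun x => W x ^+ 2) by apply: eq_intg iW2 => x; rewrite W2E.
have EW : (\int[mu]_x W x)%R = sign_avg N w.
  rewrite eW; apply: eq_sign_avg => s hs.
  by rewrite RintegralZl ?L1 ?mulr1//; exact: iL.
have r0 : 0 <= r by apply: le_trans rT; apply: Rint_ge0.
have EX : (\int[mu]_x X x)%R <= r.
  rewrite eX -[leRHS](sign_avg_cst N); apply: le_sign_avg => s hs.
  rewrite RintegralZl//; last exact: iTs.
  apply: (@le_trans _ _ (w s * r)); first by apply: ler_wpM2l; [exact: w0|exact: rTs].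
  by rewrite -[leRHS]mul1r; apply: ler_wpM2r => //; exact: w1.
have EW2 : (\int[mu]_x (W x ^+ 2))%R <= sign_avg N (fun s => sign_avg N (fun s' =>
    (\int[mu]_x (L s x * L s' x))%R)).
  have -> : (\int[mu]_x (W x ^+ 2))%R = (\int[mu]_x sign_avg N (fun s => sign_avg N (fun s' =>
    (w s * w s') * (L s x * L s' x))))%R by apply: eq_Rintegral => x _; rewrite W2E.
  rewrite eW2; apply: le_sign_avg => s hs; rewrite (iwLL s hs).2.
  apply: le_sign_avg => s' hs'; rewrite RintegralZl//; last exact: iLL.
  rewrite -[leRHS]mul1r; apply: ler_wpM2r.
    by apply: Rint_ge0 => x; rewrite mulr_ge0// L0.
  by rewrite -[leRHS]mulr1; apply: ler_pM; rewrite ?w0 ?w1.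
have dc0 : 0 <= delta * c ^+ 2 / 4 by rewrite divr_ge0// mulr_ge0// sqr_ge0.
rewrite -EW -RintegralZl//; apply: le_trans (le_Rint _ _ pt) _.
- exact: intgZ.
- by apply: intgD; [exact: intgD|exact: intgZ].
rewrite RintegralD//; [|exact: intgD|exact: intgZ].
rewrite RintegralD// RintegralZl//.
apply: lerD; last exact: ler_wpM2l.
by rewrite mulr2n mulrDl mul1r; apply: lerD.
Qed.

End mixture_bound.

(** * Bounded centred approximations of the directions *)

Section truncation.
Context d (T : measurableType d) (R : realType) (P : probability T R).

Definition clip (n : nat) (y : R) : R := Num.max (- n%:R) (Num.min y n%:R).

Lemma normr_clip_le n y : `|clip n y| <= n%:R.
Proof.
rewrite ler_norml /clip le_max lexx /= ge_max ge_min lexx orbT andbT.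
by have := ler0n R n; lra.
Qed.

Lemma normr_clip n y : `|clip n y| <= `|y|.
Proof.
have n0 := ler0n R n; have h1 := ler_norm y; have := ler_norm (- y); rewrite normrN => h2.
rewrite /clip ler_norml; have [yn|yn] := leP y n%:R.
  by have [ny|ny] := leP (- n%:R) y; apply/andP; split; lra.
by have [ny|ny] := leP (- n%:R) n%:R; apply/andP; split; lra.
Qed.

Lemma clip_cvg y : clip n y @[n --> \oo] --> y.
Proof.
apply: cvg_near_cst; apply: filterS (nbhs_infty_ger `|y|) => n; rewrite ler_norml => /andP[h1 h2].
by rewrite /clip min_l// max_r.
Qed.

Lemma measurable_clip n (f : T -> R) : measurable_fun setT f ->
  measurable_fun setT (fun x => clip n (f x)).
Proof. by move=> mf; apply: measurable_maxr => //; exact: measurable_minr. Qed.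

Lemma cvg_sqr (u : nat -> R) (l : R) : u n @[n --> \oo] --> l ->
  u n ^+ 2 @[n --> \oo] --> l ^+ 2.
Proof. by move=> ul; rewrite expr2; under eq_fun do rewrite expr2; exact: cvgM. Qed.

(** As the clipping level grows, both Gram sums tend to [S] by dominated convergence, so the strict
    inequalities hold from some level on. Centring makes the perturbed densities integrate to 1. The
    mixed sum measures the KSD of the perturbations, the other one their chi-square distance. *)
Lemma centered_truncation N (a : nat -> T -> R) (lo hi : R)
    (S := \sum_(i < N) \sum_(k < N) (\int[P]_x (a i x * a k x))%R ^+ 2) :
  (forall i, intg P (a i)) -> (forall i, intg P (fun x => a i x ^+ 2)) ->
  (forall i, (\int[P]_x a i x)%R = 0) -> lo < S -> S < hi ->
  exists psi : nat -> T -> R, exists G : R,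
  [/\ forall i, measurable_fun setT (psi i), forall i x, `|psi i x| <= G,
      forall i, (\int[P]_x psi i x)%R = 0,
      lo < \sum_(i < N) \sum_(k < N) (\int[P]_x (a k x * psi i x))%R ^+ 2 &
      \sum_(i < N) \sum_(k < N) (\int[P]_x (psi i x * psi k x))%R ^+ 2 < hi].
Proof.
move=> ia ia2 a0 loS Shi; have ma i := intg_measurable (ia i).
pose b n i x := clip n (a i x); pose c n i := (\int[P]_x b n i x)%R.
pose psi n i x := b n i x - c n i.
have mb n i : measurable_fun setT (b n i) by exact: measurable_clip.
have ib n i : intg P (b n i).
  by apply: (@intg_bounded _ T R P _ n%:R) => // x; exact: normr_clip_le.
have iabs i : intg P (fun x => `|a i x|) by exact: intg_norm.
have iaa i k : intg P (fun x => `|a i x| * `|a k x|).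
  have := intg_norm (intg_mul (ma i) (ma k) (ia2 i) (ia2 k)).
  by apply: eq_intg => x; rewrite normrM.
have c_cvg i : c n i @[n --> \oo] --> 0.
  rewrite -(a0 i); apply: (Rint_dominated_cvg (f_ := fun n => b n i) _ _ (iabs i) _).2 => //.
    by move=> x; exact: clip_cvg.
  by move=> n x; exact: normr_clip.
have iab n i k : intg P (fun x => a k x * b n i x).
  apply: intg_le (iaa k i); first exact: measurable_funM.
  by move=> x; rewrite normrM; apply: ler_wpM2l => //; exact: normr_clip.
have ab_cvg i k : (\int[P]_x (a k x * b n i x))%R @[n --> \oo] --> (\int[P]_x (a k x * a i x))%R.
  apply: (Rint_dominated_cvg (f_ := fun n x => a k x * b n i x) _ _ (iaa k i) _).2.
  - by move=> n; exact: measurable_funM.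
  - by move=> x; apply: cvgM; [exact: cvg_cst|exact: clip_cvg].
  - by move=> n x; rewrite normrM; apply: ler_wpM2l => //; exact: normr_clip.
have ibb n i k : intg P (fun x => b n i x * b n k x).
  apply: intg_le (iaa i k); first exact: measurable_funM.
  by move=> x; rewrite normrM; apply: ler_pM => //; exact: normr_clip.
have bb_cvg i k : (\int[P]_x (b n i x * b n k x))%R @[n --> \oo] --> (\int[P]_x (a i x * a k x))%R.
  apply: (Rint_dominated_cvg (f_ := fun n x => b n i x * b n k x) _ _ (iaa i k) _).2.
  - by move=> n; exact: measurable_funM.
  - by move=> x; apply: cvgM; exact: clip_cvg.
  - by move=> n x; rewrite normrM; apply: ler_pM => //; exact: normr_clip.
have apsi n i k : (\int[P]_x (a k x * psi n i x))%R = (\int[P]_x (a k x * b n i x))%R.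
  transitivity (\int[P]_x (a k x * b n i x - c n i * a k x))%R.
    by apply: eq_Rintegral => x _; rewrite /psi; ring.
  by rewrite RintegralB//; [rewrite RintegralZl// a0 mulr0 subr0|exact: intgZ].
have psipsi n i k : (\int[P]_x (psi n i x * psi n k x))%R =
    (\int[P]_x (b n i x * b n k x))%R - c n i * c n k.
  transitivity (\int[P]_x (b n i x * b n k x - c n i * b n k x - (c n k * b n i x - c n i * c n k)))%R.
    by apply: eq_Rintegral => x _; rewrite /psi; ring.
  have i1 : intg P (fun x => c n i * b n k x) by exact: intgZ.
  have i2 : intg P (fun x => c n k * b n i x) by exact: intgZ.
  have i3 : intg P (fun x => c n k * b n i x - c n i * c n k).
    by apply: intgB => //; exact: intg_cst.
  rewrite !RintegralB//; [|exact: intg_cst|exact: intgB].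
  rewrite Rint_cst !RintegralZl// -!/(c n _); ring.
pose S1 n := \sum_(i < N) \sum_(k < N) (\int[P]_x (a k x * psi n i x))%R ^+ 2.
pose S2 n := \sum_(i < N) \sum_(k < N) (\int[P]_x (psi n i x * psi n k x))%R ^+ 2.
have S1_cvg : S1 n @[n --> \oo] --> S.
  apply: (cvg_sum_seq (F := fun (i : 'I_N) n => \sum_(k < N) (\int[P]_x (a k x * psi n i x))%R ^+ 2)
    (l := fun i : 'I_N => \sum_(k < N) (\int[P]_x (a i x * a k x))%R ^+ 2)) => i.
  apply: (cvg_sum_seq (F := fun (k : 'I_N) n => (\int[P]_x (a k x * psi n i x))%R ^+ 2)
    (l := fun k : 'I_N => (\int[P]_x (a i x * a k x))%R ^+ 2)) => k.
  apply: cvg_sqr; under eq_fun do rewrite apsi.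
  have -> : (\int[P]_x (a i x * a k x))%R = (\int[P]_x (a k x * a i x))%R.
    by apply: eq_Rintegral => x _; rewrite mulrC.
  exact: ab_cvg.
have S2_cvg : S2 n @[n --> \oo] --> S.
  apply: (cvg_sum_seq (F := fun (i : 'I_N) n => \sum_(k < N) (\int[P]_x (psi n i x * psi n k x))%R ^+ 2)
    (l := fun i : 'I_N => \sum_(k < N) (\int[P]_x (a i x * a k x))%R ^+ 2)) => i.
  apply: (cvg_sum_seq (F := fun (k : 'I_N) n => (\int[P]_x (psi n i x * psi n k x))%R ^+ 2)
    (l := fun k : 'I_N => (\int[P]_x (a i x * a k x))%R ^+ 2)) => k.
  apply: cvg_sqr; under eq_fun do rewrite psipsi.
  have h := cvgB (bb_cvg i k) (cvgM (c_cvg i) (c_cvg k)).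
  by rewrite mulr0 subr0 in h; exact: h.
have [n1 _ h1] := cvgr_gt _ S1_cvg _ loS.
have [n2 _ h2] := cvgr_lt _ S2_cvg _ Shi.
pose n := maxn n1 n2; exists (psi n), (n%:R + n%:R); split.
- by move=> i; apply: measurable_funB.
- move=> i x; apply: le_trans (ler_normB _ _) _; apply: lerD; first exact: normr_clip_le.
  apply: le_trans (le_normr_Rintegral _ (ib n i)) _ => //.
  rewrite -[leRHS](Rint_cst P); apply: le_Rint => [||y].
  + exact: intg_norm.
  + exact: intg_cst.
  + exact: normr_clip_le.
- by move=> i; rewrite RintegralB//; [rewrite Rint_cst subrr|exact: intg_cst].
- by apply: (h1 n); exact: leq_maxl.
- by apply: (h2 n); exact: leq_maxr.
Qed.

End truncation.

(** * Perturbations of [P] with density at most 2 *)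

Section lower_bound.
Context (R : realType) (V : lmodType R) (H : inner_space V) (hH : is_hilbert H).
Context (d : nat).
Local Notation T := 'rV[R]_d.
Variables (xi : T -> V) (sxi : smeas H xi) (P : probability T R).
Hypothesis fe : finite_energy H xi P.
Hypothesis hE : orthonormal_basis H (onb H).
Hypothesis stein : is_bochner H P xi 0.
Local Notation K := (stein_kernel H xi).
Local Notation PP := (P \x P)%E.
Local Notation C := (stein_cov H xi P).
Local Notation EK2 := (\int[PP]_z (K z.1 z.2 ^+ 2))%R.
Hypothesis K2_gt0 : 0 < EK2.
Variables (X : set T) (A : R).
Hypotheses (mX : measurable X) (PX : P X = 1%E) (A4 : 4 <= A).

Let iK := finite_energyP hH sxi fe.

(** [bochner] picks some Bochner integral; its inner product with itself and that of 0 with it are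
    the integral of the same real function. *)
Lemma ksd_stein0 : ksd H xi P = 0.
Proof.
have sp := mean_embedding_spec hH sxi fe.
have cm := carrier_mean_embedding hH sxi fe.
have [_ e1] := bochner_ip hH sp sxi cm; have [_ e2] := bochner_ip hH stein sxi cm.
by rewrite /ksd /hnorm -e1 e2 ip0l// sqrtr0.
Qed.

Section perturbation.
Variables (Q : probability T R) (f : T -> R).
Hypotheses (f0 : forall x, 0 <= f x) (f2 : forall x, f x <= 2) (mf : measurable_fun setT f)
  (PQ : forall g : T -> \bar R, measurable_fun setT g -> (forall x, 0 <= g x)%E ->
    (\int[Q]_x g x = \int[P]_x (g x * (f x)%:E))%E).

Let dom g : measurable_fun setT g -> (forall x, 0 <= g x)%E ->
  (\int[Q]_x g x <= 2%:E * \int[P]_x g x)%E.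
Proof.
move=> mg g0; rewrite PQ// -ge0_integralZl//.
apply: ge0_le_integral => //.
- by move=> x _; rewrite mule_ge0// lee_fin.
- by apply: emeasurable_funM => //; exact/measurable_EFinP.
- exact: measurable_funeM.
- by move=> x _; rewrite muleC; apply: lee_wpmul2r => //; rewrite lee_fin.
Qed.

Lemma perturbation_energy : finite_energy H xi Q.
Proof.
rewrite /finite_energy; apply: le_lt_trans (dom _ _) _.
- by apply/measurable_EFinP; exact: measurable_stein_kernel2.
- by move=> x; rewrite lee_fin (stein_kernel_diag hH sxi) sqr_ge0.
- by rewrite -EFin_Rintegral// -EFinM ltry.
Qed.

Lemma perturbation_kernel :
  (\int[(Q \x Q)%E]_z (K z.1 z.2 ^+ 2)%:E <= (4 * EK2)%:E)%E.
Proof.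
have mK2 : measurable_fun setT (fun z : T * T => (K z.1 z.2 ^+ 2)%:E).
  by apply/measurable_EFinP; apply: measurable_funX; exact: measurable_stein_kernel.
have K20 (z : T * T) : (0 <= (K z.1 z.2 ^+ 2)%:E)%E by rewrite lee_fin sqr_ge0.
have mF (m : probability T R) :
    measurable_fun setT (fun x => \int[m]_y (K x y ^+ 2)%:E)%E.
  exact: (measurable_fun_fubini_tonelli_F (m2 := m) (fun z : T * T => (K z.1 z.2 ^+ 2)%:E)).
have F0 (m : probability T R) x : (0 <= \int[m]_y (K x y ^+ 2)%:E)%E.
  by apply: integral_ge0 => y _; rewrite lee_fin sqr_ge0.
rewrite (fubini_tonelli1 (fun z : T * T => (K z.1 z.2 ^+ 2)%:E))//.
apply: (@le_trans _ _ (\int[Q]_x (2%:E * \int[P]_y (K x y ^+ 2)%:E))%E).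
  apply: ge0_le_integral => //.
  - by move=> x _; exact: F0.
  - exact: mF.
  - by apply: measurable_funeM; exact: mF.
  - move=> x _; apply: (dom (g := fun y => (K x y ^+ 2)%:E)) => [|y]; last by rewrite lee_fin sqr_ge0.
    exact: (measurableT_comp mK2 (measurable_pair1 x)).
apply: le_trans (dom (g := fun x => (2%:E * \int[P]_y (K x y ^+ 2)%:E)%E) _ _) _.
- by apply: measurable_funeM; exact: mF.
- by move=> x; rewrite mule_ge0.
rewrite ge0_integralZl//.
rewrite -(fubini_tonelli1 (fun z : T * T => (K z.1 z.2 ^+ 2)%:E))//.
by rewrite -EFin_Rintegral; [rewrite -!EFinM lee_fin mulrA -natrM|exact: intg_kernel_sqr].
Qed.

Lemma perturbation_class : stein_class H xi X P A Q.
Proof.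
split; [|exact: perturbation_energy|].
(* [Q] is known only through integrals, so its mass off [X] is treated as the integral of an
   indicator, dominated by the one under [P]. *)
- have QC : Q (~` X) = 0%E.
    rewrite -(setIT (~` X)) -integral_indic//; last exact: measurableC.
    apply/eqP; rewrite eq_le integral_ge0 ?andbT; last by move=> x _; rewrite lee_fin.
    have mI : measurable_fun setT (fun x : T => (\1_(~` X) x : R)%:E).
      by apply/measurable_EFinP; apply: measurable_indic; exact: measurableC.
    have I0 (x : T) : (0 <= (\1_(~` X) x : R)%:E)%E by rewrite lee_fin.
    apply: le_trans (dom mI I0) _; rewrite integral_indic//; last exact: measurableC.
    have PC : P (~` X) = 0%E by rewrite probability_setC// PX subee.
    rewrite setIT; apply: (@le_trans _ _ (2%:E * 0)%E); last by rewrite mule0.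
    by apply: lee_wpmul2l => //; rewrite [leLHS]PC.
  by have := probability_setC Q mX; rewrite QC => /esym/eqP; rewrite sube_eq// add0e => /eqP.
- rewrite (trace_cov_sqr hH sxi fe hE) -EFinM.
  apply: le_trans perturbation_kernel _; rewrite lee_fin ler_wpM2r//; exact: ltW.
Qed.

Lemma perturbation_ksd (s : seq V) : onseq (onb H) s ->
  \sum_(e <- s) (\int[P]_x (ip H (xi x) e * f x))%R ^+ 2 <= ksd H xi Q ^+ 2.
Proof.
move=> os; have oo := onseq_orthonormal hE os.
have feQ := perturbation_energy.
have cm := carrier_mean_embedding hH sxi feQ.
rewrite hnorm_sqr//; apply: le_trans (bessel hH oo cm).
rewrite big_seq [leRHS]big_seq; apply: ler_sum => e es.
have ce : carrier H e by case: oo => _ /(_ e es).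
have [_ e1] := bochner_ip hH (mean_embedding_spec hH sxi feQ) sxi ce.
rewrite (ip_sym hH ce cm) -e1.
have me : measurable_fun setT (fun x => ip H (xi x) e) by exact: measurable_smeas_ipr.
have [i1 _] := bochner_ip hH stein sxi ce.
have [|_ ->//] := density_intg f0 PQ me.
apply: (intg_le (g := fun x => 2 * `|ip H (xi x) e|)).
- exact: measurable_funM.
- by move=> x; rewrite normrM mulrC; apply: ler_wpM2r => //; rewrite ger0_norm.
- by apply: intgZ; exact: intg_norm.
Qed.

End perturbation.
End lower_bound.

(** * Minimax lower bound *)

Section lower_risk.
Context (R : realType) (V : lmodType R) (H : inner_space V) (hH : is_hilbert H).
Context (d : nat).
Local Notation T := 'rV[R]_d.
Variables (xi : T -> V) (sxi : smeas H xi) (P : probability T R).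
Hypothesis fe : finite_energy H xi P.
Hypothesis hE : orthonormal_basis H (onb H).
Hypothesis stein : is_bochner H P xi 0.
Local Notation K := (stein_kernel H xi).
Local Notation PP := (P \x P)%E.
Local Notation C := (stein_cov H xi P).
Local Notation EK2 := (\int[PP]_z (K z.1 z.2 ^+ 2))%R.
Hypothesis K2_gt0 : 0 < EK2.
Variables (X : set T) (A : R).
Hypotheses (mX : measurable X) (PX : P X = 1%E) (A4 : 4 <= A).
Local Notation Q := (stein_class H xi X P A).

Let classP : Q P.
Proof.
split => //; rewrite (trace_cov_sqr hH sxi fe hE) -EFinM -EFin_Rintegral.
  rewrite lee_fin ler_peMl; [by []|exact: ltW|].
  by apply: le_trans A4; rewrite ler1n.
exact: intg_kernel_sqr.
Qed.

Let density_bounds (y : R) : `|y| <= 1 -> 0 <= 1 + y /\ 1 + y <= 2.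
Proof. by rewrite ler_norml => /andP[? ?]; split; lra. Qed.

Let chaos_aux (a b : R) : 128 * a * b <= 1 -> 4 * a * b <= 2^-1.
Proof. lra. Qed.

Let final_aux (x z r : R) : x <= 2 * r + z -> z <= x / 4 * 2 -> x <= 4 * r.
Proof. lra. Qed.

Let half_aux (a b c : R) : a / 2 < b -> b / 2 <= c -> a / 4 <= c.
Proof. lra. Qed.

(** The margins EK2 / 2 and 2 * EK2 leave room both for restricting to finitely many directions and
    for truncating them. Bundling the KSD bound hides the orthonormal basis from the rest of the
    argument. *)
Let finite_directions : exists N : nat, exists e : nat -> V, exists psi : nat -> T -> R, exists G : R,
  [/\ [/\ forall i, measurable_fun setT (psi i), forall i x, `|psi i x| <= G &
      forall i, (\int[P]_x psi i x)%R = 0],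
      EK2 / 2 < \sum_(i < N) \sum_(k < N) (\int[P]_x (ip H (xi x) (e k) * psi i x))%R ^+ 2,
      \sum_(i < N) \sum_(k < N) (\int[P]_x (psi i x * psi k x))%R ^+ 2 < 2 * EK2 &
      forall (Q' : probability T R) (f : T -> R), (forall x, 0 <= f x) -> (forall x, f x <= 2) ->
       measurable_fun setT f ->
       (forall g : T -> \bar R, measurable_fun setT g -> (forall x, 0 <= g x)%E ->
         (\int[Q']_x g x = \int[P]_x (g x * (f x)%:E))%E) ->
       \sum_(k < N) (\int[P]_x (ip H (xi x) (e k) * f x))%R ^+ 2 <= ksd H xi Q' ^+ 2] /\
      forall i, intg P (fun x => ip H (xi x) (e i)) /\ (\int[P]_x ip H (xi x) (e i))%R = 0.
Proof.
have [|s os hs] := cov_matrix_large hH sxi fe hE (a := EK2 / 2).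
  by rewrite ltr_pdivrMr// mulr_natr mulr2n ltrDl.
have hs2 : \sum_(e <- s) \sum_(f <- s) ip H (C e) f ^+ 2 < 2 * EK2.
  apply: le_lt_trans (sum_sqr_cov_le hH sxi fe hE os) _.
  by rewrite mulr_natl mulr2n ltrDl.
pose N := size s; pose e i := s`_i.
have ce i : carrier H (e i).
  have [iN|iN] := ltnP i N.
    have [_ sE] := os; have [EH _ _ _] := hE.
    by apply/EH/sE/mem_nth.
  (* Beyond [N] the sequence [e] is 0, so that facts about [e i] hold for all i. *)
  by rewrite /e nth_default//; exact: carrier0.
have ia i : intg P (fun x => ip H (xi x) (e i)) by have [] := bochner_ip hH stein sxi (ce i).
have a0 i : (\int[P]_x ip H (xi x) (e i))%R = 0.
  by have [_ ->] := bochner_ip hH stein sxi (ce i); rewrite ip0l.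
have sumE (F : V -> V -> R) : \sum_(u <- s) \sum_(v <- s) F u v =
    \sum_(i < N) \sum_(k < N) F (e i) (e k).
  rewrite (big_nth 0) big_mkord; apply: eq_bigr => i _.
  by rewrite (big_nth 0) big_mkord.
have cE : \sum_(u <- s) \sum_(v <- s) ip H (C u) v ^+ 2 = \sum_(i < N) \sum_(k < N)
    (\int[P]_x (ip H (xi x) (e i) * ip H (xi x) (e k)))%R ^+ 2.
  rewrite sumE; apply: eq_bigr => i _; apply: eq_bigr => k _.
  by rewrite (cov_ip hH sxi fe).
rewrite cE in hs hs2.
have [|psi [G [mpsi bpsi psi0 lo hi]]] := centered_truncation (a := fun i x => ip H (xi x) (e i))
    ia _ a0 hs hs2.
  by move=> i; apply: intg_ip_sqr.
exists N, e, psi, G; split => //; split => // Q' f f0 f2 mf PQ.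
have := perturbation_ksd hH sxi fe hE stein f0 f2 mf PQ os.
by rewrite (big_nth 0) big_mkord.
Qed.

Lemma lower_risk : exists N0 : nat, forall n, (N0 <= n)%N ->
  forall That : n.-tuple T -> R, measurable_fun setT That ->
  ((Num.sqrt (Num.sqrt EK2 / n%:R))%:E <=
   (32 * pz_const R ^+ 2)%:E * max_risk H xi Q That)%E.
Proof.
have [N [e [psi [G [[[mpsi bpsi psi0] lo hi hksd] ha]]]]] := finite_directions.
have k2p := K2_gt0; set k2 := EK2 in k2p lo hi *; pose k := Num.sqrt k2.
have k0 : 0 < k by rewrite sqrtr_gt0.
have kk : k ^+ 2 = k2 by rewrite sqr_sqrtr// ltW.
pose B := N%:R * G.
have G0 : 0 <= G by apply: le_trans (normr_ge0 (psi 0%N 0)) (bpsi 0%N 0).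
have B0 : 0 <= B by rewrite mulr_ge0.
(* From this rank on B ^ 2 <= n * k, hence eps * B <= 1 and the perturbed densities stay between 0
   and 2. The successor keeps n positive. *)
exists (Num.bound (B ^+ 2 / k)).+1 => n nN That mT.
have n0 : 0 < n%:R :> R by rewrite ltr0n (leq_trans _ nN).
have nB : B ^+ 2 / k <= n%:R.
  have /ltW/le_trans : B ^+ 2 / k < (Num.bound (B ^+ 2 / k))%:R.
    by apply: archi_boundP; rewrite divr_ge0 ?sqr_ge0// ltW.
  by apply; rewrite ler_nat (leq_trans _ nN).
pose rate := Num.sqrt (k / n%:R); rewrite -/rate.
(* With 1/16, t = n * eps ^ 2 equals 1 / (16 k), and 128 * t ^ 2 * (2 * k ^ 2) = 1 is exactly the
   smallness condition of [sign_avg_chaos]. *)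
pose eps := Num.sqrt (16^-1 / (n%:R * k)).
have nk0 : 0 < n%:R * k by rewrite mulr_gt0.
have eps2 : eps ^+ 2 = 16^-1 / (n%:R * k) by rewrite sqr_sqrtr// divr_ge0// ltW.
have eps0 : 0 <= eps by exact: sqrtr_ge0.
have epsB : eps * B <= 1.
  rewrite -(@ler_pXn2r _ 2)// ?nnegrE ?mulr_ge0// expr1n exprMn eps2.
  have h1 : B ^+ 2 <= n%:R * k by rewrite -ler_pdivrMr.
  rewrite mulrAC ler_pdivrMr// mul1r; apply: le_trans h1.
  by rewrite ler_piMl ?sqr_ge0// invf_le1// ler1n.
pose g s x := \sum_(i < N) psi i x * s`_i.
pose f s x := 1 + eps * g s x.
have sgn (s : seq R) i : sign_seq N s -> (i < N)%N -> `|s`_i| = 1.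
  move=> [ss hs] iN; have /hs : s`_i \in s by rewrite mem_nth// ss.
  by move=> [->|->]; rewrite ?normrN1 ?normr1.
have gB s x : sign_seq N s -> `|g s x| <= B.
  move=> hs; apply: le_trans (ler_norm_sum _ _ _) _.
  apply: (@le_trans _ _ (\sum_(i < N) G)).
    by apply: ler_sum => i _; rewrite normrM (sgn s i)// mulr1.
  by rewrite sumr_const card_ord -mulr_natl.
have epsg s x : sign_seq N s -> `|eps * g s x| <= 1.
  move=> hs; rewrite normrM ger0_norm//; apply: le_trans epsB.
  by apply: ler_wpM2l => //; exact: gB.
have f_ge0 s x : sign_seq N s -> 0 <= f s x.
  by move=> /(epsg s x)/density_bounds[].
have f_le2 s x : sign_seq N s -> f s x <= 2.
  by move=> /(epsg s x)/density_bounds[].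
have mg s : measurable_fun setT (g s).
  by apply: measurable_sum => i; exact: measurable_funM.
have mf s : measurable_fun setT (f s).
  by apply: measurable_funD => //; exact: measurable_funM.
have ipsi i : intg P (psi i) by apply: (@intg_bounded _ T R P _ G).
have ipsis s i : intg P (fun x => psi i x * s`_i).
  by have := intgZ s`_i (ipsi i); apply: eq_intg => x; rewrite mulrC.
have ig s : intg P (g s) by exact: intg_sum.
have g0 s : (\int[P]_x g s x)%R = 0.
  rewrite Rintegral_sum//; apply: big1 => i _.
  by rewrite RintegralZr// psi0 mul0r.
have if_ s : intg P (f s) by apply: intgD; [exact: intg_cst|exact: intgZ].
have f1 s : (\int[P]_x f s x)%R = 1.
  rewrite RintegralD//; [|exact: intg_cst|exact: intgZ].
  by rewrite Rint_cst RintegralZl// g0 mulr0 addr0.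
have /choice[Qs hQs] s : exists Q' : probability T R, sign_seq N s ->
    forall h : T -> \bar R, measurable_fun setT h -> (forall x, 0 <= h x)%E ->
    (\int[Q']_x h x = \int[P]_x (h x * (f s x)%:E))%E.
  (* Lists that are not sign vectors get [P] as a default value. *)
  have [hs|hs] := pselect (sign_seq N s); last by exists P.
  have [Q' hQ'] := density_exists (fun x => f_ge0 s x hs) (if_ s) (f1 s).
  by exists Q'.
have QsQ s : sign_seq N s -> Q (Qs s).
  move=> hs; exact: (perturbation_class hH sxi fe hE K2_gt0 mX PX A4
    (fun x => f_ge0 s x hs) (fun x => f_le2 s x hs) (mf s) (hQs s hs)).
set risk := max_risk _ _ _ _.
have risk0 : (0 <= risk)%E.
  apply: (@le_trans _ _ (\int[tuple_measure P n]_s `|That s - ksd H xi P|%:E)%E).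
    by apply: integral_ge0 => t _; rewrite lee_fin.
  by apply: ereal_sup_ubound; exists P => //; exact: classP.
have C0 : 0 < 32 * pz_const R ^+ 2 by rewrite mulr_gt0// !exprn_gt0.
have [rfin|] := boolP (risk \is a fin_num); last first.
  rewrite ge0_fin_numE// -leNgt leye_eq => /eqP ->.
  by rewrite gt0_muley ?lte_fin// leey.
pose r := fine risk; have rE : risk = r%:E by rewrite fineK.
rewrite rE -EFinM lee_fin.
pose TM := tuple_measure P n.
pose L s (t : n.-tuple T) := \prod_(i < n) f s (tnth t i).
have mL s : measurable_fun setT (L s).
  by apply: measurable_prod => i _; exact: measurable_tnth_comp.
have L_ge0 s t : sign_seq N s -> 0 <= L s t.
  by move=> hs; apply: prodr_ge0 => i _; exact: f_ge0.
have iprod (h : T -> R) : (forall x, 0 <= h x) -> intg P h ->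
    intg TM (fun t => \prod_(i < n) h (tnth t i)) /\
    (\int[TM]_t (\prod_(i < n) h (tnth t i)))%R = (\int[P]_x h x)%R ^+ n.
  move=> h0 ih; have e1 := tuple_prod n h0 ih; split; last by rewrite /Rintegral e1.
  apply: intg_lty.
  - apply: measurable_prod => i _; apply: measurable_tnth_comp.
    exact: (intg_measurable ih).
  - by move=> t; apply: prodr_ge0 => i _.
  - by rewrite e1 ltry.
have iL s (hs : sign_seq N s) := iprod _ (fun x => f_ge0 s x hs) (if_ s).
have iff s s' : sign_seq N s -> sign_seq N s' -> intg P (fun x => f s x * f s' x).
  move=> hs hs'; apply: (@intg_bounded _ T R P _ (2 * 2)); first exact: measurable_funM.
  by move=> x; rewrite normrM; apply: ler_pM => //; rewrite ger0_norm ?f_ge0 ?f_le2.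
have iLL s s' (hs : sign_seq N s) (hs' : sign_seq N s') :
    intg TM (fun t => L s t * L s' t) /\
    (\int[TM]_t (L s t * L s' t))%R = (\int[P]_x (f s x * f s' x))%R ^+ n.
  have [|i1 e1] := iprod _ _ (iff s s' hs hs'); first by move=> x; rewrite mulr_ge0 ?f_ge0.
  have LE : (fun t : n.-tuple T => \prod_(i < n) (f s (tnth t i) * f s' (tnth t i))) =
      (fun t => L s t * L s' t) by apply/funext => t; rewrite big_split.
  by rewrite LE in i1 e1.
pose M i j := (\int[P]_x (psi i x * psi j x))%R.
have ipp i j : intg P (fun x => psi i x * psi j x).
  apply: (@intg_bounded _ T R P _ (G * G)); first exact: measurable_funM.
  by move=> x; rewrite normrM; apply: ler_pM.
have igg s s' : intg P (fun x => g s x * g s' x) /\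
    (\int[P]_x (g s x * g s' x))%R = \sum_(i < N) \sum_(j < N) s`_i * s'`_j * M i j.
  have E : (fun x => g s x * g s' x) =
      (fun x => \sum_(i < N) \sum_(j < N) s`_i * s'`_j * (psi i x * psi j x)).
    apply/funext => x; rewrite /g mulr_suml; apply: eq_bigr => i _.
    by rewrite mulr_sumr; apply: eq_bigr => j _; ring.
  rewrite E; split; first by apply: intg_sum => i _; apply: intg_sum => j _; exact: intgZ.
  rewrite Rintegral_sum; last by move=> i _; apply: intg_sum => j _; exact: intgZ.
  apply: eq_bigr => i _; rewrite Rintegral_sum; last by move=> j _; exact: intgZ.
  by apply: eq_bigr => j _; rewrite RintegralZl.
pose t := n%:R * eps ^+ 2.
have tE : t = 16^-1 / k by rewrite /t eps2; field; rewrite !gt_eqF.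
have t0 : 0 < t by rewrite tE divr_gt0.
have LL_le s s' : sign_seq N s -> sign_seq N s' -> (\int[TM]_t (L s t * L s' t))%R <=
    expR (t * \sum_(i < N) \sum_(j < N) s`_i * s'`_j * M i j).
  move=> hs hs'; have [_ ->] := iLL s s' hs hs'.
  have [ig2 <-] := igg s s'.
  (* The integral over the sample is the n-th power of 1 + eps ^ 2 * E (g s * g s'), the first-order
     terms vanishing by centring; 1 + y <= exp y then puts the chaos in the exponent. *)
  rewrite /t -mulrA expRM_natl lerXn2r ?nnegrE ?expR_ge0//.
    by apply: Rint_ge0 => x; rewrite mulr_ge0 ?f_ge0.
  have -> : (\int[P]_x (f s x * f s' x))%R = 1 + eps ^+ 2 * (\int[P]_x (g s x * g s' x))%R.
    transitivity (\int[P]_x (1 + (eps * g s x + eps * g s' x) + eps ^+ 2 * (g s x * g s' x)))%R.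
      by apply: eq_Rintegral => x _; rewrite /f; ring.
    have i1 := intgZ eps (ig s); have i2 := intgZ eps (ig s').
    have i3 : intg P (fun x => eps * g s x + eps * g s' x) by exact: intgD.
    have i4 : intg P (fun x => 1 + (eps * g s x + eps * g s' x)).
      by apply: intgD => //; exact: intg_cst.
    rewrite RintegralD//; last exact: intgZ.
    rewrite RintegralD//; last exact: intg_cst.
    by rewrite RintegralD// Rint_cst !RintegralZl// !g0 !mulr0 !addr0.
  exact: expR_ge1Dx.
have avgLL : sign_avg N (fun s => sign_avg N (fun s' => (\int[TM]_t (L s t * L s' t))%R)) <= 2.
  apply: le_trans (le_sign_avg (fun s hs => le_sign_avg (fun s' hs' => LL_le s s' hs hs'))) _.
  have k2E : 128 * t ^+ 2 * (2 * k2) = 1.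
    by rewrite tE -kk; field; rewrite gt_eqF.
  have S0 : 0 <= \sum_(i < N) \sum_(j < N) M i j ^+ 2.
    by apply: sumr_ge0 => i _; apply: sumr_ge0 => j _; exact: sqr_ge0.
  have hM : 128 * t ^+ 2 * \sum_(i < N) \sum_(j < N) M i j ^+ 2 <= 1.
    apply: (@le_trans _ _ (128 * t ^+ 2 * (2 * k2))); last by rewrite k2E.
    by apply: ler_wpM2l; [rewrite mulr_ge0// sqr_ge0|exact: ltW].
  apply: le_trans (sign_avg_chaos t0 hM) _; apply: expR_small; last exact: chaos_aux.
  by rewrite mulr_ge0// mulr_ge0// sqr_ge0.
pose v i k := (\int[P]_x (ip H (xi x) (e k) * psi i x))%R.
pose Y s := sqn N (fun k => \sum_(i < N) v i k * s`_i).
pose U := \sum_(i < N) sqn N (v i).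
have U_lo : k2 / 2 < U by [].
have U0 : 0 < U by apply: lt_trans U_lo; rewrite divr_gt0.
have iap i j : intg P (fun x => ip H (xi x) (e i) * psi j x).
  have [iai _] := ha i; have mai := intg_measurable iai.
  apply: (intg_le (g := fun x => G * `|ip H (xi x) (e i)|)); first exact: measurable_funM.
    by move=> x; rewrite normrM mulrC; apply: ler_wpM2r.
  by apply: intgZ; exact: intg_norm.
have ksd_ge s : sign_seq N s -> eps ^+ 2 * Y s <= ksd H xi (Qs s) ^+ 2.
  move=> hs; have := hksd (Qs s) (f s) (fun x => f_ge0 s x hs) (fun x => f_le2 s x hs)
    (mf s) (hQs s hs).
  apply: le_trans; rewrite /Y /sqn mulr_sumr; apply: ler_sum => i _.
  rewrite -exprMn le_eqVlt; apply/orP; left; apply/eqP; congr (_ ^+ 2).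
  have [iai a0] := ha i.
  transitivity (\int[P]_x (ip H (xi x) (e i) +
      eps * \sum_(j < N) s`_j * (ip H (xi x) (e i) * psi j x)))%R; last first.
    apply: eq_Rintegral => x _; rewrite /f /g mulrDr mulr1; congr (_ + _).
    rewrite !mulr_sumr; apply: eq_bigr => j _; ring.
  have i1 : intg P (fun x => \sum_(j < N) s`_j * (ip H (xi x) (e i) * psi j x)).
    by apply: intg_sum => j _; exact: intgZ.
  rewrite RintegralD//; last exact: intgZ.
  rewrite a0 add0r RintegralZl//; congr (_ * _); rewrite Rintegral_sum; last first.
    by move=> j _; exact: intgZ.
  by apply: eq_bigr => j _; rewrite RintegralZl// mulrC.
pose w s : R := if U / 2 <= Y s then 1 else 0.
(* On the event Y >= U / 2 the squared KSD is at least eps ^ 2 * k2 / 4 = k / (64 n) = (rate / 8) ^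
   2. *)
pose delta := rate / 8.
have rate0 : 0 <= rate by exact: sqrtr_ge0.
have delta0 : 0 <= delta by rewrite divr_ge0.
have w01 s : sign_seq N s -> w s = 0 \/ (w s = 1 /\ delta <= ksd H xi (Qs s)).
  move=> hs; rewrite /w; case: ifPn => YU; [right; split => //|by left].
  have ksd0 : 0 <= ksd H xi (Qs s) by rewrite /ksd hnorm_ge0.
  rewrite -(@ler_pXn2r _ 2)// ?nnegrE//; apply: le_trans (ksd_ge s hs).
  apply: (@le_trans _ _ (eps ^+ 2 * (k2 / 4))); last first.
    by apply: ler_wpM2l; [exact: sqr_ge0|exact: half_aux U_lo YU].
  rewrite /delta expr_div_n /rate sqr_sqrtr; last by rewrite divr_ge0// ltW.
  rewrite eps2 -kk le_eqVlt; apply/orP; left; apply/eqP; field.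
  by rewrite !gt_eqF.
have pz := paley_zygmund U0; rewrite -/(Y _) in pz.
have mTd (c : R) : measurable_fun setT (fun x => `|That x - c|).
  by apply: measurableT_comp => //; exact: measurable_funB.
have rP : (\int[TM]_t `|That t|%:E <= r%:E)%E.
  rewrite -rE; apply: ereal_sup_ubound; exists P; first exact: classP.
  by rewrite (ksd_stein0 hH sxi fe stein); apply: eq_integral => u _; rewrite subr0.
have mTn : measurable_fun setT (fun u => `|That u|) by exact: measurableT_comp.
have iT : intg TM (fun u => `|That u|).
  by apply: intg_lty => //; exact: le_lt_trans rP (ltry _).
have rT : (\int[TM]_u `|That u|)%R <= r by rewrite -lee_fin EFin_Rintegral.
have rQ s : sign_seq N s ->
    (\int[TM]_u (`|That u - ksd H xi (Qs s)| * L s u)%:E <= r%:E)%E.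
  move=> hs; have := density_tuple (fun x => f_ge0 s x hs) (mf s) (hQs s hs)
    (F := fun u : n.-tuple T => `|That u - ksd H xi (Qs s)|%:E).
  have mF : measurable_fun setT (fun u : n.-tuple T => `|That u - ksd H xi (Qs s)|%:E).
    exact/measurable_EFinP.
  have F0 (u : n.-tuple T) : (0 <= `|That u - ksd H xi (Qs s)|%:E)%E by rewrite lee_fin.
  move=> /(_ mF F0) eQ; rewrite [leLHS](_ : _ =
    (\int[tuple_measure (Qs s) n]_u `|That u - ksd H xi (Qs s)|%:E)%E); last first.
    by rewrite eQ; apply: eq_integral => u _; rewrite -EFinM.
  by rewrite -rE; apply: ereal_sup_ubound; exists (Qs s) => //; exact: QsQ.
have iTs s : sign_seq N s -> intg TM (fun u => `|That u - ksd H xi (Qs s)| * L s u).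
  move=> hs; apply: intg_lty.
  - by apply: measurable_funM.
  - by move=> u; rewrite mulr_ge0 ?L_ge0.
  - by apply: le_lt_trans (rQ s hs) _; rewrite ltry.
have rTs s : sign_seq N s -> (\int[TM]_u (`|That u - ksd H xi (Qs s)| * L s u))%R <= r.
  by move=> hs; rewrite -lee_fin EFin_Rintegral; [exact: rQ|exact: iTs].
have L1 s : sign_seq N s -> (\int[TM]_u L s u)%R = 1.
  by move=> hs; rewrite (iL s hs).2 f1 expr1n.
have pz0 : 0 < pz_const R by rewrite exprn_gt0.
pose p := (pz_const R)^-1.
have p0 : 0 < p by rewrite invr_gt0.
have p1 : p <= 1 by rewrite invf_le1// exprn_ege1// ler1n.
(* Taking c equal to the probability bound p, with products of likelihoods averaging to at most 2,
   leaves delta * p ^ 2 <= 2 r + delta * p ^ 2 / 2, hence delta * p ^ 2 <= 4 r. The constant is 32 =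
   8 * 4. *)
have := @mixture_bound _ _ R TM N L w (fun s => ksd H xi (Qs s)) delta r That
  (fun s x => L_ge0 s x) (fun s hs => (iL s hs).1) L1
  (fun s s' hs hs' => (iLL s s' hs hs').1) w01 delta0 iT rT iTs rTs p (ltW p0) p1.
move=> main.
have h1 : delta * p * p <= delta * p * sign_avg N w.
  by apply: ler_wpM2l => //; rewrite mulr_ge0// ltW.
have h2 : delta * p ^+ 2 / 4 * sign_avg N (fun s => sign_avg N (fun s' =>
    (\int[TM]_t (L s t * L s' t))%R)) <= delta * p ^+ 2 / 4 * 2.
  by apply: ler_wpM2l => //; rewrite divr_ge0// mulr_ge0// sqr_ge0.
have h3 : delta * p ^+ 2 <= 4 * r.
  apply: final_aux _ h2.
  by rewrite [leLHS](_ : _ = delta * p * p); [exact: le_trans h1 main|ring].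
have -> : rate = 8 * (pz_const R) ^+ 2 * (delta * p ^+ 2).
  by rewrite /delta /p; field; rewrite gt_eqF.
have -> : 32 * pz_const R ^+ 2 * r = 8 * pz_const R ^+ 2 * (4 * r) by ring.
by apply: ler_wpM2l => //; rewrite mulr_ge0// sqr_ge0.
Qed.

End lower_risk.

(** * Continuity of the feature map *)

Section directional.
Context (R : realType) (d : nat).
Local Notation T := 'rV[R]_d.
Implicit Types (F : T -> R) (x e : T).

Let line_quotient F x e (u h : R) :
  h^-1 *: (((fun t : R => F (x + t *: e)) \o shift u) (h *: (1 : R^o)) - F (x + u *: e)) =
  h^-1 *: ((F \o shift (x + u *: e)) (h *: e) - F (x + u *: e)).
Proof.
congr (_ *: (F _ - _)); rewrite /= [h *: 1]mulr1 scalerDl addrCA addrA addrC.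
by rewrite [h *: e + _]addrC addrA.
Qed.

Lemma line_derive F x e (u : R) :
  'D_(1 : R^o) (fun t : R => F (x + t *: e)) u = 'D_e F (x + u *: e).
Proof. by rewrite /derive; under eq_fun do rewrite line_quotient. Qed.

Lemma line_is_derive F x e (u : R) : derivable F (x + u *: e) e ->
  is_derive u (1 : R) (fun t => F (x + t *: e)) ('D_e F (x + u *: e)).
Proof.
move=> dF; split.
  by rewrite /derivable; under eq_fun do rewrite line_quotient.
exact: line_derive.
Qed.

Lemma line_mvt F x e (h : R) : 0 < h ->
  (forall t, 0 <= t <= h -> derivable F (x + t *: e) e) ->
  exists2 c, 0 < c < h & F (x + h *: e) - F x = 'D_e F (x + c *: e) * h.
Proof.
move=> h0 dF; pose f (t : R) := F (x + t *: e).
have [|||c] := @MVT R f (fun t => 'D_e F (x + t *: e)) 0 h.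
- by [].
- move=> t; rewrite in_itv /= => /andP[t0 th]; apply: line_is_derive.
  by apply: dF; rewrite !ltW.
- apply: derivable_within_continuous => t; rewrite in_itv /= => th.
  exact: (@ex_derive _ _ _ _ _ _ _ (line_is_derive (dF t th))).
rewrite in_itv /= => ch; rewrite /f scale0r addr0 subr0 => eF.
by exists c.
Qed.

(* The offset N keeps all the steps inside a given ball. *)
Definition small_step (N n : nat) : R := (n + N).+1%:R^-1.

Lemma small_step_gt0 N n : 0 < small_step N n.
Proof. by rewrite invr_gt0. Qed.

Lemma small_step_near (e : R) : 0 < e -> exists N, forall n, small_step N n < e.
Proof.
move=> e0; have [N _ hN] := near_infty_natSinv_lt (PosNum e0).
by exists N => n; apply: (hN (n + N)%N); exact: leq_addl.
Qed.

Lemma small_step_lt N (e : R) : 0 < e -> exists M, forall n, (M <= n)%N -> small_step N n < e.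
Proof.
move=> e0; have [M _ hM] := near_infty_natSinv_lt (PosNum e0).
by exists M => n Mn; apply: (hM (n + N)%N); exact: leq_trans Mn (leq_addr _ _).
Qed.

Lemma diff_quotient_cvg F x e N : derivable F x e ->
  (small_step N n)^-1 * (F (x + small_step N n *: e) - F x) @[n --> \oo] --> 'D_e F x.
Proof.
move=> dF; have hN : small_step N n @[n --> \oo] --> (0 : R)^'.
  move=> A /nbhs_ballP[r /= r0 rA]; have [M hM] := small_step_lt N r0.
  exists M => // n /hM nr; apply: rA; last by rewrite gt_eqF// small_step_gt0.
  by rewrite /ball /= sub0r normrN ger0_norm// ltW// small_step_gt0.
have := cvg_comp _ _ hN dF.
apply: cvg_trans; apply: near_eq_cvg; apply: nearW => n /=.
by rewrite [x + _]addrC.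
Qed.

Lemma line_near x (i : 'I_d) (A : set T) : nbhs x A ->
  exists2 r : R, 0 < r & forall t, `|t| < r -> A (x + t *: delta_mx 0 i).
Proof.
move=> /nbhs_ballP[r /= r0 rA]; exists r => // t tr; apply: rA; split => // j l.
rewrite /ball /= !mxE opprD addrA subrr sub0r normrN normrM.
apply: le_lt_trans tr; rewrite -[leRHS]mulr1; apply: ler_wpM2l => //.
by case: (_ && _); rewrite ?normr1 ?normr0.
Qed.

End directional.

(** * Derivatives of kernel sections in the reproducing kernel Hilbert space *)

Section rkhs_derivative.
Context (R : realType) (d : nat).
Local Notation T := 'rV[R]_d.
Variables (X : set T) (k : T -> T -> R) (Hk : inner_space (X -> R^o)).
Hypotheses (oX : open X) (kC11 : C11_on X k) (rk : is_rkhs (restrict2 (X := X) k) Hk).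
Local Notation "<[ u , v ]>" := (ip Hk u v) (at level 0, u, v at level 99).

Let hH : is_hilbert Hk. Proof. by case: rk. Qed.

Let pt x (Xx : X x) : X := exist _ x (mem_set Xx).

Definition kernel_section (x : T) : X -> R^o := fun y => k x (\val y).

Definition kernel_dsection (i : 'I_d) (x : T) : X -> R^o := fun y => partial1 i k x (\val y).

Lemma carrier_kernel_section x : X x -> carrier Hk (kernel_section x).
Proof. by move=> Xx; have [_ /(_ (pt Xx))] := rk. Qed.

Lemma kernel_reproducing f x (Xx : X x) : carrier Hk f -> <[f, kernel_section x]> = f (pt Xx).
Proof. by move=> cf; have [_ _ /(_ f (pt Xx) cf) ->] := rk. Qed.

Lemma ip_kernel_section x y : X x -> X y -> <[kernel_section x, kernel_section y]> = k x y.
Proof. by move=> Xx Xy; rewrite (kernel_reproducing Xy)//; exact: carrier_kernel_section. Qed.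

Section direction.
Variable i : 'I_d.
Local Notation e := (delta_mx 0 i : T).
Local Notation G := (partial2 i (partial1 i k)).

(** Up to the factor h * h', the second difference of [k] is a Gram entry of difference quotients.
    The mean value theorem is used in the first argument for the difference of two sections, then in
    the second for [partial1]. *)
Let double_mvt x (r h h' : R) : (forall t, `|t| < r -> X (x + t *: e)) ->
  0 < h < r -> 0 < h' < r -> exists u u', [/\ 0 < u < h, 0 < u' < h' &
    k (x + h *: e) (x + h' *: e) - k (x + h *: e) x - k x (x + h' *: e) + k x x =
    h * h' * G (x + u *: e) (x + u' *: e)].
Proof.
move=> Xr /andP[h0 hr] /andP[h'0 h'r].
have Xt t : 0 <= t < r -> X (x + t *: e).
  by move=> /andP[t0 tr]; apply: Xr; rewrite ger0_norm.
have Xx : X x by have := Xt 0; rewrite lexx (lt_trans h0)// scale0r addr0; exact.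
have Xh' : X (x + h' *: e) by apply: Xt; rewrite h'r ltW.
have dk y z : X y -> X z -> derivable (k ^~ z) y e.
  by move=> Xy Xz; have [_ /(_ i)[]] := kC11 Xy Xz.
have [|u uh eu] := @line_mvt R d (fun z => k z (x + h' *: e) - k z x) x e h h0.
  move=> t /andP[t0 th]; have Xth : X (x + t *: e) by apply: Xt; rewrite t0 (le_lt_trans th).
  by apply: derivableB; exact: dk.
have /andP[u0 uh'] := uh.
have Xu : X (x + u *: e) by apply: Xt; rewrite ltW//= (lt_trans uh').
have [|u' u'h eu'] := @line_mvt R d (partial1 i k (x + u *: e)) x e h' h'0.
  move=> t /andP[t0 th]; have Xth : X (x + t *: e) by apply: Xt; rewrite t0 (le_lt_trans th).
  by have [_ _ _ /(_ i i)[]] := kC11 Xu Xth.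
exists u, u'; split => //.
have : k (x + h *: e) (x + h' *: e) - k (x + h *: e) x - (k x (x + h' *: e) - k x x) =
    h * h' * G (x + u *: e) (x + u' *: e).
  rewrite eu deriveB; [|exact: dk|exact: dk].
  have -> : 'D_e (k ^~ (x + h' *: e)) (x + u *: e) - 'D_e (k ^~ x) (x + u *: e) =
    G (x + u *: e) (x + u' *: e) * h' by exact: eu'.
  ring.
by move=> <-; rewrite opprB addrA addrAC.
Qed.

(** The limit of the quotients is an abstract vector, whose values the reproducing property
    identifies with partial derivatives. The last clause turns inner products with the derivative
    into limits of ordinary difference quotients. *)
Lemma kernel_dsection_limit x : X x -> exists N,
  [/\ forall n, X (x + small_step R N n *: e), carrier Hk (kernel_dsection i x) &
    forall f, carrier Hk f ->
    (small_step R N n)^-1 * (<[f, kernel_section (x + small_step R N n *: e)]> -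
      <[f, kernel_section x]>) @[n --> \oo] --> <[f, kernel_dsection i x]>].
Proof.
move=> Xx.
have [r r0 Xr] : exists2 r : R, 0 < r & forall t, `|t| < r -> X (x + t *: e).
  by apply: line_near; exact: open_nbhs_nbhs.
have [N hN] := small_step_near r0.
pose h n := small_step R N n.
have h_gt0 n : 0 < h n by exact: small_step_gt0.
have Xh n : X (x + h n *: e) by apply: Xr; rewrite ger0_norm ?hN// ltW.
pose D n := (h n)^-1 *: (kernel_section (x + h n *: e) - kernel_section x).
have cx := carrier_kernel_section Xx.
have ch n := carrier_kernel_section (Xh n).
have cD n : carrier Hk (D n) by apply: carrierZ => //; exact: carrierB.
have DD n m : exists u u', [/\ 0 < u < h n, 0 < u' < h m &
    <[D n, D m]> = G (x + u *: e) (x + u' *: e)].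
  have [||u [u' [hu hu' E]]] := double_mvt (h := h n) (h' := h m) Xr.
  - by rewrite h_gt0 hN.
  - by rewrite h_gt0 hN.
  exists u, u'; split => //; have cB p : carrier Hk (kernel_section (x + h p *: e) - kernel_section x).
    exact: carrierB.
  rewrite (ipZl hH _ (cB n) (cD m)) (ipZr hH _ (cB m) (cB n)).
  rewrite (ipBl hH (ch n) cx (cB m)) !(ipBr hH (ch m) cx)// !ip_kernel_section// opprB.
  have -> : k (x + h n *: e) (x + h m *: e) - k (x + h n *: e) x +
      (k x x - k x (x + h m *: e)) = h n * h m * G (x + u *: e) (x + u' *: e).
    by rewrite -E [k x x - _]addrC addrA.
  by field; rewrite !gt_eqF.
have G_near eps : 0 < eps -> exists2 s : R, 0 < s & forall u u', `|u| < s -> `|u'| < s ->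
    `|G x x - G (x + u *: e) (x + u' *: e)| < eps.
  move=> eps0; have [_ _ _ /(_ i i)[_ cG]] := kC11 Xx Xx.
  move/cvgrPdist_lt : cG => /(_ _ eps0)[[A B] /= [nA nB] AB].
  have [s1 s10 h1] := line_near i nA; have [s2 s20 h2] := line_near i nB.
  exists (Num.min s1 s2); first by rewrite lt_min s10.
  move=> u u'; rewrite !lt_min => /andP[us1 _] /andP[_ us2].
  by apply: (AB (x + u *: e, x + u' *: e)); split; [exact: h1|exact: h2].
have D_cauchy eps : 0 < eps -> exists M, forall m n, (M <= m)%N -> (M <= n)%N ->
    hnorm Hk (D m - D n) < eps.
  (* |D m - D n| ^ 2 combines Gram entries with coefficients 1, -2, 1, all of them within eps ^ 2 /
     4 of the same value, which cancels. *)
  move=> eps0; have e4 : 0 < eps ^+ 2 / 4 by rewrite divr_gt0// exprn_gt0.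
  have [s s0 hs] := G_near _ e4; have [M hM] := small_step_lt N s0.
  have hD m n : (M <= m)%N -> (M <= n)%N -> `|G x x - <[D m, D n]>| < eps ^+ 2 / 4.
    move=> /hM hm /hM hn; have [u [u' [/andP[u0 um] /andP[u'0 un] ->]]] := DD m n.
    by apply: hs; rewrite gtr0_norm//; [exact: lt_trans um hm|exact: lt_trans un hn].
  exists M => m n Mm Mn.
  rewrite -(@ltr_pXn2r _ 2)// ?nnegrE ?hnorm_ge0 ?(ltW eps0)// sqr_hnormB//.
  have := hD m m Mm Mm; have := hD m n Mm Mn; have := hD n n Mn Mn.
  rewrite !ltr_norml => /andP[? ?] /andP[? ?] /andP[? ?]; lra.
have [v cv Dv] := hilbert_complete hH cD D_cauchy.
have ip_cvg f : carrier Hk f -> <[f, D n]> @[n --> \oo] --> <[f, v]>.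
  move=> cf; apply: (cvg_dist_le (e := fun n => hnorm Hk f * hnorm Hk (D n - v))).
    by move=> n; rewrite -ipBr//; apply: cauchy_schwarz => //; exact: carrierB.
  by rewrite -[X in _ --> X](mulr0 (hnorm Hk f)); apply: cvgM => //; exact: cvg_cst.
have ipD f n : carrier Hk f -> <[f, D n]> = (h n)^-1 *
    (<[f, kernel_section (x + h n *: e)]> - <[f, kernel_section x]>).
  by move=> cf; rewrite /D ipZr ?ipBr//; exact: carrierB.
have vE : v = kernel_dsection i x.
  apply/funext => y; have Xy : X (\val y) by apply: set_mem; exact: (svalP y).
  have ptE : pt Xy = y by exact: val_inj.
  have cy := carrier_kernel_section Xy.
  have h1 := ip_cvg _ cy.
  have h2 : <[kernel_section (\val y), D n]> @[n --> \oo] --> partial1 i k x (\val y).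
    have [_ /(_ i)[dk _] _ _] := kC11 Xx Xy.
    have := diff_quotient_cvg N dk; apply: cvg_trans; apply: near_eq_cvg; apply: nearW => n.
    rewrite ipD// !(ip_sym hH cy)// !ip_kernel_section//.
  rewrite -ptE -(kernel_reproducing Xy cv) (ip_sym hH cv cy) ptE.
  exact: (cvg_unique _ h1 h2).
exists N; split => //; first by rewrite -vE.
move=> f cf; rewrite -vE; have := ip_cvg f cf.
by under eq_fun do rewrite ipD//.
Qed.

Lemma carrier_kernel_dsection x : X x -> carrier Hk (kernel_dsection i x).
Proof. by move=> /kernel_dsection_limit[N []]. Qed.

(** For f = [kernel_dsection i y], the reproducing property makes the quotients of inner products
    difference quotients of [partial1 i k y], whose limit is the mixed derivative. *)
Lemma ip_kernel_dsection x y : X x -> X y ->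
  <[kernel_dsection i y, kernel_dsection i x]> = G y x.
Proof.
move=> Xx Xy; have [N [Xh cx hx]] := kernel_dsection_limit Xx.
have cy := carrier_kernel_dsection Xy.
have [_ _ _ /(_ i i)[dG _]] := kC11 Xy Xx.
have h2 : (small_step R N n)^-1 *
    (<[kernel_dsection i y, kernel_section (x + small_step R N n *: e)]> -
     <[kernel_dsection i y, kernel_section x]>) @[n --> \oo] --> G y x.
  have := diff_quotient_cvg N dG; apply: cvg_trans; apply: near_eq_cvg; apply: nearW => n.
  by rewrite (kernel_reproducing (Xh n))// (kernel_reproducing Xx).
exact: (cvg_unique _ (hx _ cy) h2).
Qed.

End direction.

(** |phi y - phi x| ^ 2 = g y y - 2 g y x + g x x, and continuity of [g] at the point (x, x) makes
    it small. *)
Lemma gram_hcontinuous (phi : T -> X -> R^o) (g : T -> T -> R) x : X x ->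
  (forall y, X y -> carrier Hk (phi y)) ->
  (forall y z, X y -> X z -> <[phi y, phi z]> = g y z) ->
  continuous2_at g x x -> hcontinuous_at Hk phi x.
Proof.
move=> Xx cphi gphi cg eps eps0.
have e4 : 0 < eps ^+ 2 / 4 by rewrite divr_gt0// exprn_gt0.
move/cvgrPdist_lt : cg => /(_ _ e4)[[A B] /= [nA nB] AB].
have nX : nbhs x X by exact: open_nbhs_nbhs.
have nAB : nbhs x (A `&` B `&` X) by apply: filterI => //; exact: filterI.
apply: filterS nAB => y [[Ay By] Xy].
have Ax := nbhs_singleton nA; have Bx := nbhs_singleton nB.
rewrite -(@ltr_pXn2r _ 2)// ?nnegrE ?hnorm_ge0 ?(ltW eps0)//.
rewrite (sqr_hnormB hH); [|exact: cphi|exact: cphi].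
rewrite !gphi//.
have := AB (y, y) (conj Ay By); have := AB (y, x) (conj Ay Bx).
rewrite /= !ltr_norml => /andP[? ?] /andP[? ?]; lra.
Qed.

End rkhs_derivative.

(** * The score function and the assembly of the feature map *)

Section feature_continuity.
Context (R : realType).

Lemma hcontinuous_affine (V : lmodType R) (H : inner_space V) (hH : is_hilbert H) d
    (X : set 'rV[R]_d) (a : 'rV[R]_d -> R) (phi psi : 'rV[R]_d -> V) x :
  open X -> X x -> (forall y, X y -> carrier H (phi y)) -> (forall y, X y -> carrier H (psi y)) ->
  {for x, continuous a} -> hcontinuous_at H phi x -> hcontinuous_at H psi x ->
  hcontinuous_at H (fun y => a y *: phi y + psi y) x.
Proof.
move=> oX Xx cphi cpsi ca hphi hpsi e e0.
pose M := hnorm H (phi x) + 1; pose L := `|a x| + 1.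
have M0 : 0 < M by rewrite ltr_wpDl ?hnorm_ge0.
have L0 : 0 < L by rewrite ltr_wpDl.
have e3 : 0 < e / 3 by rewrite divr_gt0.
have eM : 0 < e / 3 / M by rewrite divr_gt0.
have eL : 0 < Num.min 1 (e / 3 / L) by rewrite lt_min ltr01 divr_gt0.
have nX : nbhs x X by exact: open_nbhs_nbhs.
move/cvgrPdist_lt : ca => /(_ _ eM) na.
apply: filterS3 (filterI nX na) (hphi _ eL) (hpsi _ e3) => y [Xy ay].
rewrite lt_min => /andP[py1 py] qy.
have [cx cy] := (cphi x Xx, cphi y Xy); have [dx dy] := (cpsi x Xx, cpsi y Xy).
have cB := carrierB hH cy cx; have dB := carrierB hH dy dx.
have -> : a y *: phi y + psi y - (a x *: phi x + psi x) =
    ((a y - a x) *: phi y + a x *: (phi y - phi x)) + (psi y - psi x).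
  by rewrite scalerBl scalerBr subrKA opprD addrACA.
have c1 : carrier H ((a y - a x) *: phi y) by exact: carrierZ.
have c2 : carrier H (a x *: (phi y - phi x)) by exact: carrierZ.
apply: le_lt_trans (ler_hnormD hH (carrierD hH c1 c2) dB) _.
have h1 := ler_hnormD hH c1 c2; rewrite !(hnormZ hH)// in h1.
have pM : hnorm H (phi y) <= M.
  rewrite -[X in hnorm H X](subrK (phi x)) addrC.
  by apply: le_trans (ler_hnormD hH cx cB) _; rewrite lerD2l ltW.
have h2 : `|a y - a x| * hnorm H (phi y) <= e / 3.
  apply: (@le_trans _ _ (e / 3 / M * M)); last by rewrite divfK// gt_eqF.
  by apply: ler_pM => //; [exact: hnorm_ge0|rewrite distrC ltW].
have h3 : `|a x| * hnorm H (phi y - phi x) <= e / 3.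
  apply: (@le_trans _ _ (L * (e / 3 / L))); last by rewrite mulrC divfK// gt_eqF.
  by apply: ler_pM; rewrite ?hnorm_ge0 ?lerDl ?(ltW py).
move: h1 h2 h3 qy; lra.
Qed.

Lemma hcontinuous_pow (V : lmodType R) (H : inner_space V) (hH : is_hilbert H) d n
    (X : set 'rV[R]_d) (F : 'rV[R]_d -> 'I_n -> V) x : open X -> X x ->
  (forall y i, X y -> carrier H (F y i)) ->
  (forall i, hcontinuous_at H (F ^~ i) x) -> hcontinuous_at (pow_space n H) F x.
Proof.
move=> oX Xx cF hF e e0.
(* Dividing by n + 1 makes the sum of the n terms strictly smaller than e and covers n = 0. *)
have en : 0 < e / n.+1%:R by rewrite divr_gt0.
have nX : nbhs x X by exact: open_nbhs_nbhs.
have nF : \forall y \near x, forall i, hnorm H (F y i - F x i) < e / n.+1%:R.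
  exact: (@filter_forall _ _ (fun i => [set y | hnorm H (F y i - F x i) < e / n.+1%:R])
    (nbhs x) (nbhs_filter x) (fun i => hF i _ en)).
apply: filterS2 nX nF => y Xy hy.
apply: le_lt_trans (hnorm_pow_le hH _) _.
  by move=> i; apply: carrierB => //; exact: cF.
apply: (@le_lt_trans _ _ (\sum_(i < n) e / n.+1%:R)).
  by apply: ler_sum => i _; exact/ltW/hy.
rewrite sumr_const card_ord -[_ *+ n]mulr_natr mulrAC ltr_pdivrMr// ltr_pM2l//.
by rewrite ltr_nat.
Qed.

(** Partial derivatives are directional, so the chain rule for ln is applied to [p0] restricted to a
    line; near x the score then equals (p0 y)^-1 * partial i p0 y. *)
Lemma score_continuous d (X : set 'rV[R]_d) (p0 : 'rV[R]_d -> R) i x :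
  open X -> C1_on X p0 -> (forall x, X x -> 0 < p0 x) -> X x ->
  {for x, continuous (fun y => score p0 y i)}.
Proof.
move=> oX C1 p0_gt0 Xx.
have scoreE y : X y -> score p0 y i = (p0 y)^-1 * partial i p0 y.
  move=> Xy; have [_ /(_ i)[dp _]] := C1 y Xy.
  rewrite /score /partial; set e := delta_mx 0 i.
  have y0 : y = y + (0 : R) *: e by rewrite scale0r addr0.
  rewrite y0 -line_derive -y0.
  have hp : is_derive (0 : R) 1 (fun t => p0 (y + t *: e)) ('D_e p0 y).
    by have := @line_is_derive R d p0 y e 0; rewrite -y0 => /(_ dp).
  have hl : is_derive (p0 (y + (0 : R) *: e)) 1 (@ln R) (p0 y)^-1.
    by rewrite -y0; apply: is_derive1_ln; exact: p0_gt0.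
  exact: (derive_val (is_derive := is_derive1_comp hl hp)).
have nX : nbhs x X by exact: open_nbhs_nbhs.
have [cp /(_ i)[_ cdp]] := C1 x Xx.
have lim : (p0 y)^-1 * partial i p0 y @[y --> x] --> (p0 x)^-1 * partial i p0 x.
  have px0 : p0 x != 0 by rewrite gt_eqF// p0_gt0.
  exact: (cvgM (cvgV px0 cp) cdp).
have eqs : {near x, (fun y => (p0 y)^-1 * partial i p0 y) =1 (fun y => score p0 y i)}.
  by apply: filterS nX => y Xy; rewrite scoreE.
suff : score p0 y i @[y --> x] --> score p0 x i by [].
rewrite (scoreE _ Xx); apply: (cvg_trans _ lim).
exact: near_eq_cvg eqs.
Qed.

Variables (d : nat) (X : set 'rV[R]_d) (p0 : 'rV[R]_d -> R)
  (k : 'rV[R]_d -> 'rV[R]_d -> R) (Hk : inner_space (X -> R^o)).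
Hypotheses (oX : open X) (C1 : C1_on X p0) (p0_gt0 : forall x, X x -> 0 < p0 x)
  (kC11 : C11_on X k) (rk : is_rkhs (restrict2 (X := X) k) Hk).
Local Notation H := (pow_space d Hk).
Local Notation xi := (stein_feature (X := X) p0 k).

Let hHk : is_hilbert Hk. Proof. by case: rk. Qed.

Let xiE x : X x -> xi x = fun i => score p0 x i *: kernel_section (X := X) k x
  + kernel_dsection (X := X) k i x.
Proof. by move=> Xx; rewrite /stein_feature patchT// inE. Qed.

Let xi0 x : ~ X x -> xi x = 0.
Proof. by move=> Xx; rewrite /stein_feature patchC// inE. Qed.

Let cks x := @carrier_kernel_section R d X k Hk rk x.
Let ckd i x := @carrier_kernel_dsection R d X k Hk oX kC11 rk i x.

Lemma carrier_stein_feature x : carrier H (xi x).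
Proof.
have [Xx|Xx] := pselect (X x); last by rewrite xi0// => i; exact: carrier0.
rewrite xiE// => i; apply: carrierD => //; last exact: ckd.
by apply: carrierZ => //; exact: cks.
Qed.

Lemma stein_feature_hcontinuous x : X x -> hcontinuous_at H xi x.
Proof.
move=> Xx; pose F y i := score p0 y i *: kernel_section (X := X) k y
  + kernel_dsection (X := X) k i y.
have cF y i : X y -> carrier Hk (F y i).
  move=> Xy; apply: carrierD => //; last exact: ckd.
  by apply: carrierZ => //; exact: cks.
have hF : hcontinuous_at H F x.
  apply: (hcontinuous_pow hHk oX Xx cF) => i.
  apply: (hcontinuous_affine hHk oX Xx (a := fun y => score p0 y i)) => //.
  - by move=> y Xy; exact: ckd.
  - exact: score_continuous C1 p0_gt0 Xx.
  - apply: (gram_hcontinuous oX rk Xx (g := k)) => //.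
    + by move=> y z Xy Xz; exact: ip_kernel_section.
    + by have [] := kC11 Xx Xx.
  - apply: (gram_hcontinuous oX rk Xx (g := partial2 i (partial1 i k))).
    + by move=> y Xy; exact: ckd.
    + by move=> y z Xy Xz; apply: ip_kernel_dsection.
    + by have [_ _ _ /(_ i i)[]] := kC11 Xx Xx.
move=> e e0; have nX : nbhs x X by exact: open_nbhs_nbhs.
by apply: filterS2 nX (hF e e0) => y Xy; rewrite (xiE Xx) (xiE Xy).
Qed.

Lemma stein_feature_smeas : smeas H xi.
Proof.
apply: (continuous_smeas (pow_space_hilbert hHk d) oX).
- exact: carrier_stein_feature.
- exact: xi0.
- exact: stein_feature_hcontinuous.
Qed.

End feature_continuity.

(** * Assembly of the minimax rate *)

Lemma sqrt_sqrt_powR (R : realType) (x : R) (n : nat) : 0 <= x ->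
  Num.sqrt (Num.sqrt x / n%:R) = x `^ (4^-1) / Num.sqrt n%:R.
Proof.
move=> x0; rewrite sqrtrM ?sqrtr_ge0// sqrtrV ?ler0n//; congr (_ * _).
have -> : (4^-1 : R) = 2^-1 * 2^-1 by rewrite -invfM -natrM.
by rewrite powRrM -!powR12_sqrt ?powR_ge0.
Qed.

Theorem corollary6 (R : realType) (A : R) (hA : 4 <= A) :
  exists2 C : R, 0 < C &
  forall (d : nat) (X : set 'rV[R]_d) (p0 : 'rV[R]_d -> R)
    (P0 : probability 'rV[R]_d R) (k : 'rV[R]_d -> 'rV[R]_d -> R)
    (Hk : inner_space (X -> R^o)),
  open X ->
  C1_on X p0 -> (forall x, X x -> 0 < p0 x) -> has_density X p0 P0 ->
  C11_on X k -> pd_kernel (restrict2 (X := X) k) ->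
  is_rkhs (restrict2 (X := X) k) Hk ->
  let H := pow_space d Hk in
  let xi := stein_feature (X := X) p0 k in
  let Cstar := stein_cov H xi P0 in
  let rate n := fine (trace H (Cstar \o Cstar)) `^ (4^-1) / Num.sqrt n%:R in
  let Q := stein_class H xi X P0 A in
  finite_energy H xi P0 ->
  is_bochner H P0 xi 0 ->
  (0 < trace H (Cstar \o Cstar))%E ->
  exists N : nat, forall n : nat, (N <= n)%N ->
  [/\ (minimax_risk H xi Q n <= (C * rate n)%:E)%E,
      ((rate n)%:E <= C%:E * minimax_risk H xi Q n)%E,
      rate n = Num.sqrt (hs_norm H Cstar / n%:R) &
      (max_risk H xi Q (ksd_u H xi (n := n)) <= (C * rate n)%:E)%E].
Proof.
(* The class allows E K ^ 2 up to A * tr (C_star ^ 2) and the rate is its fourth root, hence sqrt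
   (sqrt A). The lower constant is free of [A], since the perturbations already lie in the class for
   A = 4. *)
pose Cu := 72 * Num.sqrt (Num.sqrt A); pose Cl := 32 * pz_const R ^+ 2.
have A0 : 0 < A by apply: lt_le_trans hA.
have Cl0 : 0 < Cl by rewrite mulr_gt0// !exprn_gt0.
exists (Num.max Cu Cl); first by rewrite lt_max Cl0 orbT.
move=> d X p0 P0 k Hk oX C1 p0_gt0 dens kC11 _ rk H xi Cstar rate Q fe stein tr0.
have hH : is_hilbert H by apply: pow_space_hilbert; case: rk.
have sxi : smeas H xi by exact: stein_feature_smeas.
have hE := onb_trace_gt0 tr0.
pose k2 := (\int[(P0 \x P0)%E]_z (stein_kernel H xi z.1 z.2 ^+ 2))%R.
have trE : trace H (Cstar \o Cstar) = k2%:E by exact: trace_cov_sqr.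
have k20 : 0 < k2 by rewrite -lte_fin -trE.
have rateE n : rate n = Num.sqrt (Num.sqrt k2 / n%:R).
  by rewrite /rate trE /= sqrt_sqrt_powR// ltW.
have mX : measurable X by exact: sub_sigma_algebra.
(* The density formula assigns the same integral to [X] and to [setT]. *)
have PX : P0 X = 1%E.
  by rewrite -(probability_setT P0) (dens X)// (dens setT)// setIid setTI.
have [N0 hN0] := lower_risk hH sxi fe hE stein k20 mX PX hA.
have upper n : (2 <= n)%N -> (max_risk H xi Q (ksd_u H xi (n := n)) <= (Num.max Cu Cl * rate n)%:E)%E.
  move=> n2; apply: ge_ereal_sup => _ [P [PX1 feP EP] <-].
  have Ak0 : 0 < A * k2 by rewrite mulr_gt0.
  have KP : (\int[(P \x P)%E]_z (stein_kernel H xi z.1 z.2 ^+ 2))%R <= A * k2.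
    rewrite -lee_fin EFin_Rintegral; last exact: intg_kernel_sqr.
    by move: EP; rewrite trE -EFinM.
  apply: le_trans (ksd_u_risk hH sxi feP n2 Ak0 KP) _; rewrite lee_fin rateE.
  rewrite (sqrtrM _ (ltW A0)) -mulrA sqrtrM ?sqrtr_ge0// mulrA.
  by apply: ler_wpM2r; rewrite ?sqrtr_ge0// le_max lexx.
exists (maxn 2 N0) => n; rewrite geq_max => /andP[n2 nN]; split.
- apply: le_trans (upper n n2); apply: ereal_inf_lbound.
  by exists (ksd_u H xi (n := n)) => //; exact: measurable_ksd_u.
- have M0 : 0 < Num.max Cu Cl by rewrite lt_max Cl0 orbT.
  have -> : rate n = Num.max Cu Cl * (rate n / Num.max Cu Cl) by rewrite mulrC divfK// gt_eqF.
  rewrite EFinM; apply: lee_wpmul2l; first by rewrite lee_fin ltW.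
  apply: le_ereal_inf_tmp => _ [That mT <-].
  have := hN0 n nN That mT; rewrite -rateE => hl.
  have r0 : (0 <= max_risk H xi Q That)%E.
    apply: (@le_trans _ _ (\int[tuple_measure P0 n]_s `|That s - ksd H xi P0|%:E)%E).
      by apply: integral_ge0 => t _; rewrite lee_fin.
    apply: ereal_sup_ubound; exists P0 => //; split => //.
    rewrite trE -EFinM -EFin_Rintegral; last exact: intg_kernel_sqr.
    rewrite lee_fin ler_peMl ?(ltW k20)//; apply: le_trans hA; by rewrite ler1n.
  rewrite mulrC EFinM lee_pdivrMl//.
  by apply: le_trans hl _; apply: lee_wpmul2r => //; rewrite lee_fin le_max lexx orbT.
- by rewrite rateE (hs_norm_cov hH sxi fe hE).
- exact: upper.
Qed.
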